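(* Let $\mathscr E_t$ be the radius process of the pool model with particle intensity $\lambda$, and let $T_{\mathscr E}=\inf\{t\ge 0:\mathscr E_t=\infty\}$ be its explosion time. (1) For $\lambda>1$, $\{\mathscr E_t\}_{t\ge0}$ explodes almost surely at a finite time, i.e. $\mathbb P(T_{\mathscr E}<\infty)=1$. (2) For $\lambda=1$, $\{\mathscr E_t\}_{t\ge0}$ almost surely does not explode, i.e. $\mathbb P(T_{\mathscr E}=\infty)=1$.
   Context: Notation: $B(r)=\{x\in\mathbb R^2:|x|\le r\}$; for a set (or point configuration) $S$, $|S|$ is its cardinality. A continuous time and space random walk started from $x\in\mathbb R^2$ is $\mathbf r_t=x+\sum_{i=1}^{N(t)}\nu_i$, where $N$ is a rate-1 Poisson process in time and $\nu_i$ are i.i.d. standard Gaussian vectors in $\mathbb R^2$ (mean $0$, covariance $I_2$), independent of $N$. Pool model with intensity $\lambda>0$. Let $A_0=\{X^i\}_{i\ge1}$ be a Poisson point process in $\mathbb R^2$ of intensity $\lambda$; from each $X^i$ run an independent continuous time and space random walk $\mathbf r^i_t$, $\mathbf r^i_0=X^i$, and let $A_t=\{\mathbf r^i_t\}_i$. Each particle carries a label $a(i,t)\in\{0,1\}$ ($1$ = active, i.e. its mass has not yet been released to the pool). The pool at time $t$ is the disc $B(\mathscr E_t)$. Time zero: set $r_0=1/\sqrt\pi$, $\xi_1=|A_0\cap B(r_0)|$, $r_1=\sqrt{(1+\xi_1)/\pi}$, and recursively $\xi_{j+1}=|A_0\cap B(r_j)\setminus B(r_{j-1})|$, $r_{j+1}=\sqrt{r_j^2+\xi_{j+1}/\pi}$.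 Let $N=\inf\{j:\xi_j=0\}$. If $N=\infty$, put $\mathscr E_t\equiv\infty$ for all $t\ge0$ (explosion at time $0$). Otherwise $\mathscr E_0=r_N$ and $a(i,0)=1$ if $|X^i|>\mathscr E_0$, $a(i,0)=0$ otherwise. Later times: let $\hat\tau_0=0$. For $k\ge1$, if the model has not exploded, let $\hat\tau_k$ be the infimum of the times $t>\hat\tau_{k-1}$ at which some particle $i$ that is still active satisfies $|\mathbf r^i_t|\le\mathscr E_{\hat\tau_{k-1}}$. The radius $\mathscr E_t$ and the labels are constant on $[\hat\tau_{k-1},\hat\tau_k)$. At time $\hat\tau_k$ set $r_{-1}=\mathscr E_{\hat\tau_{k-1}}$, $r_0=\sqrt{r_{-1}^2+1/\pi}$ and recursively for $j\ge0$ let $\xi_{j+1}$ be the number of active particles located at time $\hat\tau_k$ in $B(r_j)\setminus B(r_{j-1})$ and $r_{j+1}=\sqrt{r_j^2+\xi_{j+1}/\pi}$. Let $N=\inf\{j:\xi_j=0\}$. If $N=\infty$, put $\mathscr E_t\equiv\infty$ for $t\ge\hat\tau_k$ (explosion at $\hat\tau_k$). Otherwise $\mathscr E_{\hat\tau_k}=r_N$, and every active particle located in $B(\mathscr E_{\hat\tau_k})$ at time $\hat\tau_k$ gets label $0$; a particle with label $0$ keeps label $0$ forever. Thus $a(i,t)=1$ if and only if $|\mathbf r^i_s|>\mathscr E_s$ for all $s\le t$. If $\hat\tau_k\uparrow\hat\tau_\infty<\infty$, then $\mathscr E_t=\infty$ for $t\ge\hat\tau_\infty$. When $\mathscr E_t=\infty$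 no particle is active. *)

(* Defs.v *)
From HB Require Import structures.
From mathcomp Require Import all_boot all_order all_algebra.
From mathcomp Require Import all_classical all_reals all_analysis measurable_realfun.

Set Implicit Arguments.
Unset Strict Implicit.
Unset Printing Implicit Defensive.

Import Order.TTheory GRing.Theory Num.Theory.
Import numFieldNormedType.Exports.

Local Open Scope classical_set_scope.
Local Open Scope ring_scope.

(* The carrier is [R * R] with the product sigma-algebra; the norm that the
   library puts on it is the sup norm, hence the explicit Euclidean one. *)
Notation plane R := (measurableTypeR R * measurableTypeR R)%type.

Definition euclid (R : realType) (x : plane R) : R :=
  Num.sqrt (x.1 ^+ 2 + x.2 ^+ 2).

Definition disc (R : realType) (r : \bar R) : set (plane R) :=
  [set x | ((euclid x)%:E <= r)%E].

Definition area (R : realType) : set (plane R) -> \bar R :=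
  (@lebesgue_measure R \x @lebesgue_measure R)%E.

Definition std_gaussian2 (R : realType) : set (plane R) -> \bar R :=
  (@normal_prob R 0 1 \x @normal_prob R 0 1)%E.

Section independence.
Context d (T : measurableType d) (R : realType) (P : probability T R).

Definition mutually_independent (I : Type) (F : I -> set (set T)) : Prop :=
  forall (n : nat) (s : 'I_n -> I), injective s ->
  forall A : 'I_n -> set T, (forall k, F (s k) (A k)) ->
  P (\bigcap_k A k) = (\prod_(k < n) P (A k))%E.

(* The sigma-algebra generated by the variables [Y i], for [i] in [D]. *)
Definition sigma_generated d' (S : measurableType d') (I : Type) (D : set I)
    (Y : I -> T -> S) : set (set T) :=
  <<s \bigcup_(i in D) preimage_set_system setT (Y i) measurable >>.

End independence.

Section randomness.
Context d (T : measurableType d) (R : realType) (P : probability T R).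

Definition point_count (X : nat -> T -> plane R) (A : set (plane R)) (w : T) :
    \bar R :=
  counting [set i | A (X i w)].

(* [poisson_prob r _] is the Poisson law of parameter [r], the Dirac mass at
   [0] when [r = 0]; its [nat] argument is a dummy. *)
Definition poisson_point_process (lambda : R) (X : nat -> T -> plane R) :=
  (forall A : set (plane R), measurable A -> (area A < +oo)%E -> forall n : nat,
     P [set w | point_count X A w = n%:R%:E] =
     poisson_prob (lambda * fine (area A)) 0 [set n]) /\
  (forall (n : nat) (A : 'I_n -> set (plane R)),
     (forall k, measurable (A k)) -> (forall k, (area (A k) < +oo)%E) ->
     trivIset setT A ->
     mutually_independent P (fun k : 'I_n =>
       preimage_set_system setT (point_count X (A k)) measurable)).

(* Only the times [t >= 0] are meaningful. *)
Definition poisson_process (rate : R) (N : R -> T -> nat) :=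
  [/\ forall w, N 0 w = 0%N,
      forall w (s t : R), 0 <= s -> s <= t -> (N s w <= N t w)%N,
      forall w (t : R), 0 <= t -> N s w @[s --> t^'+] --> N t w,
      forall s t : R, 0 <= s -> s <= t -> forall n : nat,
        P [set w | (N t w - N s w)%N = n] =
        poisson_prob (rate * (t - s)) 0 [set n] &
      forall (n : nat) (t : nat -> R), 0 <= t 0%N ->
        (forall k, t k <= t k.+1) ->
        mutually_independent P (fun k : 'I_n =>
          preimage_set_system setT (fun w => N (t k.+1) w - N (t k) w)%N
            measurable)].

Inductive source : Type :=
  | Positions
  | Clock of nat
  | Jump of nat & nat.

Definition source_events (X : nat -> T -> plane R) (N : nat -> R -> T -> nat)
    (nu : nat -> nat -> T -> plane R) (s : source) : set (set T) :=
  match s with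
  | Positions => sigma_generated setT X
  | Clock i => sigma_generated [set t | 0 <= t] (N i)
  | Jump i m => sigma_generated setT (fun _ : unit => nu i m)
  end.

Definition random_walks_from_ppp (lambda : R)
    (X : nat -> {RV P >-> plane R}) (N : nat -> R -> {RV P >-> nat})
    (nu : nat -> nat -> {RV P >-> plane R}) :=
  [/\ poisson_point_process lambda (fun i => X i),
      forall i, poisson_process 1 (fun t => N i t),
      forall i m (A : set (plane R)), measurable A ->
        distribution P (nu i m) A = std_gaussian2 A &
      mutually_independent P
        (source_events (fun i => X i) (fun i t => N i t) (fun i m => nu i m))].

Definition walk (X : nat -> T -> plane R) (N : nat -> R -> T -> nat)
    (nu : nat -> nat -> T -> plane R) (w : T) (i : nat) (t : R) : plane R :=
  X i w + \sum_(m < N i t w) nu i m w.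

End randomness.

(* The pool driven by deterministic trajectories [r i t].  Radii live in
   [\bar R], the value [+oo] standing for explosion. *)
Section pool.
Context (R : realType).
Local Open Scope ereal_scope.

Section cascade.
(* [n S] is the number of available particles in [S].  Step [j] stores the
   region already swept, [B(r_(j-1))], and the radius [r_j].  The swept region
   is initially empty at time zero, where [xi_1] counts all of [B(r_0)]. *)
Variables (n : set (plane R) -> \bar R) (swept0 : set (plane R)) (r0 : \bar R).

Fixpoint cascade (j : nat) : set (plane R) * \bar R :=
  if j is j'.+1 then
    let: (swept, r) := cascade j' in
    (disc r, sqrte (r ^+ 2 + n (disc r `\` swept) * (pi^-1)%:E))
  else (swept0, r0).

(* This is [xi_(j+1)]. *)
Definition cascade_count (j : nat) : \bar R :=
  n (disc (cascade j).2 `\` (cascade j).1).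

Definition cascade_radius : \bar R :=
  if pselect (exists j, cascade_count j == 0) is left ex
  then (cascade (ex_minn ex).+1).2 else +oo.

End cascade.

Record pool_state := PoolState {
  event_time : \bar R;
  state_radius : \bar R;
  active : set nat }.

Variable r : nat -> R -> plane R.

Definition initial_state : pool_state :=
  let n S := counting [set i | S (r i 0%R)] in
  let E := cascade_radius n set0 ((Num.sqrt pi)^-1)%:E in
  PoolState 0 E [set i | ~ disc E (r i 0%R)].

Definition next_contact (s : pool_state) : \bar R :=
  ereal_inf [set t%:E | t in [set t : R | event_time s < t%:E /\
    exists2 i, active s i & disc (state_radius s) (r i t)]].

(* If there is no further contact the state is frozen, with [event_time]
   equal to [+oo]; this is also what happens after an explosion. *)
Definition next_state (s : pool_state) : pool_state :=
  match next_contact s with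
  | t%:E =>
      let n S := counting [set i | active s i /\ S (r i t)] in
      let E := cascade_radius n (disc (state_radius s))
                 (sqrte (state_radius s ^+ 2 + (pi^-1)%:E)) in
      PoolState t%:E E [set i | active s i /\ ~ disc E (r i t)]
  | tau => PoolState tau (state_radius s) (active s)
  end.

Definition pool_states (k : nat) : pool_state := iter k next_state initial_state.

Definition pool_radius (t : R) : \bar R :=
  if pselect (exists k, (event_time (pool_states k) <= t%:E) &&
                        (t%:E < event_time (pool_states k.+1))) is left ex
  then state_radius (pool_states (ex_minn ex)) else +oo.

Definition explosion_time : \bar R :=
  ereal_inf [set t%:E | t in [set t : R | (0 <= t)%R /\ pool_radius t = +oo]].

End pool.

(* Main.v *)
Require Import Defs.
From HB Require Import structures.
From mathcomp Require Import all_boot all_order all_algebra.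
From mathcomp Require Import all_classical all_reals all_analysis measurable_realfun.
From mathcomp Require Import lra ring zify.

Import Order.TTheory GRing.Theory Num.Theory.
Import numFieldNormedType.Exports.

Local Open Scope classical_set_scope.
Local Open Scope ring_scope.

Set Implicit Arguments.
Unset Strict Implicit.
Unset Printing Implicit Defensive.

(** Every released particle adds area 1 to the pool.  Hence a pool of finite radius [E] at time [t]
    satisfies [1 + n <= pi * E ^+ 2], both for the number [n] of particles that have visited the
    disc of area 1 by time [t] and for the number [n] of particles in [B(E)] at time [t].
    Conversely, if at most [pi * rho ^+ 2 - 1] particles visit [B(rho)] before time [t], then the
    pool stays inside [B(rho)] until then.

    The particles together with their clocks and jumps form a marked Poisson process, so the number
    of particles with a given property of (starting point, trajectory) has variance equal to its
    mean, whence Chebyshev bounds.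

    If [lambda > 1], a walk has unbounded range, so the expected number of visitors of the disc of
    area 1 tends to infinity with time and forces [E] to be large; but by Chebyshev along the areas
    [n ^ 2], with high probability every large disc contains more particles than its area.

    If [lambda = 1], consider discs of areas [a_(n+1) = a_n + a_n ^ 2].  The number of particles that
    start in the [n]-th annulus is Poisson of mean [a_n ^ 2]; it falls [k * a_n] below its mean with
    probability bounded below, independently for all [n].  The particles that start in the [n]-th
    disc, and those that enter the [n+1]-st one from outside, number [O(a_n)] except on events of
    summable probability.  So almost surely some disc as above has few enough visitors. *)

(** * The deterministic pool *)

(** The growth of the pool depends on all particles at once. The pathwise inequalities remove this
    dependence: they only involve counts of independent walks up to one fixed time. The lower one
    may fail when two particles jump onto the pool together, hence the study of the clocks. The
    radius is random and correlated with the particles, so for [lambda > 1] the crowding must hold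
    for all large discs simultaneously. The areas [n ^ 2] are sparse enough for the Chebyshev
    errors, of order [1 / n ^ 2], to be summable, and dense enough for [lambda * n ^ 2] to exceed
    [(n + 1) ^ 2]. Small discs escape this argument, whence the detour through the visitors. For
    [lambda = 1] mean count and area agree, and only a downward fluctuation helps. An annulus of
    area [a ^ 2] has standard deviation [a]. This is the order of the count in the inner disc, of
    area [a], and of the flux across the outer circle, whose radius is of order [a]: a deficit of
    [k * a], with [k] a large constant, outweighs both. *)

Section counting_facts.
Context {R : realType}.
Local Open Scope ereal_scope.
Implicit Types A B : set nat.

Let mN A : measurable A. Proof. by []. Qed.

Lemma counting_ge0 A : 0 <= counting A :> \bar R.
Proof. exact: measure_ge0. Qed.

Lemma le_counting A B : A `<=` B -> counting A <= counting B :> \bar R.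
Proof. by move=> AB; apply: le_measure; rewrite ?inE. Qed.

Lemma countingU A B : A `&` B = set0 ->
  counting (A `|` B) = counting A + counting B :> \bar R.
Proof. by move=> AB; rewrite measureU. Qed.

Lemma counting_neq0 A : A !=set0 -> 1 <= counting A :> \bar R.
Proof.
move=> [i Ai]; rewrite (@le_trans _ _ (counting [set i]))//; last first.
  by apply: le_counting => j ->.
by rewrite /counting asboolT// fset_set1 finmap.cardfs1.
Qed.

Lemma counting_fin A : counting A < +oo :> \bar R -> finite_set A.
Proof. by rewrite /counting; case: ifPn => [/asboolP|]//; rewrite ltxx. Qed.

Lemma counting_natP A : counting A < +oo :> \bar R ->
  exists n : nat, counting A = n%:R%:E :> \bar R.
Proof. by rewrite /counting; case: ifPn => // _ _; eexists. Qed.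

Lemma counting_le1 A : (forall i j, A i -> A j -> i = j) ->
  counting A <= 1 :> \bar R.
Proof.
move=> A1; have [[i Ai]|nA] := pselect (A !=set0).
  rewrite (@le_trans _ _ (counting [set i]))//; last first.
    by rewrite /counting asboolT// fset_set1 finmap.cardfs1.
  by apply: le_counting => j Aj; rewrite /= (A1 i j).
rewrite (_ : A = set0) ?measure0//; apply/seteqP; split => // i Ai.
by apply: nA; exists i.
Qed.

End counting_facts.

(** * Area balance of a single cascade *)

Section cascade_facts.
Context {R : realType}.
Local Open Scope ereal_scope.

(** Area of the disc of radius [r]. The recursion adds squares of radii, so every step of the pool
    is additive in this quantity. *)
Definition darea (r : \bar R) : \bar R := r ^+ 2 * pi%:E.

Lemma darea_ge0 r : 0 <= r -> 0 <= darea r.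
Proof. by move=> r0; rewrite mule_ge0 ?expe_ge0// lee_fin pi_ge0. Qed.

Lemma pie_gt0 : 0 < (pi : R)%:E. Proof. by rewrite lte_fin pi_gt0. Qed.

Lemma le_darea r s : 0 <= r -> 0 <= s -> (darea r <= darea s) = (r <= s).
Proof.
move=> r0 s0; rewrite /darea lee_pmul2r ?pie_gt0//.
rewrite -lee_sqrt ?expe_ge0// !sqrte_sqr.
by rewrite !gee0_abs.
Qed.

Lemma darea_sqrte x : 0 <= x -> darea (sqrte x) = x * pi%:E.
Proof. by move=> x0; rewrite /darea sqr_sqrte. Qed.

Lemma muleVpi : (pi^-1)%:E * pi%:E = 1 :> \bar R.
Proof. by rewrite -EFinM mulVf// gt_eqF// pi_gt0. Qed.

Lemma darea_step r x : 0 <= r -> 0 <= x ->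
  darea (sqrte (r ^+ 2 + x * (pi^-1)%:E)) = darea r + x.
Proof.
move=> r0 x0; rewrite darea_sqrte; last first.
  by rewrite adde_ge0 ?expe_ge0// mule_ge0// lee_fin invr_ge0 pi_ge0.
rewrite ge0_muleDl ?expe_ge0//; last by rewrite mule_ge0// lee_fin invr_ge0 pi_ge0.
by rewrite -[x * _ * _]muleA muleVpi mule1.
Qed.

Lemma disc_sub (r s : \bar R) : r <= s -> disc r `<=` disc s.
Proof. by move=> rs x /le_trans; exact. Qed.

Section with_count.
Variables (I : set nat) (x : nat -> plane R) (swept0 : set (plane R)) (r0 : \bar R).
Let n S : \bar R := counting [set i | I i /\ S (x i)].
Hypothesis r0_ge0 : 0 <= r0.
Hypothesis sw0 : swept0 `<=` disc r0.
Let c := cascade n swept0 r0.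

Let n_ge0 S : 0 <= n S. Proof. exact: counting_ge0. Qed.

Let nS S S' : S `<=` S' -> n S <= n S'.
Proof. by move=> SS'; apply: le_counting => i [? ?]; split => //; exact: SS'. Qed.

Let nD S1 S2 S3 : S1 `<=` S2 -> S2 `<=` S3 -> n (S3 `\` S1) = n (S3 `\` S2) + n (S2 `\` S1).
Proof.
move=> S12 S23; rewrite /n -countingU.
  congr counting; apply/seteqP; split=> i /=.
    move=> [Ii [S3x S1x]]; have [|] := pselect (S2 (x i)); first by right.
    by left.
  move=> [[Ii [S3x S2x]]|[Ii [S2x S1x]]]; split => //; split => //.
    by move/S12.
  exact: S23.
by apply/seteqP; split=> i //= [[_ [_ ?]] [_ [? _]]].
Qed.

Lemma cascadeS j : c j.+1 = (disc (c j).2,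
  sqrte ((c j).2 ^+ 2 + n (disc (c j).2 `\` (c j).1) * (pi^-1)%:E)).
Proof. by rewrite /c /=; case: (cascade _ _ _ j). Qed.

Lemma cascade_inv j : [/\ 0 <= (c j).2, swept0 `<=` (c j).1, (c j).1 `<=` disc (c j).2 &
  darea (c j).2 = darea r0 + n ((c j).1 `\` swept0)].
Proof.
elim: j => [|j [r_ge0 sw sd aE]].
  split => //=; rewrite setDv.
  suff -> : n set0 = 0 by rewrite adde0.
  by rewrite /n (_ : [set i | _] = set0) ?measure0//; apply/seteqP; split => i //= [].
rewrite cascadeS /=.
have E : darea (c j.+1).2 = darea r0 + n (disc (c j).2 `\` swept0).
  by rewrite cascadeS darea_step// aE -addeA (nD sw sd) [X in _ + X]addeC.
have ge0 : 0 <= (c j.+1).2 by rewrite cascadeS sqrte_ge0.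
have le : (c j).2 <= (c j.+1).2.
  rewrite -le_darea// E aE leeD2l//; apply: nS.
  by move=> y [/sd ? ?].
split => //.
- by move: ge0; rewrite cascadeS.
- exact: subset_trans sw sd.
- by move: le; rewrite cascadeS/= => /disc_sub.
- by move: E; rewrite cascadeS.
Qed.

Lemma cascade_mono j : (c j).2 <= (c j.+1).2.
Proof.
have [g0 sw sd E] := cascade_inv j; have [g0' _ _ E'] := cascade_inv j.+1.
rewrite -le_darea// E E' leeD2l// cascadeS; apply: nS.
by move=> y [/sd ? ?].
Qed.

Lemma cascade_radius_ge : r0 <= cascade_radius n swept0 r0.
Proof.
rewrite /cascade_radius; case: pselect => [ex|_]; last by rewrite leey.
move: (ex_minn ex).+1; elim=> [//|j]; move/le_trans; apply.
exact: cascade_mono.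
Qed.

(** The cascade stops at an empty ring: its last disc is then the swept region itself, and
    [cascade_inv] becomes an equation for [E] alone. *)
Lemma darea_cascade_radius (E := cascade_radius n swept0 r0) :
  E < +oo -> darea E = darea r0 + n (disc E `\` swept0).
Proof.
rewrite /E /cascade_radius; case: pselect => [ex|_]; last by rewrite ltxx.
case: ex_minnP => N /eqP N0 _ _; rewrite -/c.
have [_ _ _ ->] := cascade_inv N.+1; congr (_ + n (_ `\` _)).
have -> : (c N.+1).1 = disc (c N).2 by rewrite cascadeS.
rewrite /cascade_count -/c in N0.
rewrite cascadeS N0 mul0e adde0 sqrte_sqr gee0_abs//.
by have [] := cascade_inv N.
Qed.

(** A disc with room for the initial area and for all the available particles in it is a barrier: no
    step can leave it, since what has been swept lies inside. *)
Lemma cascade_radius_le (rho : R) : (0 <= rho)%R ->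
  darea r0 + n (disc rho%:E `\` swept0) <= darea rho%:E ->
  cascade_radius n swept0 r0 <= rho%:E.
Proof.
move=> rho0 le.
have rle j : (c j).2 <= rho%:E.
  elim: j => [|j IH].
    rewrite -le_darea ?lee_fin//; apply: le_trans le; rewrite leeDl//.
  have [g0 _ _ E] := cascade_inv j.+1.
  rewrite -le_darea ?lee_fin// E; apply: le_trans le; rewrite leeD2l//.
  by apply: nS; rewrite cascadeS /= => y [/(disc_sub IH) ? ?].
rewrite /cascade_radius; case: pselect => [ex|nex]; first exact: rle.
exfalso; apply: nex.
have rhoy : darea rho%:E < +oo by rewrite /darea -EFin_expe -EFinM ltry.
have {}le : n (disc rho%:E `\` swept0) <= darea rho%:E.
  by apply: le_trans le; rewrite leeDr// darea_ge0.
have nfin := le_lt_trans le rhoy.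
apply: contrapT => /forallNP nex.
(* A cascade without an empty ring would sweep at least one new particle at each step, while
   [B(rho)] contains finitely many. *)
have cnt j : j%:R%:E <= n ((c j).1 `\` swept0).
  elim: j => [|j IH]; first exact: n_ge0.
  have [_ sw sd _] := cascade_inv j.
  rewrite cascadeS /= (nD sw sd) -natr1 EFinD addeC leeD//.
  have /eqP := nex j; rewrite /cascade_count -/c => H.
  apply: counting_neq0; apply/set0P/eqP => H0; move/eqP: H; apply.
  by apply/eqP; rewrite /n H0 measure0.
have [m mE] := counting_natP nfin.
have := cnt m.+1; rewrite leNgt => /negP; apply.
apply: (@le_lt_trans _ _ m%:R%:E); last by rewrite lte_fin ltr_nat.
rewrite -mE; apply: nS; rewrite cascadeS /= => y [/(disc_sub (rle m)) ? ?].
by split.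
Qed.

End with_count.
End cascade_facts.

(** * The pool along its successive contacts *)

Section pool_facts.
Context {R : realType}.
Local Open Scope ereal_scope.
Variable r : nat -> R -> plane R.

Let st k := pool_states r k.
Let tau k := event_time (st k).
Let rad k := state_radius (st k).
Let act k := active (st k).

Let r0 : \bar R := ((Num.sqrt pi)^-1)%:E.

Lemma r0_ge0 : 0 <= r0.
Proof. by rewrite lee_fin invr_ge0 sqrtr_ge0. Qed.

Lemma darea_r0 : darea r0 = 1.
Proof.
rewrite /darea /r0 -EFin_expe -EFinM exprVn sqr_sqrtr ?pi_ge0//.
by rewrite mulVf// gt_eqF// pi_gt0.
Qed.

Lemma stS k : st k.+1 = next_state r (st k). Proof. by []. Qed.

Lemma tau_le k : tau k <= tau k.+1.
Proof.
rewrite /tau stS /next_state.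
have : event_time (st k) <= next_contact r (st k).
  by apply: le_ereal_inf_tmp => _ [t [/ltW ? _] <-].
by case: (next_contact r (st k)).
Qed.

Lemma le_tau k l : (k <= l)%N -> tau k <= tau l.
Proof.
elim: l => [|l IH]; first by rewrite leqn0 => /eqP->.
by rewrite leq_eqVlt => /predU1P[->//|/IH/le_trans]; apply; exact: tau_le.
Qed.

Lemma tau0 : tau 0 = 0. Proof. by []. Qed.

Lemma tau_ge0 k : 0 <= tau k.
Proof. by rewrite -tau0; exact: le_tau. Qed.

Lemma step k : tau k.+1 < +oo -> exists t : R, [/\ tau k.+1 = t%:E,
  next_contact r (st k) = t%:E,
  rad k.+1 = cascade_radius (fun S => counting [set i | act k i /\ S (r i t)])
    (disc (rad k)) (sqrte (rad k ^+ 2 + (pi^-1)%:E)) &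
  act k.+1 = [set i | act k i /\ ~ disc (rad k.+1) (r i t)]].
Proof.
rewrite /tau /rad /act stS /next_state.
case E: (next_contact r (st k)) => [t| |] //=; first by exists t; split.
move=> _; exfalso.
have : event_time (st k) <= next_contact r (st k).
  by apply: le_ereal_inf_tmp => _ [t [/ltW ? _] <-].
rewrite E leeNy_eq => /eqP H; have := tau_ge0 k.
by rewrite /tau H.
Qed.


Lemma contact_lt (k : nat) (i : nat) (t : R) : next_contact r (st k) = t%:E ->
  forall s, tau k < s%:E -> (s < t)%R -> act k i -> ~ disc (rad k) (r i s).
Proof.
move=> ct s ks st' ai di; have : next_contact r (st k) <= s%:E.
  by apply: ereal_inf_lbound; exists s => //; split => //; exists i.
by rewrite ct lee_fin leNgt st'.
Qed.

Lemma initial_countE :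
  (fun S : set (plane R) => counting [set i | S (r i 0%R)] : \bar R) =
  (fun S => counting [set i | setT i /\ S (r i 0%R)]).
Proof.
apply/funext => S; congr counting.
by apply/seteqP; split=> i /= => [|[]].
Qed.

Lemma rad_ge k : tau k < +oo -> r0 <= rad k.
Proof.
elim: k => [_|k IH kfin].
  rewrite /rad /= initial_countE; apply: cascade_radius_ge => //; exact: r0_ge0.
have [t [_ _ -> _]] := step kfin.
have /IH r0k : tau k < +oo by apply: le_lt_trans kfin; exact: tau_le.
have rad0 : 0 <= rad k by apply: le_trans r0k; exact: r0_ge0.
apply: (@le_trans _ _ (sqrte (rad k ^+ 2 + (pi^-1)%:E))).
  rewrite (le_trans r0k)// -[leLHS]gee0_abs// -sqrte_sqr lee_sqrt.
    by rewrite leeDl// lee_fin invr_ge0 pi_ge0.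
  by rewrite adde_ge0// ?expe_ge0// lee_fin invr_ge0 pi_ge0.
apply: cascade_radius_ge.
  exact: sqrte_ge0.
apply: disc_sub.
rewrite -[leLHS]gee0_abs// -sqrte_sqr lee_sqrt.
  by rewrite leeDl// lee_fin invr_ge0 pi_ge0.
by rewrite adde_ge0// ?expe_ge0// lee_fin invr_ge0 pi_ge0.
Qed.

Lemma rad_ge0 k : tau k < +oo -> 0 <= rad k.
Proof. by move=> /rad_ge/(le_trans _); apply; exact: r0_ge0. Qed.

Lemma act_out k (t : R) i : tau k = t%:E -> act k i -> ~ disc (rad k) (r i t).
Proof.
case: k => [|k] tk.
  by move: tk; rewrite tau0 => -[<-].
have kfin : tau k.+1 < +oo by rewrite tk ltry.
have [u [tu _ _ ->]] := step kfin.
by move: tu; rewrite tk => -[<-] [].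
Qed.

(** An infinite disc contains every particle, whereas active particles lie outside the pool: after
    an explosion nothing is left to make a contact. *)
Lemma rad_fin k : tau k.+1 < +oo -> rad k < +oo.
Proof.
move=> kfin; have [t [_ ct _ _]] := step kfin.
have kfin' : tau k < +oo by apply: le_lt_trans kfin; exact: tau_le.
have : next_contact r (st k) < +oo by rewrite ct ltry.
move/ereal_inf_lt => [_ [s [_ [i ai _]] _] _].
rewrite ltey; apply/eqP => H.
have [u tu] : exists u, tau k = u%:E.
  by have := tau_ge0 k; move: kfin'; case: (tau k) => // u; exists u.
apply: (act_out tu ai); rewrite H /disc /=.
by rewrite leey.
Qed.

(** The cascade regards the old disc as already swept, so the particles that trigger the contact are
    not counted by it; the fixed increment 1 stands for them. The balance is written without
    subtraction because counts may be infinite. *)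
Lemma step_darea k : tau k.+1 < +oo -> rad k.+1 < +oo ->
  exists2 t, tau k.+1 = t%:E &
  darea (rad k.+1) + counting [set i | act k i /\ disc (rad k) (r i t)] =
  darea (rad k) + 1 + counting [set i | act k i /\ disc (rad k.+1) (r i t)].
Proof.
move=> kfin radfin; have [t [-> _ rE _]] := step kfin; exists t => //.
have kfin' : tau k < +oo by apply: le_lt_trans kfin; exact: tau_le.
have r0k := rad_ge0 kfin'.
have le : rad k <= sqrte (rad k ^+ 2 + (pi^-1)%:E).
  rewrite -[leLHS]gee0_abs// -sqrte_sqr lee_sqrt.
    by rewrite leeDl// lee_fin invr_ge0 pi_ge0.
  by rewrite adde_ge0// ?expe_ge0// lee_fin invr_ge0 pi_ge0.
have le' : rad k <= rad k.+1.
  rewrite rE; apply: le_trans (le) _; apply: cascade_radius_ge.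
    exact: sqrte_ge0.
  exact: disc_sub.
rewrite {1}rE darea_cascade_radius; [|exact: sqrte_ge0|exact: disc_sub|by rewrite -rE].
rewrite -rE -[X in _ + X]mul1e -[(pi^-1)%:E]mul1e darea_step// -!addeA; congr (_ + (_ + _)).
rewrite mul1e -countingU; last first.
  by apply/seteqP; split => // i [[_ [_ ?]] [_ ?]].
congr counting; apply/seteqP; split => i /=.
  by move=> [[ai [di _]]|[ai /(disc_sub le')]].
move=> [ai di]; have [|] := pselect (disc (rad k) (r i t)); first by right.
by left.
Qed.

Lemma actSC k (t : R) : tau k.+1 = t%:E ->
  counting (~` act k.+1) =
  counting (~` act k) + counting [set i | act k i /\ disc (rad k.+1) (r i t)] :> \bar R.
Proof.
move=> tk.
have kfin : tau k.+1 < +oo by rewrite tk ltry.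
have [u [tu _ _ ->]] := step kfin.
move: tu; rewrite tk => -[<-].
rewrite -countingU; last by apply/seteqP; split => // i [+ [? _]].
congr counting; apply/seteqP; split => i /=.
  move=> /not_andP[|/contrapT]; first by left.
  by have [|] := pselect (act k i); [right|left].
by move=> [ai [ ]//|[ai di] [_ ]].
Qed.

Lemma init_darea : rad 0 < +oo -> darea (rad 0) = 1 + counting (~` act 0).
Proof.
rewrite /rad /act /= initial_countE.
move=> fin; rewrite (darea_cascade_radius r0_ge0 (@sub0set _ _) fin).
rewrite -/r0 darea_r0; congr (_ + counting _).
apply/seteqP; split=> i /=; first by move=> [_ [? _]]; apply.
by move=> /contrapT di; split => //; split.
Qed.

Lemma tauS k : tau k.+1 = next_contact r (st k).
Proof. by rewrite /tau stS /next_state; case: next_contact. Qed.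

Lemma act_sub k : act k.+1 `<=` act k.
Proof.
by rewrite /act stS /next_state; case: next_contact => [t i []| |].
Qed.

Lemma act_out_next k i (s : R) : act k i -> tau k <= s%:E -> s%:E < tau k.+1 ->
  ~ disc (rad k) (r i s).
Proof.
move=> ai; rewrite le_eqVlt => /predU1P[ks _|ks sk di]; first exact: act_out ai.
have : next_contact r (st k) <= s%:E.
  by apply: ereal_inf_lbound; exists s => //; split => //; exists i.
by rewrite -tauS leNgt sk.
Qed.

(** All pool discs contain the one of radius [r0], so a particle that is still active has avoided
    this fixed disc all along. This spares following the radius in time. *)
Lemma act_out_r0 k i (s : R) : tau k < +oo -> act k i -> (0 <= s)%R -> s%:E <= tau k ->
  ~ disc r0 (r i s).
Proof.
move=> + + s0; elim: k => [k0 ai|k IH k1 ai].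
  rewrite tau0 lee_fin => s0'; have {s0 s0'}-> : s = 0%R by apply/eqP; rewrite eq_le s0 s0'.
  by move/(disc_sub (rad_ge k0)); exact: (@act_out 0).
have k0 : tau k < +oo by apply: le_lt_trans k1; exact: tau_le.
rewrite le_eqVlt => /predU1P[sk|sk].
  by move/(disc_sub (rad_ge k1)); exact: (@act_out k.+1).
have [sk'|ks] := leP s%:E (tau k); first by apply: IH => //; exact: act_sub.
move/(disc_sub (rad_ge k0)); apply: act_out_next => //; last exact: ltW.
exact: act_sub.
Qed.

(** * Lower bound on the area when no two particles jump together *)

Section lower.
Variable T : R.
Hypothesis nosim : forall t : R, (0 < t <= T)%R -> forall i j, i <> j ->
  exists2 s : R, (0 <= s < t)%R & ((forall u, (s <= u <= t)%R -> r i u = r i t) \/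
                               (forall u, (s <= u <= t)%R -> r j u = r j t)).

(** Of two active particles found in the pool at the contact time, one was already at the same place
    shortly before, which would have been an earlier contact. *)
Lemma contact_uniq k t : tau k.+1 = t%:E -> (t <= T)%R ->
  counting [set i | act k i /\ disc (rad k) (r i t)] <= 1 :> \bar R.
Proof.
move=> tk tT; apply: counting_le1 => i j /= [ai di] [aj dj].
have [u ku] : exists u, tau k = u%:E.
  have := tau_ge0 k; have := tau_le k; rewrite tk.
  by case: (tau k) => // u; exists u.
have ut : (u < t)%R.
  rewrite lt_neqAle; apply/andP; split.
    by apply/eqP => ut; apply: (act_out ku ai); rewrite ut.
  by rewrite -lee_fin -ku -tk tau_le.
have u0 : (0 <= u)%R by rewrite -lee_fin -ku tau_ge0.
have kfin : tau k.+1 < +oo by rewrite tk ltry.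
have [v [tv ct _ _]] := step kfin.
move: tv; rewrite tk => -[tv]; rewrite -tv in ct.
apply: contrapT => ij.
have [|s /andP[s0 st'] H] := nosim _ ij (t := t).
  by rewrite tT andbT (le_lt_trans u0).
(* A time before [t], late enough to follow the previous contact [u] and to fall in the interval
   where one of the two particles stands still. *)
pose w : R := ((Num.max s u + t) / 2)%R.
have mt : (Num.max s u < t)%R by rewrite gt_max st' ut.
have : (Num.max s u < w < t)%R by rewrite /w !midf_lt.
rewrite gt_max => /andP[/andP[sw uw] wt].
have kw : tau k < w%:E by rewrite ku lte_fin.
have swt : (s <= w <= t)%R by rewrite !ltW.
case: H => /(_ w swt) H.
- by apply: (contact_lt ct kw wt ai); rewrite H.
- by apply: (contact_lt ct kw wt aj); rewrite H.
Qed.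

(* A contact adds area 1 whatever the number of particles that it releases, so simultaneous
   contacts would break this inequality. *)
Lemma darea_lower k : tau k <= T%:E -> rad k < +oo ->
  1 + counting (~` act k) <= darea (rad k).
Proof.
elim: k => [_ /init_darea ->//|k IH kT rk].
have kfin : tau k.+1 < +oo by rewrite (le_lt_trans kT)// ltry.
have {}IH : 1 + counting (~` act k) <= darea (rad k).
  by apply: IH; [exact: le_trans (tau_le k) kT|exact: rad_fin].
have [t tk E] := step_darea kfin rk.
have tT : (t <= T)%R by rewrite -lee_fin -tk.
have le1 := contact_uniq tk tT.
rewrite (actSC tk) addeA.
rewrite -(@leeD2rE _ 1)//.
apply: (@le_trans _ _ (darea (rad k.+1) +
  counting [set i | act k i /\ disc (rad k) (r i t)])); last by rewrite leeD2l.
by rewrite E [leRHS]addeAC !leeD2r.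
Qed.

Lemma pool_mass (t : R) : (0 <= t <= T)%R -> pool_radius r t != +oo ->
  exists2 E : R, (0 <= E)%R &
  1 + counting [set i | (exists2 s : R, (0 <= s <= t)%R & disc r0 (r i s)) \/
                          disc E%:E (r i t)] <= darea E%:E.
Proof.
move=> /andP[t0 tT]; rewrite /pool_radius; case: pselect => [ex|]; last by rewrite eqxx.
case: ex_minnP => k /andP[kt tk] _ /= radfin.
have kfin : tau k < +oo by rewrite (le_lt_trans kt)// ltry.
have ge := rad_ge kfin.
have [E rE] : exists E, rad k = E%:E.
  have := rad_ge0 kfin; move: radfin; rewrite -/(rad k).
  by case: (rad k) => // E; exists E.
exists E; first by rewrite -lee_fin -rE rad_ge0.
rewrite -rE; apply: le_trans (darea_lower (k := k) _ _); last 2 first.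
- by rewrite (le_trans kt)// lee_fin.
- by rewrite rE ltry.
rewrite leeD2l//; apply: le_counting.
move=> i /= H ai; case: H => [[s /andP[s0 st'] di]|di].
  have [sk|ks] := leP s%:E (tau k); first exact: (act_out_r0 kfin ai s0 sk).
  apply: (act_out_next ai _ _ (disc_sub ge di)).
    by rewrite ltW.
  by apply: le_lt_trans tk; rewrite lee_fin.
exact: (act_out_next ai kt tk di).
Qed.
End lower.

(** * A disc with enough room confines the pool *)

Section upper.
Variables (T rho : R).
Hypothesis rho0 : (0 <= rho)%R.
Hypothesis rc : forall i (t : R), (0 <= t)%R ->
  exists2 e : R, (0 < e)%R & forall s, (t <= s < t + e)%R -> r i s = r i t.
Let vis := [set i | exists2 s, (0 <= s <= T)%R & disc rho%:E (r i s)].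
Hypothesis visE : 1 + counting vis <= darea rho%:E.

Let vis_fin : counting vis < +oo :> \bar R.
Proof.
have /le_lt_trans : counting vis <= darea rho%:E.
  by apply: le_trans visE; rewrite leeDr.
by apply; rewrite /darea -EFin_expe -EFinM ltry.
Qed.

(** Finitely many particles visit the disc, so their individual delays have a positive minimum. *)
Lemma common_delay (t : R) : (0 <= t)%R -> exists2 e : R, (0 < e)%R &
  forall i s, vis i -> (t <= s < t + e)%R -> r i s = r i t.
Proof.
move=> t0; have /counting_fin/finite_fsetP[A AE] := vis_fin.
have [e e0 eP] : exists2 e : R, (0 < e)%R &
    forall i s, i \in finmap.enum_fset A -> (t <= s < t + e)%R -> r i s = r i t.
  elim: (finmap.enum_fset A) => [|i l [e e0 IH]]; first by exists 1%R.
  have [e' e'0 H] := rc i t0; exists (Num.min e e'); first by rewrite lt_min e0.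
  move=> j s; rewrite inE => /predU1P[->|jl] /andP[ts].
    by rewrite addr_minr lt_min => /andP[_ se]; apply: H; rewrite ts.
  by rewrite addr_minr lt_min => /andP[se _]; apply: IH => //; rewrite ts.
exists e => // i s; rewrite AE => iA; exact: eP.
Qed.

(** The infimum in [next_contact] is a minimum: a contact that follows [t] within the common delay
    is made by a particle that has not moved since [t]. *)
Lemma contact_attained k (t : R) : tau k.+1 = t%:E -> (t < T)%R -> rad k <= rho%:E ->
  exists2 i, act k i & disc (rad k) (r i t).
Proof.
move=> tk tT rk.
have t0 : (0 <= t)%R by rewrite -lee_fin -tk tau_ge0.
have [e e0 eP] := common_delay t0.
have : next_contact r (st k) < (Num.min (t + e) T)%:E.
  by rewrite -tauS tk lte_fin lt_min tT ltrDl e0.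
move/ereal_inf_lt => [_ [s [ks [i ai di]] <-]]; rewrite lte_fin lt_min => /andP[ste sT].
have ts : (t <= s)%R.
  by rewrite -lee_fin -tk tauS; apply: ereal_inf_lbound; exists s => //; split => //; exists i.
exists i => //; rewrite -(eP i s) ?ts//.
exists s; first by rewrite (le_trans t0)//= ltW.
exact: disc_sub di.
Qed.

(* The last conjunct bounds the number of contacts before [T]: they cannot accumulate. *)
Lemma upper_inv k : tau k < T%:E -> [/\ rad k <= rho%:E,
  darea (rad k) <= 1 + counting (~` act k),
  ~` act k `<=` vis & k%:R%:E <= counting (~` act k) :> \bar R].
Proof.
elim: k => [T0|k IH kT].
  have rad0 : rad 0 <= rho%:E.
    rewrite /rad /= initial_countE; apply: (cascade_radius_le r0_ge0 (@sub0set _ _)) => //.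
    apply: le_trans visE; rewrite -/r0 darea_r0 leeD2l//; apply: le_counting.
    move=> i [_ [di _]]; exists 0%R => //.
    by rewrite lexx; move: T0; rewrite tau0 lte_fin => /ltW.
  split => //; last exact: counting_ge0.
    by rewrite init_darea// (le_lt_trans rad0)// ltry.
  move=> i /contrapT di; exists 0%R.
    by rewrite lexx; move: T0; rewrite tau0 lte_fin => /ltW.
  exact: disc_sub di.
have {}IH := IH (le_lt_trans (tau_le k) kT).
have [rk ak vk ck] := IH.
have kfin : tau k.+1 < +oo by rewrite (lt_trans kT)// ltry.
have kfin' : tau k < +oo by apply: le_lt_trans kfin; exact: tau_le.
have [t [tk _ rE aE]] := step kfin.
have tT : (t < T)%R by rewrite -lte_fin -tk.
have t0 : (0 <= t)%R by rewrite -lee_fin -tk tau_ge0.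
have [i ai di] := contact_attained tk tT rk.
have rk0 := rad_ge0 kfin'.
have le : rad k <= sqrte (rad k ^+ 2 + (pi^-1)%:E).
  rewrite -[leLHS]gee0_abs// -sqrte_sqr lee_sqrt.
    by rewrite leeDl// lee_fin invr_ge0 pi_ge0.
  by rewrite adde_ge0// ?expe_ge0// lee_fin invr_ge0 pi_ge0.
have rk1 : rad k.+1 <= rho%:E.
  rewrite rE; apply: cascade_radius_le => //; [exact: sqrte_ge0|exact: disc_sub|].
  apply: le_trans visE.
  rewrite -[in leLHS](mul1e (pi^-1)%:E) darea_step//.
  rewrite (@le_trans _ _ (1 + counting (~` act k) + 1 +
    counting [set i | act k i /\ (disc rho%:E `\` disc (rad k)) (r i t)]))//.
    by rewrite !leeD2r.
  rewrite -!addeA leeD2l//.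
  (* The unit of area added by the contact is paid for by the particle [i], which lies in the old
     disc and hence not in the ring outside it. *)
  apply: (@le_trans _ _ (counting (~` act k) + counting [set i | act k i /\ disc rho%:E (r i t)])).
    rewrite leeD2l//.
    rewrite (@le_trans _ _ (counting [set i | act k i /\ disc (rad k) (r i t)] +
      counting [set i | act k i /\ (disc rho%:E `\` disc (rad k)) (r i t)]))//.
      by rewrite leeD2r// counting_neq0//; exists i.
    rewrite -countingU; last by apply/seteqP; split => // j [[_ ?] [_ []]].
    apply: le_counting => j [[aj dj]|[aj [dj _]]]; split => //.
    exact: disc_sub dj.
  rewrite -countingU; last by apply/seteqP; split => // j [+ []].
  apply: le_counting => j [/vk//|[aj dj]]; exists t => //.
  by rewrite t0 ltW.
have rfin : rad k.+1 < +oo by rewrite (le_lt_trans rk1)// ltry.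
have le' : rad k <= rad k.+1.
  rewrite rE; apply: le_trans (le) _; apply: cascade_radius_ge.
    exact: sqrte_ge0.
  exact: disc_sub.
have L1 : 1 <= counting [set i | act k i /\ disc (rad k.+1) (r i t)] :> \bar R.
  by apply: counting_neq0; exists i; split => //; exact: disc_sub di.
split => //.
- have [u tu E] := step_darea kfin rfin.
  move: tu; rewrite tk => -[tu]; rewrite -{u}tu in E.
  rewrite (actSC tk) addeA -(@leeD2rE _ 1)//.
  apply: (@le_trans _ _ (darea (rad k.+1) + counting [set i | act k i /\ disc (rad k) (r i t)])).
    by rewrite leeD2l// counting_neq0//; exists i.
  by rewrite E [leRHS]addeAC !leeD2r.
- move=> j /=; rewrite aE /= => /not_andP[/vk//|/contrapT dj]; exists t; first by rewrite t0 ltW.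
  exact: disc_sub dj.
- by rewrite (actSC tk) -natr1 EFinD leeD.
Qed.

Lemma pool_bounded (t : R) : (0 <= t < T)%R -> pool_radius r t <= rho%:E.
Proof.
move=> /andP[t0 tT]; rewrite /pool_radius; case: pselect => [ex|nex].
  case: ex_minnP => k /andP[kt tk] _.
  by have [] := upper_inv (le_lt_trans kt (_ : t%:E < T%:E)); rewrite ?lte_fin.
exfalso; apply: nex.
(* Each contact releases at least one visitor, so there cannot be more contacts before [T] than
   visitors. *)
have [k tk] : exists k, t%:E < tau k.
  apply: contrapT => /forallNP H.
  have [m mE] := counting_natP vis_fin.
  have [|_ _ /le_counting vk ck] := @upper_inv m.+1.
    by apply: (@le_lt_trans _ _ t%:E); rewrite ?lte_fin// leNgt; apply/negP/H.
  by have := le_trans ck (vk R); rewrite mE lee_fin ler_nat ltnn.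
elim: k tk => [|k IH] tk; first by rewrite tau0 lte_fin ltNge t0 in tk.
have [kt|] := leP (tau k) t%:E; last exact: IH.
by exists k; rewrite kt.
Qed.
End upper.

End pool_facts.

(** * Areas of discs *)

Section push.
Context d d' (T1 : measurableType d) (T2 : measurableType d') (R : realType).
Variables (m : {measure set T1 -> \bar R}) (f : T1 -> T2).
Hypothesis mf : measurable_fun [set: T1] f.
Local Open Scope ereal_scope.

(** The proof of measurability is an argument, so that measure instances can be attached to the
    image measure. *)
Definition push of measurable_fun setT f : set T2 -> \bar R := pushforward m f.

Let push0 : push mf set0 = 0.
Proof. by rewrite /push /pushforward preimage_set0 measure0. Qed.

Let push_ge0 A : 0 <= push mf A. Proof. exact: measure_ge0. Qed.

Let push_sigma_additive : semi_sigma_additive (push mf).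
Proof. exact: (@measure_semi_sigma_additive _ _ _ (pushforward m f)). Qed.

HB.instance Definition _ := isMeasure.Build _ _ _ (push mf)
  push0 push_ge0 push_sigma_additive.
End push.

Section area_measure.
Context {R : realType}.
Local Open Scope ereal_scope.

HB.instance Definition _ := Measure.on (@area R).

Let area_sigma_finite : sigma_finite setT (@area R).
Proof.
have /sigma_finiteP[F [TF ndF Foo]] := sigma_finiteT (@lebesgue_measure R).
exists (fun n => F n `*` F n).
  rewrite -setXTT TF predeqE => -[x y]; split.
    move=> [/= [n _ Fnx] [k _ Gky]]; exists (maxn n k) => //; split.
    - by move: x Fnx; exact/subsetPset/ndF/leq_maxl.
    - by move: y Gky; exact/subsetPset/ndF/leq_maxr.
  by move=> [n _ []/= ? ?]; split; exists n.
move=> k; have [? ?] := Foo k.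
split; first exact: measurableX.
by rewrite /area product_measure1E// lte_mul_pinfty// ge0_fin_numE.
Qed.

HB.instance Definition _ := Measure_isSigmaFinite.Build _ _ _ (@area R)
  area_sigma_finite.


Lemma measurable_fun_sqrt : measurable_fun [set: R] (@Num.sqrt R).
Proof. by apply: continuous_measurable_fun; exact: sqrt_continuous. Qed.

Lemma measurable_euclid : measurable_fun [set: plane R] (@euclid R).
Proof.
apply: measurableT_comp measurable_fun_sqrt _.
apply: measurable_funD; apply: measurable_funX.
  exact: measurable_fst.
exact: measurable_snd.
Qed.

Lemma measurable_disc (r : \bar R) : measurable (@disc R r).
Proof.
rewrite (_ : disc r = setT `&` [set x | (euclid x)%:E <= r]); last by rewrite setTI.
apply: emeasurable_fun_infty_c => //.
by apply/measurable_EFinP; exact: measurable_euclid.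
Qed.

Lemma measurable_fun_addr (z : R) : measurable_fun setT
  (fun x : measurableTypeR R => (x + z)%R : measurableTypeR R).
Proof. by apply: measurable_funD => //; exact: measurable_cst. Qed.

Lemma lebesgue_shift (z : R) (A : set R) : measurable A ->
  lebesgue_measure ((fun x : measurableTypeR R => (x + z)%R : measurableTypeR R) @^-1` A) = lebesgue_measure A.
Proof.
move=> mA.
have mz : measurable_fun setT (fun x : measurableTypeR R => (x + z)%R : measurableTypeR R).
  by apply: measurable_funD => //; exact: measurable_cst.
pose nu := pushforward (@lebesgue_measure R) (fun x : measurableTypeR R => (x + z)%R : measurableTypeR R).
suff -> : lebesgue_measure A = nu A by [].
apply: lebesgue_measure_unique => //= _ [[a b]] _ <-.
rewrite /nu /= /pushforward.
rewrite (_ : _ @^-1` _ = `]a - z, b - z]%classic)%R; last first.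
  by apply/seteqP; split => x /=; rewrite !in_itv/= ltrBlDr lerBrDr.
rewrite !lebesgue_measure_itv/= !lte_fin ltrD2r.
by case: ifPn => // _; rewrite -!EFinB; congr (_%:E); lra.
Qed.

Lemma measurable_shift (z : plane R) : measurable_fun setT (fun x : plane R => (x + z)%R : plane R).
Proof.
apply/measurable_fun_pairP; split.
  by apply: measurable_funD; [exact: measurable_fst|exact: measurable_cst].
by apply: measurable_funD; [exact: measurable_snd|exact: measurable_cst].
Qed.

Lemma area_shift (z : plane R) (A : set (plane R)) : measurable A ->
  area [set x : plane R | A (x + z)%R] = area A.
Proof.
move=> mA.
transitivity (push (@area R) (measurable_shift z) A) => //.
apply/esym; apply: (@product_measure_unique _ _ _ _ _ (@lebesgue_measure R)
  (@lebesgue_measure R) (push (@area R) (measurable_shift z))) => // B C mB mC.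
have mS w (D : set (measurableTypeR R)) : measurable D -> measurable
    ((fun x : measurableTypeR R => (x + w)%R : measurableTypeR R) @^-1` D).
  by move=> mD; rewrite -[X in measurable X]setTI; exact: measurable_fun_addr.
transitivity (@lebesgue_measure R ((fun x : measurableTypeR R => (x + z.1)%R : measurableTypeR R) @^-1` B) *
  @lebesgue_measure R ((fun x : measurableTypeR R => (x + z.2)%R : measurableTypeR R) @^-1` C)).
  exact: product_measure1E (mS _ _ mB) (mS _ _ mC).
congr (_ * _); [exact: (lebesgue_shift z.1 mB)|exact: (lebesgue_shift z.2 mC)].
Qed.


Lemma sqr_le_sqrt (a y : R) : (0 <= a)%R ->
  (y ^+ 2 <= a)%R = (- Num.sqrt a <= y <= Num.sqrt a)%R.
Proof. by move=> a0; rewrite -ler_norml -sqrtr_sqr ler_sqrt. Qed.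

Lemma euclid_le (x : plane R) (r : R) : (0 <= r)%R ->
  (euclid x <= r)%R = (x.1 ^+ 2 + x.2 ^+ 2 <= r ^+ 2)%R.
Proof.
by move=> r0; rewrite -{1}[r]ger0_norm// -sqrtr_sqr ler_sqrt// sqr_ge0.
Qed.

Lemma euclid_section (r x y : R) : (0 < r)%R -> (- r <= x <= r)%R ->
  (euclid (x, y) <= r)%R =
  (- Num.sqrt (r ^+ 2 - x ^+ 2) <= y <= Num.sqrt (r ^+ 2 - x ^+ 2))%R.
Proof.
move=> r0 xr; have s0 : (0 <= r ^+ 2 - x ^+ 2)%R by rewrite subr_ge0; nra.
by have := sqr_le_sqrt y s0; rewrite lerBrDl => <-; exact: euclid_le (ltW r0).
Qed.

Lemma euclid_out (r x y : R) : (0 < r)%R -> ~ (- r <= x <= r)%R ->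
  ~ (euclid (x, y) <= r)%R.
Proof.
move=> r0 xr; rewrite (euclid_le _ (ltW r0)) => H; apply: xr.
have : (x ^+ 2 <= r ^+ 2)%R by apply: le_trans H; rewrite lerDl sqr_ge0.
by rewrite sqr_le_sqrt ?sqr_ge0// sqrtr_sqr ger0_norm// ltW.
Qed.

Lemma half_disc_param (r t : R) : (0 < r)%R -> (- (pi / 2) <= t <= pi / 2)%R ->
  (Num.sqrt (r ^+ 2 - (r * sin t) ^+ 2) *+ 2 * (r * cos t) =
   r ^+ 2 * (cos t ^+ 2 *+ 2))%R.
Proof.
move=> r0 tI.
have -> : (r ^+ 2 - (r * sin t) ^+ 2 = (r * cos t) ^+ 2)%R.
  have -> : (r ^+ 2 - (r * sin t) ^+ 2 = r ^+ 2 * (1 - sin t ^+ 2))%R by ring.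
  by rewrite -(cos2Dsin2 t); ring.
rewrite sqrtr_sqr ger0_norm; first by rewrite !expr2; ring.
by apply: mulr_ge0; [exact: ltW|exact: cos_ge0_pihalf].
Qed.

(** The substitution [x = r * sin t] turns the integrand into [r ^ 2 * 2 * cos t ^ 2], a primitive
    of which is [r ^ 2 * (t + cos t * sin t)]. *)
Lemma integral_half_disc (r : R) : (0 < r)%R ->
  \int[lebesgue_measure]_(x in `[(- r)%R, r]) (Num.sqrt (r ^+ 2 - x ^+ 2) *+ 2)%:E = darea r%:E.
Proof.
move=> r0; pose F (t : R) : R := (r * sin t)%R; pose b : R := (pi / 2)%R.
pose G (x : R) : R := (Num.sqrt (r ^+ 2 - x ^+ 2) *+ 2)%R.
have b0 : (0 < b)%R by rewrite divr_gt0 ?pi_gt0.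
have dF t : is_derive t (1:R)%R F (r * cos t)%R by apply: is_deriveZ.
have F'E : (F^`())%classic = (fun t => r * cos t)%R.
  by apply/funext => t; rewrite derive1E derive_val.
have cF : continuous F by move=> t; apply/differentiable_continuous/derivable1_diffP.
have cF' : continuous (fun t : R => r * cos t)%R.
  by move=> t; apply: cvgM; [exact: cvg_cst|exact: continuous_cos].
have Fb : F b = r by rewrite /F sin_pihalf mulr1.
have FNb : F (- b)%R = (- r)%R by rewrite /F sinN sin_pihalf mulrN1.
have cG : continuous G.
  move=> x; apply: (@cvgMn _ _ _ _ _ _ 2).
  apply: (cvg_comp (fun x : R => r ^+ 2 - x ^+ 2)%R (@Num.sqrt R)); last exact: sqrt_continuous.
  by apply: cvgB; [exact: cvg_cst|exact: exprn_continuous].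
have -> : \int[lebesgue_measure]_(x in `[(- r)%R, r]) (G x)%:E =
    \int[lebesgue_measure]_(x in `[F (- b)%R, F b]) (G x)%:E by rewrite FNb Fb.
rewrite (@integration_by_substitution_increasing _ F G); first last.
- exact: continuous_subspaceT.
- by split => //; [exact: cvg_at_right_filter (cF _)|exact: cvg_at_left_filter (cF _)].
- apply/cvg_ex; rewrite F'E; eexists; exact: cvg_at_left_filter (cF' _).
- apply/cvg_ex; rewrite F'E; eexists; exact: cvg_at_right_filter (cF' _).
- by move=> t _; rewrite F'E; exact: cF'.
- by move=> s t sI tI st; rewrite /F ltr_pM2l// ltr_sin.
- by rewrite ltW// (lt_trans _ b0)// oppr_lt0.
pose H (t : R) : R := (r ^+ 2 * (t + cos t * sin t))%R.
have dH t : is_derive t (1:R)%R H (r ^+ 2 * (cos t ^+ 2 *+ 2))%R.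
  apply: is_deriveZ; apply: is_derive_eq.
  rewrite /GRing.scale/= -[(sin t * _)%R]/(sin t * - sin t)%R.
  have := cos2Dsin2 t; rewrite !expr2 mulr2n; nra.
have cH : continuous H by move=> t; apply/differentiable_continuous/derivable1_diffP.
transitivity (\int[lebesgue_measure]_(x in `[(- b)%R, b]) (r ^+ 2 * (cos x ^+ 2 *+ 2))%:E).
  apply: eq_integral => t; rewrite inE/= in_itv/= => tI; congr EFin.
  by rewrite F'E; exact: half_disc_param.
rewrite (@continuous_FTC2 _ _ H).
- rewrite /H /b sinN cosN !cos_pihalf !mul0r /darea -EFinB -EFin_expe -EFinM; congr EFin; lra.
- by rewrite (lt_trans _ b0)// oppr_lt0.
- apply: continuous_subspaceT => t.
  apply: cvgM; first exact: cvg_cst.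
  apply: (@cvgMn _ _ _ _ _ _ 2).
  apply: (cvg_comp (@cos R) (fun x : R => x ^+ 2)%R); first exact: continuous_cos.
  exact: exprn_continuous.
- by split => //; [exact: cvg_at_right_filter (cH _)|exact: cvg_at_left_filter (cH _)].
- by move=> t _; rewrite derive1E derive_val.
Qed.

Lemma area_disc (r : R) : (0 < r)%R -> area (disc r%:E) = darea r%:E.
Proof.
move=> r0; rewrite -integral_half_disc// /area /product_measure1.
rewrite [RHS]integral_mkcond; apply: eq_integral => x _ /=.
rewrite patchE; have [xr|xr] := pselect (- r <= x <= r)%R; last rewrite ifF; first rewrite ifT.
- have s0 : (0 <= r ^+ 2 - x ^+ 2)%R by rewrite subr_ge0; nra.
  rewrite (_ : xsection _ _ = `[(- Num.sqrt (r ^+ 2 - x ^+ 2))%R, (Num.sqrt (r ^+ 2 - x ^+ 2))%R]%classic); last first.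
    apply/funext => y; apply/propext; rewrite /xsection /= inE /disc /= lee_fin in_itv /=.
    by split=> [h|h]; [rewrite -(euclid_section y r0 xr)|rewrite (euclid_section y r0 xr)].
  rewrite lebesgue_measure_itv /= lte_fin; case: ifPn.
    by rewrite -EFinB opprK mulr2n.
  rewrite -leNgt => H; have := sqrtr_ge0 (r ^+ 2 - x ^+ 2)%R => H'.
  by congr EFin; rewrite mulr2n; lra.
- by rewrite mem_set//= in_itv.
- rewrite (_ : xsection _ _ = set0) ?measure0//.
apply/seteqP; split => // y; rewrite /xsection /= inE /disc /= lee_fin.
exact: euclid_out.
- by apply/negbTE; rewrite notin_setE/= in_itv.
Qed.

End area_measure.

(** * Counts of a Poisson point process *)

Lemma eseries_setT (R : realType) (f : nat -> \bar R) :
  (\sum_(0 <= i <oo | i \in [set: nat]) f i = \sum_(0 <= i <oo) f i)%E.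
Proof. by apply: eq_eseriesl => i; rewrite in_setT. Qed.

Section discrete_integral.
Context d (T : measurableType d) (R : realType) (m : {measure set T -> \bar R}).
Local Open Scope ereal_scope.
Variables (C : T -> \bar R) (p : nat -> \bar R).
Hypothesis mC : measurable_fun setT C.
Hypothesis mCp : forall n : nat, m [set w | C w = n%:R%:E] = p n.
Hypothesis mfin : m setT < +oo.
Hypothesis sump : \sum_(0 <= n <oo) p n = m setT.

Lemma measurable_eq_ereal (x : \bar R) : measurable [set w | C w = x].
Proof.
by have := mC measurableT (emeasurable_set1 x); rewrite setTI.
Qed.

Lemma trivIset_eq_nat : trivIset setT (fun n : nat => [set w | C w = n%:R%:E]).
Proof.
apply/trivIsetP => i j _ _ ij; apply/seteqP; split => // w [/= ->] [] /eqP.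
by rewrite eqr_nat (negbTE ij).
Qed.

(** The masses [p n] exhaust [m], so the points where [C] is infinite or not a natural number are
    negligible. The measure is a general finite one because [discrete_integral] is also applied to
    [P] restricted to an event. *)
Lemma discrete_split (g : T -> \bar R) : measurable_fun setT g ->
  (forall w, 0 <= g w) ->
  \int[m]_w g w = \sum_(0 <= n <oo) \int[m]_(w in [set w | C w = n%:R%:E]) g w.
Proof.
move=> mg g0.
pose U := \bigcup_n [set w | C w = n%:R%:E].
have mU : measurable U by apply: bigcup_measurable => n _; exact: measurable_eq_ereal.
have mUT : m U = m setT.
  rewrite measure_bigcup//; [|by move=> n _; exact: measurable_eq_ereal|exact: trivIset_eq_nat].
  by rewrite -sump eseries_setT; apply: eq_eseriesr => n _; exact: mCp.
rewrite (@ge0_negligible_integral _ _ _ m setT (~` U))//; last first.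
- rewrite -setTD measureD//.
  rewrite setTI.
  by rewrite [X in _ - X]mUT subee// ge0_fin_numE.
- exact: measurableC.
rewrite setTD setCK ge0_integral_bigcup//.
- by move=> n; exact: measurable_eq_ereal.
- exact: measurable_funS mg.
- exact: trivIset_eq_nat.
Qed.

Lemma discrete_integral (f : \bar R -> \bar R) : measurable_fun setT f ->
  (forall w, 0 <= f (C w)) -> \int[m]_w f (C w) = \sum_(0 <= n <oo) f n%:R%:E * p n.
Proof.
move=> mf f0; rewrite discrete_split//; last exact: measurableT_comp.
apply: eq_eseriesr => n _; rewrite -mCp -integral_cst//; last exact: measurable_eq_ereal.
by apply: eq_integral => w; rewrite inE /= => ->.
Qed.
End discrete_integral.

Lemma integral_mrestr d (T : measurableType d) (R : realType)
    (m : {measure set T -> \bar R}) (D : set T) (mD : measurable D) (f : T -> \bar R) :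
  measurable_fun setT f -> (forall w, 0 <= f w)%E ->
  (\int[mrestr m mD]_w f w = \int[m]_(w in D) f w)%E.
Proof.
move=> mf f0.
rewrite (@ge0_negligible_integral _ _ _ _ setT (~` D))//; last first.
- by rewrite /= /mrestr setICl measure0.
- exact: measurableC.
rewrite setTD setCK; apply: eq_measure_integral => A mA AD.
by rewrite /= /mrestr setIidl.
Qed.

Section poisson_moments.
Context {R : realType}.
Local Open Scope ereal_scope.
Variable a : R.
Hypothesis a0 : (0 <= a)%R.
Let p n : \bar R := poisson_prob a 0 [set n].

Lemma poisson_ge0 n : 0 <= p n. Proof. exact: measure_ge0. Qed.

Lemma poisson_sum : \sum_(0 <= n <oo) p n = 1.
Proof.
rewrite -(@probability_setT _ _ _ (poisson_prob a 0 : probability _ R)).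
rewrite -(_ : \bigcup_n [set n] = [set: nat]); last first.
  by apply/seteqP; split => // n _; exists n.
rewrite measure_bigcup//; first by rewrite eseries_setT.
by move=> i j _ _ [k [/= -> ->]].
Qed.

(** The moments and the mode of the law are derived from this recursion, which also covers the Dirac
    mass at [a = 0]. *)
Lemma poissonS n : n.+1%:R%:E * p n.+1 = a%:E * p n.
Proof.
rewrite /p /poisson_prob; case: ifPn => [ap|]; last first.
  rewrite -leNgt => an; have -> : a = 0%R by apply/eqP; rewrite eq_le an.
  rewrite mul0e diracE (_ : _ \in _ = false) ?mule0//.
  by apply/negbTE; rewrite notin_setE.
rewrite !esum_set1 ?lee_fin ?poisson_pmf_ge0// -!EFinM; congr EFin.
rewrite /poisson_pmf ap factS natrM invfM exprS.
have x0 : n.+1%:R != 0%R :> R by rewrite pnatr_eq0.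
have y0 : (n`!)%:R != 0%R :> R by rewrite pnatr_eq0 -lt0n fact_gt0.
by move: (n.+1%:R) (n`!%:R) x0 y0 => x y x0 y0; field; rewrite x0 y0.
Qed.

Lemma poisson_mean : \sum_(0 <= n <oo) n%:R%:E * p n = a%:E.
Proof.
rewrite nneseries_recl//; last by move=> n _; rewrite mule_ge0 ?lee_fin ?poisson_ge0.
rewrite mul0e add0e -(@nneseries_addn _ (fun n => n%:R%:E * p n) 1); last first.
  by move=> n; rewrite mule_ge0 ?lee_fin ?poisson_ge0.
under eq_eseriesr do rewrite addn1 poissonS.
rewrite nneseriesZl; last by move=> *; exact: poisson_ge0.
by rewrite poisson_sum mule1.
Qed.

Lemma poisson_moment2 : \sum_(0 <= n <oo) (n%:R%:E * n%:R%:E) * p n = a%:E * a%:E + a%:E.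
Proof.
rewrite nneseries_recl//; last by move=> n _; rewrite !mule_ge0 ?lee_fin ?poisson_ge0.
rewrite !mul0e add0e -(@nneseries_addn _ (fun n => n%:R%:E * n%:R%:E * p n) 1); last first.
  by move=> n; rewrite !mule_ge0 ?lee_fin ?poisson_ge0.
under eq_eseriesr.
  move=> n _; rewrite addn1 -muleA poissonS muleCA -[n.+1]addn1 natrD EFinD.
  rewrite ge0_muleDl ?lee_fin// mul1e.
  over.
rewrite nneseriesZl; last first.
  by move=> n _; rewrite adde_ge0 ?mule_ge0 ?lee_fin ?poisson_ge0.
rewrite nneseriesD; last 2 first.
- by move=> n _ _; rewrite mule_ge0 ?lee_fin ?poisson_ge0.
- by move=> n _ _; exact: poisson_ge0.
by rewrite poisson_mean poisson_sum muleDr// ?fin_num_adde_defl// mule1.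
Qed.
End poisson_moments.

Section ppp_moments.
Context d (T : measurableType d) (R : realType) (P : probability T R).
Variables (lambda : R) (X : nat -> T -> plane R).
Hypothesis lambda0 : (0 < lambda)%R.
Hypothesis mX : forall i, measurable_fun setT (X i).
Hypothesis ppp : poisson_point_process P lambda X.
Local Open Scope ereal_scope.

Let C (A : set (plane R)) : T -> \bar R := point_count X A.

Lemma counting_series (B : nat -> Prop) :
  counting [set i | B i] = \sum_(0 <= i <oo) (`[< B i >]%:R)%:E :> \bar R.
Proof.
rewrite counting_dirac; apply: eq_eseriesr => i _.
by rewrite diracE; congr (_%:R%:E); congr nat_of_bool; apply/idP/asboolP => [/set_mem//|?]; rewrite inE.
Qed.

Lemma measurable_preim d' (S : measurableType d') (f : T -> S) (A : set S) :
  measurable_fun setT f -> measurable A -> measurable [set w | A (f w)].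
Proof. by move=> mf mA; rewrite -[X in measurable X]setTI; exact: mf. Qed.

Lemma measurable_asbool (B : set T) : measurable B ->
  measurable_fun setT (fun w => (`[< B w >]%:R)%:E : \bar R).
Proof.
move=> mB; rewrite (_ : (fun _ => _) = EFin \o \1_B).
  by apply/measurable_EFinP; exact: measurable_indic.
apply/funext => w /=; rewrite indicE; congr (_%:R%:E).
Qed.

Lemma measurable_counting (B : nat -> set T) : (forall i, measurable (B i)) ->
  measurable_fun setT (fun w => counting [set i | B i w] : \bar R).
Proof.
move=> mB; under eq_fun do rewrite counting_series.
apply: ge0_emeasurable_sum => // i x _.
by apply: measurable_asbool.
Qed.

Lemma integral_asbool (B : set T) (m : {measure set T -> \bar R}) : measurable B ->
  \int[m]_w (`[< B w >]%:R)%:E = m B.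
Proof.
move=> mB; rewrite -[in RHS](setIT B) -integral_indic//.
Qed.

Lemma integral_counting (B : nat -> set T) (m : {measure set T -> \bar R}) :
  (forall i, measurable (B i)) ->
  \int[m]_w counting [set i | B i w] = \sum_(0 <= i <oo) m (B i).
Proof.
move=> mB; under eq_integral do rewrite counting_series.
rewrite integral_nneseries//; last by move=> i; exact: measurable_asbool.
by apply: eq_eseriesr => i _; exact: integral_asbool.
Qed.

(** A product of counts is a count of ordered pairs, sliced along the first index. Empty and
    infinite sets are treated apart because of [0 * +oo = 0]. *)
Lemma counting_mul (A B : nat -> Prop) :
  counting [set i | A i] * counting [set i | B i] =
  \sum_(0 <= i <oo) counting [set j | A i /\ B j] :> \bar R.
Proof.
have [[i Ai]|nA] := pselect (exists i, A i); last first.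
  rewrite (_ : [set i | A i] = set0) ?measure0 ?mul0e.
    rewrite eseries0// => i _ _; rewrite (_ : [set _ | _] = set0) ?measure0//.
    by apply/seteqP; split => // j [Ai _]; apply: nA; exists i.
  by apply/seteqP; split => // j Aj; apply: nA; exists j.
have [[j Bj]|nB] := pselect (exists i, B i); last first.
  rewrite (_ : [set i | B i] = set0) ?measure0 ?mule0.
    rewrite eseries0// => k _ _; rewrite (_ : [set _ | _] = set0) ?measure0//.
    by apply/seteqP; split => // j [_ Bj]; apply: nB; exists j.
  by apply/seteqP; split => // j Bj; apply: nB; exists j.
have E k : counting [set j | A k /\ B j] = (`[< A k >]%:R)%:E * counting [set j | B j] :> \bar R.
  case: asboolP => Ak; rewrite ?mul1e ?mul0e.
    by congr counting; apply/seteqP; split => // ? [].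
  by rewrite (_ : [set _ | _] = set0) ?measure0//; apply/seteqP; split => // ? [].
under eq_eseriesr do rewrite E.
rewrite counting_series.
case: (counting [set i0 | B i0]) (counting_ge0 (R := R) [set i0 | B i0]) (counting_neq0 (R := R) (ex_intro B j Bj)) => [b| |] // b0 b1.
  under eq_eseriesr do rewrite muleC.
  by rewrite nneseriesZl// muleC.
rewrite (@nneseries_pinfty _ (fun k => (`[< A k >]%:R)%:E * +oo) xpredT i); last first.
  by rewrite asboolT// (_ : (true%:R)%:E = 1)// mul1e.
- by [].
- by move=> n _; rewrite mule_ge0// lee_fin.
rewrite gt0_muley// -counting_series.
by apply: lt_le_trans (counting_neq0 (ex_intro A i Ai)).
Qed.


Let a (A : set (plane R)) : R := (lambda * fine (area A))%R.

Let a0 A : (0 <= a A)%R.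
Proof. by rewrite mulr_ge0 ?fine_ge0// ltW. Qed.

Lemma measurable_point_count A : measurable A -> measurable_fun setT (C A).
Proof. by move=> mA; apply: measurable_counting => i; exact: measurable_preim. Qed.

Lemma point_count_law A n : measurable A -> area A < +oo ->
  P [set w | C A w = n%:R%:E] = poisson_prob (a A) 0 [set n].
Proof. by move=> mA Afin; case: ppp => + _; apply. Qed.

Lemma integral_point_count A (f : \bar R -> \bar R) : measurable A -> area A < +oo ->
  measurable_fun setT f -> (forall x, 0 <= x -> 0 <= f x) ->
  \int[P]_w f (C A w) = \sum_(0 <= n <oo) f n%:R%:E * poisson_prob (a A) 0 [set n].
Proof.
move=> mA Afin mf f0; apply: discrete_integral => //.
- exact: measurable_point_count.
- by move=> n; exact: point_count_law.
- by rewrite /= probability_setT ltry.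
- by rewrite poisson_sum /= probability_setT.
- by move=> w; rewrite f0// counting_ge0.
Qed.

Lemma mean_point_count A : measurable A -> area A < +oo ->
  \int[P]_w C A w = (a A)%:E.
Proof.
move=> mA Afin; rewrite -(poisson_mean (a0 A)).
exact: (@integral_point_count A id).
Qed.

Lemma moment2_point_count A : measurable A -> area A < +oo ->
  \int[P]_w (C A w * C A w) = (a A)%:E * (a A)%:E + (a A)%:E.
Proof.
move=> mA Afin; rewrite -(poisson_moment2 (a0 A)).
apply: (@integral_point_count A (fun x => x * x)) => //.
  exact: emeasurable_funM.
by move=> x x0; rewrite mule_ge0.
Qed.

Lemma point_count_indep (n : nat) (F : 'I_n -> set (plane R)) (E : 'I_n -> set (\bar R)) :
  (forall k, measurable (F k)) -> (forall k, area (F k) < +oo) -> trivIset setT F ->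
  (forall k, measurable (E k)) ->
  P (\bigcap_k [set w | E k (C (F k) w)]) = \prod_(k < n) P [set w | E k (C (F k) w)].
Proof.
move=> mF Ffin tF mE; have [_ /(_ n F mF Ffin tF)] := ppp.
move/(_ n id (fun _ _ => id)); apply => k.
by exists (E k) => //; rewrite setTI.
Qed.

Lemma point_count_joint A B k l : measurable A -> area A < +oo ->
  measurable B -> area B < +oo -> A `&` B = set0 ->
  P ([set w | C A w = k%:R%:E] `&` [set w | C B w = l%:R%:E]) =
  poisson_prob (a A) 0 [set k] * poisson_prob (a B) 0 [set l].
Proof.
move=> mA Afin mB Bfin AB; rewrite -!point_count_law//.
pose F (i : 'I_2) := if i == ord0 then A else B.
pose K (i : 'I_2) := if i == ord0 then k else l.
have := @point_count_indep 2 F (fun i => [set (K i)%:R%:E]).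
rewrite big_ord_recl big_ord1 /F /K /= => <-.
- congr (P _); apply/seteqP; split => w /=.
    by move=> [H1 H2] i _ /=; case: ifP.
  by move=> H; split; [exact: (H ord0)|exact: (H ord_max)].
- by move=> i; case: ifP.
- by move=> i; case: ifP.
- apply/trivIsetP => i j _ _; case: ifPn => [/eqP->|i0]; case: ifPn => [/eqP->|j0]//.
    by rewrite setIC.
  by case: i j i0 j0 => -[|[|//]] // p [] [|[|//]] // q _ _ /eqP []; exact: val_inj.
- by move=> i; exact: emeasurable_set1.
Qed.

(** Restricted to the event [C A = n], the measure still gives [C B] a Poisson law, up to the total
    mass; summing over [n] leaves the product of the means. *)
Lemma cross_point_count A B : measurable A -> area A < +oo ->
  measurable B -> area B < +oo -> A `&` B = set0 ->
  \int[P]_w (C A w * C B w) = (a A)%:E * (a B)%:E.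
Proof.
move=> mA Afin mB Bfin AB.
have mCA := measurable_point_count mA; have mCB := measurable_point_count mB.
rewrite (@discrete_split _ _ _ P (C A) (fun n => poisson_prob (a A) 0 [set n]))//; last 5 first.
- by move=> n; exact: point_count_law.
- by rewrite /= probability_setT ltry.
- by rewrite poisson_sum /= probability_setT.
- exact: emeasurable_funM.
- by move=> w; rewrite mule_ge0// counting_ge0.
transitivity (\sum_(0 <= n <oo) (n%:R%:E * poisson_prob (a A) 0 [set n]) * (a B)%:E).
  apply: eq_eseriesr => n _.
  have mD := measurable_eq_ereal mCA n%:R%:E.
  transitivity (\int[P]_(w in [set w | C A w = n%:R%:E]) (n%:R%:E * C B w)).
    by apply: eq_integral => w; rewrite inE /= => ->.
  rewrite ge0_integralZl//; last exact: measurable_funTS.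
  rewrite -muleA; congr (_ * _).
  rewrite -(integral_mrestr P mD)//.
  rewrite (@discrete_integral _ _ _ (mrestr P mD) (C B)
    (fun l => poisson_prob (a B) 0 [set l] * poisson_prob (a A) 0 [set n]) _ _ _ _ id)//; last first.
  - under eq_eseriesr do rewrite muleC.
    rewrite -(@fineK _ (poisson_prob (a A) 0 [set n])); last exact: fin_num_measure.
    rewrite nneseriesZl; last by move=> *; exact: measure_ge0.
    rewrite poisson_sum// mule1 fineK; last exact: fin_num_measure.
    by rewrite /= /mrestr setTI point_count_law.
  - by rewrite /= /mrestr setTI (le_lt_trans (probability_le1 P mD))// ltry.
  - by move=> l; rewrite /= /mrestr -point_count_joint// 1?setIC.
  rewrite -(@fineK _ (poisson_prob (a A) 0 [set n])); last exact: fin_num_measure.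
  under eq_eseriesr do rewrite muleA muleC.
  rewrite nneseriesZl; last by move=> *; rewrite mule_ge0 ?lee_fin// measure_ge0.
  by rewrite poisson_mean.
under eq_eseriesr do rewrite muleC.
rewrite nneseriesZl; last by move=> *; rewrite mule_ge0 ?lee_fin// measure_ge0.
by rewrite poisson_mean// muleC.
Qed.

(** The second factorial moment measure of the process, that is, the mean number of ordered pairs of
    points with distinct indices. *)
Let rho2 A B := \sum_(0 <= i <oo) \sum_(0 <= j <oo | j != i)
  P [set w | A (X i w) /\ B (X j w)].

Lemma measurable_pair_event A B i j : measurable A -> measurable B ->
  measurable [set w | A (X i w) /\ B (X j w)].
Proof. by move=> mA mB; apply: measurableI; exact: measurable_preim. Qed.

Lemma rho2E A B : measurable A -> measurable B ->
  \int[P]_w (C A w * C B w) = rho2 A B + \int[P]_w C (A `&` B) w.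
Proof.
move=> mA mB; have mAB i j := @measurable_pair_event A B i j mA mB.
under eq_integral do rewrite counting_mul.
rewrite integral_nneseries//; last first.
  by move=> i; exact: (@measurable_counting (fun j => [set w | A (X i w) /\ B (X j w)])).
rewrite integral_counting; last by move=> i; apply: measurable_preim => //; exact: measurableI.
rewrite addeC /rho2 -nneseriesD//; last first.
  by move=> i _ _; apply: nneseries_ge0 => *; exact: measure_ge0.
apply: eq_eseriesr => i _.
transitivity (\sum_(0 <= j <oo) P [set w | A (X i w) /\ B (X j w)]).
  exact: (@integral_counting (fun j => [set w | A (X i w) /\ B (X j w)]) P (mAB i)).
by rewrite (@nneseriesD1 _ (fun j => P [set w | A (X i w) /\ B (X j w)]) i xpredT).
Qed.

Lemma rho2_disjoint A B : measurable A -> area A < +oo ->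
  measurable B -> area B < +oo -> A `&` B = set0 -> rho2 A B = (a A)%:E * (a B)%:E.
Proof.
move=> mA Afin mB Bfin AB; rewrite -cross_point_count// rho2E// AB.
rewrite integral_counting; last by move=> i; exact: measurable_preim.
by rewrite eseries0 ?adde0// => i _ _; exact: measure0.
Qed.

Lemma rho2_diag A : measurable A -> area A < +oo -> rho2 A A = (a A)%:E * (a A)%:E.
Proof.
move=> mA Afin; have := moment2_point_count mA Afin.
rewrite rho2E// setIid mean_point_count// => /(congr1 (fun x => x - (a A)%:E)).
by rewrite !addeK.
Qed.

Lemma rho2Ul A A' B : measurable A -> measurable A' -> measurable B -> A `&` A' = set0 ->
  rho2 (A `|` A') B = rho2 A B + rho2 A' B.
Proof.
move=> mA mA' mB AA'; rewrite /rho2 -nneseriesD; last 2 first.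
- by move=> i _ _; apply: nneseries_ge0 => *; exact: measure_ge0.
- by move=> i _ _; apply: nneseries_ge0 => *; exact: measure_ge0.
apply: eq_eseriesr => i _; rewrite -nneseriesD//.
apply: eq_eseriesr => j _; rewrite -measureU; [|exact: measurable_pair_event..|].
  congr (P _); apply/seteqP; split => w /=; first by move=> [[?|?] ?]; [left|right].
  by move=> [[? ?]|[? ?]]; split => //; [left|right].
apply/seteqP; split => // w [[? _] [? _]].
by have : (A `&` A') (X i w) by []; rewrite AA'.
Qed.

Lemma rho2Ur A B B' : measurable A -> measurable B -> measurable B' -> B `&` B' = set0 ->
  rho2 A (B `|` B') = rho2 A B + rho2 A B'.
Proof.
move=> mA mA' mB AA'; rewrite /rho2 -nneseriesD; last 2 first.
- by move=> i _ _; apply: nneseries_ge0 => *; exact: measure_ge0.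
- by move=> i _ _; apply: nneseries_ge0 => *; exact: measure_ge0.
apply: eq_eseriesr => i _; rewrite -nneseriesD//.
apply: eq_eseriesr => j _; rewrite -measureU; [|exact: measurable_pair_event..|].
  congr (P _); apply/seteqP; split => w /=; first by move=> [? [?|?]]; [left|right].
  by move=> [[? ?]|[? ?]]; split => //; [left|right].
apply/seteqP; split => // w [[_ ?] [_ ?]].
by have : (B `&` B') (X j w) by []; rewrite AA'.
Qed.

(** By bilinearity on disjoint unions, cutting both sets along [A]&[B] reduces to two known cases:
    disjoint sets, where counts are independent, and equal sets, where removing the diagonal from
    [a ^ 2 + a] leaves [a ^ 2]. *)
Lemma rho2_prod A B : measurable A -> area A < +oo -> measurable B -> area B < +oo ->
  rho2 A B = (a A)%:E * (a B)%:E.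
Proof.
move=> mA Afin mB Bfin.
have le (D E : set (plane R)) : measurable D -> measurable E -> area E < +oo -> D `<=` E -> area D < +oo.
  by move=> mD mE Efin DE; apply: le_lt_trans Efin; apply: le_measure; rewrite ?inE.
have mW : measurable (A `&` B) by exact: measurableI.
have mA1 : measurable (A `\` B) by exact: measurableD.
have mB1 : measurable (B `\` A) by exact: measurableD.
have Wfin := le _ _ mW mA Afin (@subIsetl _ _ _).
have A1fin := le _ _ mA1 mA Afin (@subDsetl _ _ _).
have B1fin := le _ _ mB1 mB Bfin (@subDsetl _ _ _).
have aU D E : measurable D -> measurable E -> area D < +oo -> area E < +oo ->
    D `&` E = set0 -> a (D `|` E) = (a D + a E)%R.
  move=> mD mE Dfin Efin DE; rewrite /a measureU// fineD; first by rewrite mulrDr.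
    by rewrite ge0_fin_numE.
  by rewrite ge0_fin_numE.
have dA : (A `\` B) `&` (A `&` B) = set0 by rewrite setICA setDKI setI0.
have dB : (A `&` B) `&` (B `\` A) = set0.
  by apply/seteqP; split => // x [[? _] [_ ?]].
have EA : A = (A `\` B) `|` (A `&` B) by rewrite setUC setUIDK.
have EB : B = (A `&` B) `|` (B `\` A) by rewrite [A `&` B]setIC setUIDK.
rewrite [in LHS]EA [X in rho2 _ X]EB rho2Ul//; last first.
  exact: measurableU.
rewrite !rho2Ur// rho2_diag// !rho2_disjoint//; last first.
  by apply/seteqP; split => // x [[_ ?] [? _]].
have -> : a A = (a (A `\` B) + a (A `&` B))%R by rewrite -aU// -EA.
have -> : a B = (a (A `&` B) + a (B `\` A))%R by rewrite -aU// -EB.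
move: (a (A `\` B)) (a (A `&` B)) (a (B `\` A)) => x y z.
by rewrite -!EFinM -!EFinD; congr EFin; ring.
Qed.

End ppp_moments.

(** * Marked Poisson points *)

Section rect_unique.
Context (R : realType) d' (S : measurableType d').
Local Open Scope ereal_scope.

Let D (n : nat) : set (plane R) := disc n.+1%:R%:E.

Lemma area_disc_fin (n : nat) : area (D n) < +oo.
Proof. by rewrite area_disc// /darea -EFin_expe -EFinM ltry. Qed.

Lemma bigcup_disc : \bigcup_n D n = setT.
Proof.
apply/seteqP; split => // x _.
exists (Num.truncn (euclid x)) => //; rewrite /D /disc /= lee_fin ltW//.
by rewrite truncnS_gt.
Qed.

(** Rectangles over sets of finite area are stable under intersection and generate the product
    sigma-algebra. Finite area is imposed because the Poisson law is only prescribed there; the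
    discs [D n] then exhaust the plane. *)
Lemma rect_unique (m1 m2 : {measure set (plane R * S) -> \bar R}) :
  (forall A G, measurable A -> area A < +oo -> measurable G -> m1 (A `*` G) = m2 (A `*` G)) ->
  (forall n, m1 (D n `*` setT) < +oo) ->
  forall F, measurable F -> m1 F = m2 F.
Proof.
move=> m12 m1fin.
pose rects : set (set (plane R * S)) := [set F | exists A G,
  [/\ measurable A, area A < +oo, measurable G & F = A `*` G]].
move=> F mF; apply: (measure_unique rects (fun n => D n `*` setT)) => //.
- rewrite measurable_prod_measurableType; apply/seteqP; split.
    apply: smallest_sub; first exact: smallest_sigma_algebra.
    move=> _ [A mA [G mG <-]].
    rewrite -[A]setIT -bigcup_disc setI_bigcupr.
    rewrite (_ : _ `*` G = \bigcup_n ((A `&` D n) `*` G)); last first.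
      apply/seteqP; split => [[x s] /= [[n _ ADx] Gs]|[x s] /= [n _ [ADx Gs]]].
        by exists n.
      by split => //; exists n.
    apply: sigma_algebra_bigcup => n; apply: sub_sigma_algebra.
    exists (A `&` D n), G; split => //.
      by apply: measurableI => //; exact: measurable_disc.
    apply: le_lt_trans (area_disc_fin n); apply: le_measure; rewrite ?inE//.
      by apply: measurableI => //; exact: measurable_disc.
    exact: measurable_disc.
  apply: sub_sigma_algebra2 => _ [A [G [mA _ mG ->]]].
  by exists A => //; exists G.
- move=> _ _ [A [G [mA Afin mG ->]]] [A' [G' [mA' _ mG' ->]]].
  exists (A `&` A'), (G `&` G'); split; [exact: measurableI| |exact: measurableI|by rewrite setXI].
  apply: le_lt_trans Afin; apply: le_measure; rewrite ?inE//.
  exact: measurableI.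
- move=> n; exists (D n), setT; split => //; [exact: measurable_disc|exact: area_disc_fin].
- by rewrite -[RHS]setXTT -bigcup_disc; apply/seteqP; split => [[x s] [n _ [? _]]|[x s] [[n _ ?] _]]; [split => //; exists n|exists n].
- by move=> _ [A [G [mA Afin mG ->]]]; exact: m12.
Qed.

End rect_unique.

Section marked.
Context d (T : measurableType d) (R : realType) (P : probability T R).
Context d' (S : measurableType d').
Variables (Q : probability S R) (lambda : R).
Variables (X : nat -> T -> plane R) (Y : nat -> T -> S).
Variable (G0 : set (set S)).
Hypothesis lambda0 : (0 < lambda)%R.
Hypothesis mX : forall i, measurable_fun setT (X i).
Hypothesis ppp : poisson_point_process P lambda X.
Hypothesis mY : forall i, measurable_fun setT (Y i).
Hypothesis G0E : @measurable _ S = <<s G0 >>.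
Hypothesis G0I : setI_closed G0.
Hypothesis G0T : G0 setT.
Local Open Scope ereal_scope.

(** Second moments only see pairs of particles, so independence is asked for two marks at a time,
    and only on a class that generates the sigma-algebra. *)
Hypothesis ind : forall i j, i <> j -> forall A A' G G', measurable A -> measurable A' ->
  G0 G -> G0 G' ->
  P [set w | [/\ A (X i w), A' (X j w), G (Y i w) & G' (Y j w)]] =
  P [set w | A (X i w) /\ A' (X j w)] * Q G * Q G'.

Let mG0 G : G0 G -> measurable G.
Proof. by rewrite G0E; exact: sub_sigma_algebra. Qed.

Let Qfin G : measurable G -> Q G \is a fin_num.
Proof. by move=> mG; exact: fin_num_measure. Qed.

(** With all other factors frozen, both sides are finite measures in [G], then in [G']; they agree
    on the intersection-stable class [G0], hence everywhere. *)
Lemma ind_ext i j : i <> j -> forall A A' G G', measurable A -> measurable A' ->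
  measurable G -> measurable G' ->
  P [set w | [/\ A (X i w), A' (X j w), G (Y i w) & G' (Y j w)]] =
  P [set w | A (X i w) /\ A' (X j w)] * Q G * Q G'.
Proof.
move=> ij.
pose E A A' := [set w | A (X i w) /\ A' (X j w)].
have mE A A' : measurable A -> measurable A' -> measurable (E A A').
  by move=> mA mA'; apply: measurableI; exact: measurable_preim.
have mYE k G : measurable G -> measurable [set w | G (Y k w)].
  by move=> mG; exact: measurable_preim.
have step1 A A' G G' : measurable A -> measurable A' -> measurable G -> G0 G' ->
    P [set w | [/\ A (X i w), A' (X j w), G (Y i w) & G' (Y j w)]] = P (E A A') * Q G * Q G'.
  move=> mA mA' mG GG'; have mG' := mG0 GG'.
  have mEG : measurable (E A A' `&` [set w | G' (Y j w)]) by apply: measurableI; auto.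
  have c0 : (0 <= fine (P (E A A') * Q G'))%R by rewrite fine_ge0// mule_ge0.
  pose m1 := push (mrestr P mEG) (mY i).
  pose m2 := mscale (NngNum c0) Q.
  have E1 B : m1 B = P [set w | [/\ A (X i w), A' (X j w), B (Y i w) & G' (Y j w)]].
    rewrite /m1 /push /pushforward /= /mrestr; congr (P _).
    by apply/seteqP; split => w /= => [[? [[? ?] ?]]|[? ? ? ?]].
  have E2 B : m2 B = P (E A A') * Q B * Q G'.
    rewrite /m2 /mscale/= fineK; last by rewrite fin_numM// ?Qfin// fin_num_measure//; exact: mE.
    by rewrite -!muleA [Q B * _]muleC.
  rewrite -E1 -E2; apply: (measure_unique G0 (fun=> setT)) => //.
  - exact: bigcup_const.
  - move=> B GB; rewrite [LHS](E1 B) [RHS](E2 B); exact: ind.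
  - move=> _; rewrite [ltLHS](E1 setT); apply: le_lt_trans (probability_le1 _ _) _; rewrite ?ltry//.
    rewrite (_ : [set _ | _] = E A A' `&` [set w | G' (Y j w)])//.
    by apply/seteqP; split => w /= => [[? ? _ ?]|[[? ?] ?]].
move=> A A' G G' mA mA' mG mG'.
have mEG : measurable (E A A' `&` [set w | G (Y i w)]) by apply: measurableI; auto.
have c0 : (0 <= fine (P (E A A') * Q G))%R by rewrite fine_ge0// mule_ge0.
pose m1 := push (mrestr P mEG) (mY j).
pose m2 := mscale (NngNum c0) Q.
have E1 B : m1 B = P [set w | [/\ A (X i w), A' (X j w), G (Y i w) & B (Y j w)]].
  rewrite /m1 /push /pushforward /= /mrestr; congr (P _).
  by apply/seteqP; split => w /= => [[? [[? ?] ?]]|[? ? ? ?]].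
have E2 B : m2 B = P (E A A') * Q G * Q B.
  by rewrite /m2 /mscale/= fineK// fin_numM// ?Qfin// fin_num_measure//; exact: mE.
rewrite -E1 -E2; apply: (measure_unique G0 (fun=> setT)) => //.
- exact: bigcup_const.
- move=> B GB; rewrite [LHS](E1 B) [RHS](E2 B); exact: step1.
- move=> _; rewrite [ltLHS](E1 setT); apply: le_lt_trans (probability_le1 _ _) _; rewrite ?ltry//.
  rewrite (_ : [set _ | _] = E A A' `&` [set w | G (Y i w)])//.
  by apply/seteqP; split => w /= => [[? ? ? _]|[[? ?] ?]].
Qed.

Lemma ind1 i A G : measurable A -> measurable G ->
  P [set w | A (X i w) /\ G (Y i w)] = P [set w | A (X i w)] * Q G.
Proof.
move=> mA mG; have := @ind_ext i i.+1 _ A setT G setT mA measurableT mG measurableT.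
rewrite probability_setT mule1 => H.
transitivity (P [set w | [/\ A (X i w), setT (X i.+1 w), G (Y i w) & setT (Y i.+1 w)]]).
  by congr (P _); apply/seteqP; split => w /= => [[]|[]].
rewrite H; last by apply/eqP; rewrite neq_ltn ltnSn.
by congr (P _ * _); apply/seteqP; split => w /= => [[]|].
Qed.

Let Z i w := (X i w, Y i w).

Let mZ i : measurable_fun setT (Z i). Proof. exact: measurable_fun_pair. Qed.

Definition intensity := mscale (NngNum (ltW lambda0)) (@area R \x Q).

Let intensityE A G : measurable A -> measurable G ->
  intensity (A `*` G) = lambda%:E * area A * Q G.
Proof.
move=> mA mG; rewrite /intensity /mscale /= -muleA; congr (_ * _).
exact: product_measure1E.
Qed.

Let a (A : set (plane R)) : R := (lambda * fine (area A))%R.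

Let aE A : measurable A -> area A < +oo -> (a A)%:E = lambda%:E * area A.
Proof. by move=> mA Afin; rewrite /a EFinM fineK// ge0_fin_numE. Qed.

Let intensity_fin n : intensity (disc n.+1%:R%:E `*` setT) < +oo.
Proof.
rewrite intensityE//; last exact: measurable_disc.
by rewrite probability_setT mule1 -aE ?ltry//; [exact: measurable_disc|exact: area_disc_fin].
Qed.

(** Both sides are measures in [F], and on a rectangle the law of the mark factors out of the mean
    number of points. *)
Lemma sum_intensity F : measurable F ->
  \sum_(0 <= i <oo) P [set w | F (X i w, Y i w)] = intensity F.
Proof.
move=> mF; pose m1 := mseries (fun i => push P (mZ i)) 0.
have R1 A G : measurable A -> area A < +oo -> measurable G -> m1 (A `*` G) = intensity (A `*` G).
  move=> mA Afin mG; rewrite [RHS]intensityE// -aE//.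
  rewrite -(mean_point_count lambda0 mX ppp mA Afin).
  rewrite (@integral_counting _ _ _ (fun i => [set w | A (X i w)])); last first.
    by move=> i; exact: measurable_preim.
  rewrite -(@fineK _ (Q G)) ?Qfin// muleC -nneseriesZl//.
  by apply: eq_eseriesr => i _; rewrite fineK ?Qfin// muleC -ind1//.
apply: (@rect_unique R _ S m1 intensity) => // n.
by rewrite [ltLHS]R1//; [exact: measurable_disc|exact: area_disc_fin].
Qed.

Let rho2 F F' := \sum_(0 <= i <oo) \sum_(0 <= j <oo | j != i)
  P [set w | F (X i w, Y i w) /\ F' (X j w, Y j w)].

Let mZE i F : measurable F -> measurable [set w | F (X i w, Y i w)].
Proof. by move=> mF; exact: (measurable_preim (mZ i)). Qed.

(** With one slot fixed, the sum over pairs is a series of measures in the other slot; the zero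
    measure fills the missing diagonal terms. *)
Let mrho F' (mF' : measurable F') i j : {measure set (plane R * S) -> \bar R} :=
  if j != i then (push (mrestr P (mZE j mF')) (mZ i) : {measure set (plane R * S) -> \bar R})
  else (mzero : {measure set (plane R * S) -> \bar R}).

Let mrho' F (mF : measurable F) i j : {measure set (plane R * S) -> \bar R} :=
  if j != i then (push (mrestr P (mZE i mF)) (mZ j) : {measure set (plane R * S) -> \bar R})
  else (mzero : {measure set (plane R * S) -> \bar R}).

Let rho2_l F' (mF' : measurable F') F :
  mseries (fun i => mseries (mrho mF' i) 0) 0 F = rho2 F F'.
Proof.
apply: eq_eseriesr => i _; rewrite [RHS]eseries_mkcond; apply: eq_eseriesr => j _.
by rewrite /mrho; case: ifP.
Qed.

Let rho2_r F (mF : measurable F) F' :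
  mseries (fun i => mseries (mrho' mF i) 0) 0 F' = rho2 F F'.
Proof.
apply: eq_eseriesr => i _; rewrite [RHS]eseries_mkcond; apply: eq_eseriesr => j _.
rewrite /mrho'; case: ifP => //= _.
by rewrite /push /pushforward /mrestr setIC.
Qed.

Let rho2_rect A G A' G' : measurable A -> area A < +oo -> measurable G ->
  measurable A' -> area A' < +oo -> measurable G' ->
  rho2 (A `*` G) (A' `*` G') = intensity (A `*` G) * intensity (A' `*` G').
Proof.
move=> mA Afin mG mA' Afin' mG'; rewrite [X in _ = X * _]intensityE// [X in _ = _ * X]intensityE//.
rewrite -!aE// muleACA -(rho2_prod lambda0 mX ppp mA Afin mA' Afin').
have GGfin : Q G * Q G' \is a fin_num by rewrite fin_numM ?Qfin.
rewrite -(fineK GGfin) muleC -nneseriesZl; last first.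
  by move=> i _; apply: nneseries_ge0 => *; exact: measure_ge0.
apply: eq_eseriesr => i _; rewrite -nneseriesZl//.
apply: eq_eseriesr => j ji; rewrite fineK// muleC muleA -ind_ext//; last first.
  by apply/eqP; rewrite eq_sym.
by congr (P _); apply/seteqP; split => w /= => [[[? ?] [? ?]]|[]].
Qed.

(** The product formula is extended from rectangles one slot at a time. Finiteness of [intensity F]
    allows it to be used as a real scaling factor. *)
Lemma rho2_intensity F F' : measurable F -> measurable F' -> intensity F < +oo ->
  rho2 F F' = intensity F * intensity F'.
Proof.
move=> mF mF' Ffin.
have step1 A' G' F1 : measurable A' -> area A' < +oo -> measurable G' -> measurable F1 ->
    rho2 F1 (A' `*` G') = intensity F1 * intensity (A' `*` G').
  move=> mA' Afin' mG' mF1.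
  have mAG : measurable (A' `*` G') by exact: measurableX.
  have AGfin : intensity (A' `*` G') < +oo.
    by rewrite intensityE// -aE// -(fineK (Qfin mG')) -EFinM ltry.
  have c0 : (0 <= fine (intensity (A' `*` G')))%R by rewrite fine_ge0.
  pose m1 := mseries (fun i => mseries (mrho mAG i) 0) 0.
  pose m2 := mscale (NngNum c0) intensity.
  have E2 B : m2 B = intensity B * intensity (A' `*` G').
    by rewrite /m2 /mscale/= fineK ?ge0_fin_numE// muleC.
  rewrite -rho2_l -E2; apply: (@rect_unique R _ S m1 m2) => //.
    by move=> A G mA Afin mG; rewrite [LHS]rho2_l [RHS](E2 (A `*` G)) rho2_rect.
  move=> n; rewrite [ltLHS]rho2_l rho2_rect//; [|exact: measurable_disc|exact: area_disc_fin].
  by rewrite lte_mul_pinfty// ge0_fin_numE.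
have c0 : (0 <= fine (intensity F))%R by rewrite fine_ge0.
pose m1 := mseries (fun i => mseries (mrho' mF i) 0) 0.
pose m2 := mscale (NngNum c0) intensity.
have E2 B : m2 B = intensity F * intensity B.
  by rewrite /m2 /mscale/= fineK ?ge0_fin_numE// muleC.
rewrite -rho2_r -E2; apply: (@rect_unique R _ S m1 m2) => //.
  by move=> A G mA Afin mG; rewrite [LHS]rho2_r [RHS](E2 (A `*` G)) step1.
move=> n; rewrite [ltLHS]rho2_r step1//; [|exact: measurable_disc|exact: area_disc_fin].
by rewrite lte_mul_pinfty// ge0_fin_numE.
Qed.

Let Zc F w := counting [set i | F (X i w, Y i w)] : \bar R.

Lemma marked_mean F : measurable F -> \int[P]_w Zc F w = intensity F.
Proof.
move=> mF; rewrite -sum_intensity//.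
exact: (@integral_counting _ _ _ (fun i => [set w | F (X i w, Y i w)]) P (fun i => mZE i mF)).
Qed.

Lemma marked_moment2 F : measurable F -> intensity F < +oo ->
  \int[P]_w (Zc F w * Zc F w) = intensity F * intensity F + intensity F.
Proof.
move=> mF Ffin; rewrite -(rho2_intensity mF mF Ffin) -(sum_intensity mF).
under eq_integral do rewrite counting_mul.
rewrite integral_nneseries//; last first.
  move=> i; apply: (@measurable_counting _ _ _ (fun j => [set w | F (X i w, Y i w) /\ F (X j w, Y j w)])) => j.
  by apply: measurableI; exact: mZE.
rewrite addeC -nneseriesD//; last first.
  by move=> i _ _; apply: nneseries_ge0 => *; exact: measure_ge0.
apply: eq_eseriesr => i _.
transitivity (\sum_(0 <= j <oo) P [set w | F (X i w, Y i w) /\ F (X j w, Y j w)]).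
  apply: (@integral_counting _ _ _ (fun j => [set w | F (X i w, Y i w) /\ F (X j w, Y j w)]) P) => j.
  by apply: measurableI; exact: mZE.
rewrite (@nneseriesD1 _ (fun j => P [set w | F (X i w, Y i w) /\ F (X j w, Y j w)]) i xpredT)//.
by congr (P _ + _); apply/seteqP; split => w /= => [[]|].
Qed.

Lemma measurable_Zc F : measurable F -> measurable_fun setT (Zc F).
Proof. by move=> mF; apply: (@measurable_counting _ _ _ (fun i => [set w | F (X i w, Y i w)])) => i; exact: mZE. Qed.

(* Chebyshev: the variance of the number of points in [F] is its mean. *)
Lemma marked_chebyshev F (m u : R) (E : set T) : measurable F -> intensity F = m%:E ->
  measurable E -> (forall w, E w -> Zc F w <= (m - u)%:E \/ (m + u)%:E <= Zc F w) -> (0 <= u)%R ->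
  (u ^+ 2)%:E * P E <= m%:E.
Proof.
move=> mF Fm mE HE u0.
have m0 : (0 <= m)%R by rewrite -lee_fin -Fm.
have mZc := measurable_Zc mF.
have Zc0 w : 0 <= Zc F w by exact: counting_ge0.
have mZ2 : measurable_fun setT (fun w => Zc F w * Zc F w) by exact: emeasurable_funM.
have m2Z : measurable_fun setT (fun w => (2 * m)%:E * Zc F w) by exact: emeasurable_funM.
have m1E : measurable_fun setT (fun w => (\1_E w)%:E : \bar R).
  by apply/measurable_EFinP; exact: measurable_indic.
have mu1E : measurable_fun setT (fun w => (u ^+ 2)%:E * (\1_E w)%:E) by exact: emeasurable_funM.
have m20 : 0 <= (2 * m)%:E by rewrite lee_fin mulr_ge0.
have u20 : 0 <= (u ^+ 2)%:E by rewrite lee_fin sqr_ge0.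
have mm0 : 0 <= (m ^+ 2)%:E by rewrite lee_fin sqr_ge0.
(* This integrates the bound of [(Z - m) ^ 2] from below by [u ^ 2] on [E], with the cross term
   moved to the other side since [Z] may be infinite. *)
have : \int[P]_w (Zc F w * Zc F w + (m ^+ 2)%:E) >=
       \int[P]_w ((2 * m)%:E * Zc F w + (u ^+ 2)%:E * (\1_E w)%:E).
  apply: ge0_le_integral => //.
  - by move=> w _; rewrite adde_ge0// mule_ge0// lee_fin.
  - exact: emeasurable_funD.
  - exact: emeasurable_funD.
  - move=> w _; rewrite indicE; have := HE w; have := Zc0 w.
    case: (Zc F w) => [z| |]//=; last by rewrite mulyy addye ?leey.
    rewrite lee_fin => z0 H; rewrite -!EFinM -!EFinD lee_fin.
    case: (pselect (E w)) => Ew.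
      by rewrite mem_set// mulr1; case: (H Ew); rewrite lee_fin => zm; nra.
    by rewrite memNset// mulr0; have := sqr_ge0 (z - m)%R; nra.
have E1 : \int[P]_w (Zc F w * Zc F w + (m ^+ 2)%:E) = (m * m + m + m ^+ 2)%:E.
  rewrite (@ge0_integralD _ _ _ P setT measurableT)//; last first.
    by move=> w _; rewrite mule_ge0.
  by rewrite marked_moment2// ?Fm ?ltry// integral_cst// [X in _ + _ * X]probability_setT mule1.
have E2 : \int[P]_w ((2 * m)%:E * Zc F w + (u ^+ 2)%:E * (\1_E w)%:E) =
    (2 * m * m)%:E + (u ^+ 2)%:E * P E.
  rewrite (@ge0_integralD _ _ _ P setT measurableT)//; last 2 first.
  - by move=> w _; rewrite mule_ge0// lee_fin.
  - by move=> w _; rewrite mule_ge0.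
  rewrite !ge0_integralZl// marked_mean// Fm integral_indic// setIT.
  by [].
rewrite E1 E2 -(fineK (fin_num_measure P E mE)) -!EFinM -EFinD !lee_fin => H; nra.
Qed.

End marked.

(** * Marks carried by the walks *)

Section push_probability.
Context d d' (T1 : measurableType d) (T2 : measurableType d') (R : realType).
Variables (m : probability T1 R) (f : T1 -> T2).
Hypothesis mf : measurable_fun [set: T1] f.

Let push_setT : push m mf setT = 1%E.
Proof. by rewrite /push /pushforward; exact: (@probability_setT _ _ _ m). Qed.

HB.instance Definition _ := Measure_isProbability.Build _ _ _ (push m mf) push_setT.
End push_probability.

HB.instance Definition _ := gen_eqMixin source.

Lemma nat_law d (T : measurableType d) (R : realType) (P : probability T R)
    (f : T -> nat) (mf : measurable_fun setT f) (q : {measure set nat -> \bar R}) :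
  (forall k, P [set w | f w = k] = q [set k]) ->
  forall V : set nat, P [set w | V (f w)] = q V.
Proof.
move=> H V.
have E (m : {measure set nat -> \bar R}) :
    (m V = \sum_(0 <= k <oo | k \in V) m [set k])%E.
  rewrite -measure_bigcup//; last by move=> ? ? _ _ [? [/= -> ->]].
  by congr (m _); apply/seteqP; split => [k Vk|k [? Vk ->]//]; exists k.
rewrite -[LHS]/(push P mf V) [LHS]E [RHS]E.
by apply: eq_eseriesr => k _; exact: H.
Qed.

Section seq_independence.
Context d (T : measurableType d) (R : realType) (P : probability T R).
Local Open Scope ereal_scope.

Lemma mutually_independent_seq (I : eqType) (F : I -> set (set T)) (l : seq I) (A : I -> set T) :
  mutually_independent P F -> uniq l -> (forall s, s \in l -> F s (A s)) ->
  P [set w | forall s, s \in l -> A s w] = \prod_(s <- l) P (A s).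
Proof.
move=> ind ul FA; pose t := in_tuple l.
have := ind (size l) (tnth t) _ (fun k => A (tnth t k)) _.
rewrite (big_tnth _ _ l) => <-.
- congr (P _); apply/seteqP; split => w /=.
    by move=> H k _; apply: H; exact: mem_tnth.
  by move=> H s /(@tnthP _ _ t)[k ->]; exact: H.
- exact/tuple_uniqP.
- by move=> k; apply: FA; exact: mem_tnth.
Qed.

End seq_independence.

Section cylinders.
Context {R : realType}.

(** Boxes, rather than arbitrary events on the first [n] coordinates: they are stable under
    intersection and their probabilities are products over coordinates. *)
Definition cylinder (n : nat) (B : nat -> set (plane R)) : set (nat -> plane R) :=
  [set s | forall m, (m < n)%N -> B m (s m)].

Definition cylinders : set (set (nat -> plane R)) :=
  [set A | exists n B, (forall m, measurable (B m)) /\ A = cylinder n B].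

Definition marks := g_sigma_algebraType cylinders.

Lemma cylindersI : setI_closed cylinders.
Proof.
move=> _ _ [n [B [mB ->]]] [n' [B' [mB' ->]]].
exists (maxn n n'), (fun m => (if (m < n)%N then B m else setT) `&` (if (m < n')%N then B' m else setT)).
split.
  by move=> m; apply: measurableI; case: ifP.
apply/seteqP; split => s /=.
  by move=> [H H'] m _; split; case: ifP; auto.
move=> H; split => m mn.
  by have [] := H m (leq_trans mn (leq_maxl _ _)); rewrite mn.
by have [_] := H m (leq_trans mn (leq_maxr _ _)); rewrite mn.
Qed.

Lemma cylindersT : cylinders setT.
Proof. by exists 0%N, (fun=> setT); split => //; apply/seteqP; split. Qed.

Lemma measurable_marks : @measurable _ marks = <<s cylinders >>.
Proof. by []. Qed.

Lemma measurable_coord m : measurable_fun [set: marks] (fun s : marks => s m : plane R).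
Proof.
move=> _ B mB; rewrite setTI; apply: sub_sigma_algebra.
exists m.+1, (fun k => if k == m then B else setT); split.
  by move=> k; case: ifP.
apply/seteqP; split => s /=.
  by move=> Bs k _; case: eqP => // ->.
by move/(_ m (ltnSn m)); rewrite eqxx.
Qed.

Lemma measurable_to_marks d (T : measurableType d) (Y : T -> nat -> plane R) :
  (forall m, measurable_fun setT (fun w => Y w m)) ->
  measurable_fun setT (Y : T -> marks).
Proof.
move=> mY; refine (@measurability _ _ T marks setT Y cylinders _ _) => //.
move=> _ [_ [n [B [mB ->]]] <-]; rewrite setTI.
rewrite (_ : _ @^-1` _ = \bigcap_(m in `I_n) ((fun w => Y w m) @^-1` B m)).
  apply: fin_bigcap_measurable => // m _.
  by rewrite -[X in measurable X]setTI; exact: mY.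
by apply/seteqP; split => w /=.
Qed.

End cylinders.
Arguments marks R : clear implicits.

Section walk_marks.
Context d (T : measurableType d) (R : realType) (P : probability T R).
Variables (lambda : R) (X : nat -> T -> plane R) (N : nat -> R -> T -> nat)
  (nu : nat -> nat -> T -> plane R).
Hypothesis mX : forall i, measurable_fun setT (X i).
Hypothesis mN : forall i t, measurable_fun setT (N i t).
Hypothesis mnu : forall i m, measurable_fun setT (nu i m).
Hypothesis poissonN : forall i, poisson_process P 1 (N i).
Hypothesis gaussian : forall i m (A : set (plane R)), measurable A ->
  P [set w | A (nu i m w)] = std_gaussian2 A.
Hypothesis indep : mutually_independent P (source_events X N nu).
Variable t : R.
Hypothesis t0 : 0 <= t.
Local Open Scope ereal_scope.

(* The clock reading is coded as a point of the plane, so that a mark is a plain sequence of points. *)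
Definition mark (i : nat) (w : T) : marks R :=
  fun k => if k is m.+1 then nu i m w else ((N i t w)%:R, 0)%R.

Lemma measurable_mark i : measurable_fun setT (mark i).
Proof.
apply: measurable_to_marks => -[|m] /=; last exact: mnu.
apply: measurable_fun_pair => /=; last exact: measurable_cst.
exact: (@measurableT_comp _ _ _ _ _ _ (fun n : nat => n%:R : measurableTypeR R)).
Qed.

Let mark_source (i k : nat) : source := if k is m.+1 then Jump i m else Clock i.

Lemma law_N i k : P [set w | N i t w = k] = poisson_prob t 0 [set k].
Proof.
have [N0 _ _ + _] := poissonN i.
move=> /(_ 0%R t (lexx _) t0 k); rewrite subr0 mul1r => <-.
by congr (P _); apply/seteqP; split => w /=; rewrite N0 subn0.
Qed.

Lemma law_N_set i (V : set nat) : P [set w | V (N i t w)] = poisson_prob t 0 V.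
Proof. by apply: nat_law => // k; exact: law_N. Qed.

Lemma mark_law i k (B : set (plane R)) : measurable B ->
  P [set w | B (mark i w k)] = P [set w | B (mark 0 w k)].
Proof.
case: k => [|m] mB /=; last by rewrite !gaussian.
by rewrite [LHS](law_N_set i [set n | B (n%:R, 0)%R]) [RHS](law_N_set 0 [set n | B (n%:R, 0)%R]).
Qed.

Lemma mark_source_inj i k j l : mark_source i k = mark_source j l -> i = j /\ k = l.
Proof. by case: k => [|k]; case: l => [|l] //= []; [move=> ->|move=> -> ->]. Qed.

Definition pos_event A A' i j := [set w | A (X i w) /\ A' (X j w)].

Lemma pos_event_source i j A A' : measurable A -> measurable A' ->
  source_events X N nu Positions (pos_event A A' i j).
Proof.
move=> mA mA'; apply: (@measurableI _ (g_sigma_algebraType _));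
  apply: sub_sigma_algebra; [exists i => //; exists A => //|exists j => //; exists A' => //]; by rewrite setTI.
Qed.

Lemma mark_event_source i k (B : set (plane R)) : measurable B ->
  source_events X N nu (mark_source i k) [set w | B (mark i w k)].
Proof.
case: k => [|m] mB; apply: sub_sigma_algebra.
  by exists t => //; exists [set n | B (n%:R, 0)%R] => //; rewrite setTI.
by exists tt => //; exists B => //; rewrite setTI.
Qed.

(** The positions and the coordinates of the two marks come from pairwise distinct sources, so the
    event factors. All particles have identically distributed coordinates, hence the marks of
    particle 0 on the right. *)
Lemma mark_indep_boxes i j A A' n B B' : i <> j -> measurable A -> measurable A' ->
  (forall m, measurable (B m)) -> (forall m, measurable (B' m)) ->
  P [set w | [/\ A (X i w), A' (X j w), cylinder n B (mark i w) & cylinder n B' (mark j w)]] =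
  P (pos_event A A' i j) * (\prod_(k < n) P [set w | B k (mark 0 w k)]) *
    (\prod_(k < n) P [set w | B' k (mark 0 w k)]).
Proof.
move=> ij mA mA' mB mB'.
pose l := Positions :: [seq mark_source i k | k <- iota 0 n] ++ [seq mark_source j k | k <- iota 0 n].
pose Bi (i' : nat) := if i' == i then B else B'.
pose E s := match s with Positions => pos_event A A' i j
  | Clock i' => [set w | Bi i' 0%N (mark i' w 0%N)]
  | Jump i' m => [set w | Bi i' m.+1 (mark i' w m.+1)] end.
have EE i' k : E (mark_source i' k) = [set w | Bi i' k (mark i' w k)] by case: k.
have mBi i' k : measurable (Bi i' k) by rewrite /Bi; case: ifP.
have lE s : s \in l -> source_events X N nu s (E s).
  rewrite inE => /predU1P[->|]; first exact: pos_event_source.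
  rewrite mem_cat => /orP[] /mapP[k _ ->]; rewrite EE; exact: mark_event_source.
have inj i' : injective (mark_source i') by move=> k k' /mark_source_inj[].
have ul : uniq l.
  rewrite /l cons_uniq cat_uniq !map_inj_uniq// iota_uniq/= andbT; apply/andP; split.
    by rewrite mem_cat; apply/negP => /orP[] /mapP[[|k] _].
  by apply/hasPn => _ /mapP[k _ ->]; apply/negP => /mapP[k' _ /mark_source_inj[/esym]].
have := mutually_independent_seq indep ul lE.
have ordE (f : nat -> \bar R) : \prod_(k < n) f k = \prod_(k <- iota 0 n) f k.
  by rewrite -(big_mkord xpredT f) /index_iota subn0.
rewrite (ordE (fun k => P [set w | B k (mark 0 w k)])) (ordE (fun k => P [set w | B' k (mark 0 w k)])).
rewrite /l big_cons big_cat /= !big_map muleA => H.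
rewrite -(_ : \prod_(k <- iota 0 n) P (E (mark_source i k)) = \prod_(k <- iota 0 n) P [set w | B k (mark 0 w k)]); last first.
  by apply: eq_bigr => k _; rewrite EE /Bi eqxx mark_law.
rewrite -(_ : \prod_(k <- iota 0 n) P (E (mark_source j k)) = \prod_(k <- iota 0 n) P [set w | B' k (mark 0 w k)]); last first.
  by apply: eq_bigr => k _; rewrite EE /Bi ifN_eqC ?mark_law//; exact/eqP.
rewrite -H; congr (P _); apply/seteqP; split => w /=.
  move=> [Ai Aj Bci Bcj] s; rewrite inE => /predU1P[->//|].
  rewrite mem_cat => /orP[] /mapP[k]; rewrite mem_iota add0n => /andP[_ kn] ->; rewrite EE /=.
    by rewrite /Bi eqxx; exact: Bci.
  by rewrite /Bi ifN_eqC; [exact: Bcj|exact/eqP].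
move=> H'; have [Ai Aj] := H' Positions (mem_head _ _).
split => // k kn.
  have := H' (mark_source i k); rewrite EE /= /Bi eqxx; apply.
  by rewrite inE mem_cat map_f ?orbT// mem_iota.
have := H' (mark_source j k); rewrite EE /= /Bi ifN_eqC; [apply|exact/eqP].
by rewrite inE mem_cat (map_f (mark_source j)) ?orbT// mem_iota.
Qed.

Let Q := push P (measurable_mark 0).

Lemma Q_cylinder n B : (forall m, measurable (B m)) ->
  Q (cylinder n B) = \prod_(k < n) P [set w | B k (mark 0 w k)].
Proof.
move=> mB; have := @mark_indep_boxes 0 1 setT setT n B (fun=> setT) _ measurableT measurableT mB (fun=> measurableT).
rewrite (_ : pos_event _ _ _ _ = setT); last by apply/seteqP; split.
rewrite probability_setT mul1e [X in _ * X]big1; last by [].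
rewrite mule1 => <-//; rewrite /Q /push /pushforward; congr (P _).
by apply/seteqP; split => w /= => [H|[]//].
Qed.

Lemma cylinder_widen n n' B : (n <= n')%N ->
  cylinder n B = cylinder n' (fun m => if (m < n)%N then B m else setT) :> set (marks R).
Proof.
move=> nn'; apply/seteqP; split => s H m mn.
  by case: ifP => // /H.
by have := H m (leq_trans mn nn'); rewrite mn.
Qed.

Lemma mark_indep i j A A' G G' : i <> j -> measurable A -> measurable A' ->
  cylinders G -> cylinders G' ->
  P [set w | [/\ A (X i w), A' (X j w), G (mark i w) & G' (mark j w)]] =
  P [set w | A (X i w) /\ A' (X j w)] * Q G * Q G'.
Proof.
move=> ij mA mA' [n [B [mB ->]]] [n' [B' [mB' ->]]].
rewrite (@cylinder_widen n (maxn n n') B) ?leq_maxl// (@cylinder_widen n' (maxn n n') B') ?leq_maxr//.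
rewrite mark_indep_boxes//; last 2 first.
- by move=> m; case: ifP.
- by move=> m; case: ifP.
by rewrite !Q_cylinder// => m; case: ifP.
Qed.

End walk_marks.

(** * Poisson clocks *)

Section product_push.
Context d (T : measurableType d) (R : realType) (P : probability T R).
Context d' (S : measurableType d') (Y : T -> S) (mY : measurable_fun setT Y).
Local Open Scope ereal_scope.

(** Integrating over the positions first makes the intensity of [F] the mean area of a random set of
    starting points, which translation invariance can evaluate. *)
Lemma product_push (F : set (plane R * S)) : measurable F ->
  (@area R \x push P mY) F = \int[P]_w area [set x | F (x, Y w)].
Proof.
move=> mF.
rewrite (@product_measure_unique _ _ _ _ _ (@area R) (push P mY) (@area R \x^ push P mY))//; last first.
  by move=> A B mA mB; exact: product_measure2E.
rewrite /product_measure2.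
transitivity (\int[pushforward P Y]_y (@area R \o ysection F) y).
  exact: eq_measure_integral.
have mf : measurable_fun setT (@area R \o ysection F) by exact: measurable_fun_ysection.
have f0 : {in setT, forall y, 0 <= (@area R \o ysection F) y} by move=> y _; exact: measure_ge0.
transitivity (\int[P]_(w in Y @^-1` setT) ((@area R \o ysection F) \o Y) w).
  exact: (@ge0_integral_pushforward _ _ _ _ R Y mY P setT _ measurableT mf f0).
rewrite preimage_setT; apply: eq_integral => w _ /=; congr area; apply/seteqP; split => x /=; rewrite /ysection /= inE//.
Qed.

Lemma measurable_area_section (F : set (plane R * S)) : measurable F ->
  measurable_fun setT (fun w => area [set x | F (x, Y w)]).
Proof.
move=> mF; rewrite (_ : (fun _ => _) = (@area R \o ysection F) \o Y).
  by apply: measurableT_comp => //; exact: measurable_fun_ysection.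
by apply/funext => w /=; congr area; apply/seteqP; split => x /=; rewrite /ysection /= inE.
Qed.

End product_push.

Section probability_facts.
Context d (T : measurableType d) (R : realType) (P : probability T R).
Local Open Scope ereal_scope.

(** Explosion and path properties involve all real times and are not shown to be measurable;
    coverings by measurable events of small probability are enough. *)
Lemma negligible_small (A : set T) :
  (forall e : R, (0 < e)%R -> exists B, [/\ measurable B, A `<=` B & P B <= e%:E]) ->
  P.-negligible A.
Proof.
move=> H.
have {}H (n : nat) : exists B, [/\ measurable B, A `<=` B & P B <= (n.+1%:R^-1)%:E].
  by apply: H; rewrite invr_gt0.
have [B HB] := choice H.
exists (\bigcap_n B n); split.
- by apply: bigcapT_measurable => n; have [] := HB n.
- apply/eqP; rewrite eq_le measure_ge0 andbT.
  apply/lee_addgt0Pr => e e0; rewrite add0e.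
  pose n := Num.truncn e^-1; have [mB _ PB] := HB n.
  apply: (@le_trans _ _ (P (B n))).
    apply: le_measure; rewrite ?inE//; last by apply: bigcap_inf.
    by apply: bigcapT_measurable => k; have [] := HB k.
  apply: le_trans PB _; rewrite lee_fin invf_ple ?posrE// ltW//.
  exact: truncnS_gt.
- by move=> w Aw n _; have [_ AB _] := HB n; exact: AB.
Qed.

Lemma prob_bigsetU_le (n : nat) (A : nat -> set T) (c : R) :
  (forall k, (k < n)%N -> measurable (A k)) -> (forall k, (k < n)%N -> P (A k) <= c%:E) ->
  P (\big[setU/set0]_(k < n) A k) <= (n%:R * c)%:E.
Proof.
move=> mA PA; apply: le_trans (Boole_inequality _ mA) _.
apply: (@le_trans _ _ (\sum_(k < n) c%:E)); first by apply: lee_sum => k _; exact: PA.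
by rewrite sumEFin sumr_const card_ord mulr_natl.
Qed.

End probability_facts.

Section poisson_tails.
Context {R : realType}.
Local Open Scope ereal_scope.
Variable h : R.
Hypothesis h0 : (0 <= h)%R.
Let p n : R := fine (poisson_prob h 0 [set n]).

Let pE n : poisson_prob h 0 [set n] = (p n)%:E.
Proof. by rewrite fineK// fin_num_measure. Qed.

Let p_le1 n : (p n <= 1)%R.
Proof. by rewrite -lee_fin -pE; exact: probability_le1. Qed.

Let p_ge0 n : (0 <= p n)%R.
Proof. by rewrite -lee_fin -pE; exact: measure_ge0. Qed.

Let pS n : (n.+1%:R * p n.+1 = h * p n)%R.
Proof. by have := poissonS h0 n; rewrite !pE -!EFinM => -[]. Qed.

Lemma poisson0_ge : (1 - h <= p 0)%R.
Proof.
rewrite /p; have [->|hn0] := eqVneq h 0%R; last first.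
  have hp : (0 < h)%R by rewrite lt_neqAle eq_sym hn0.
  rewrite /poisson_prob hp esum_set1 ?lee_fin ?poisson_pmf_ge0//=.
  rewrite /poisson_pmf hp expr0 fact0 invr1 !mul1r.
  exact: expR_ge1Dx.
by rewrite subr0 /poisson_prob ltxx diracE mem_set.
Qed.

Lemma poisson_gt0_le : poisson_prob h 0 [set n | 0 < n]%N <= h%:E.
Proof.
have -> : [set n | 0 < n]%N = ~` [set 0%N].
  by apply/seteqP; split => n /=; rewrite lt0n => /eqP.
have -> : poisson_prob h 0 (~` [set 0%N]) = 1 - poisson_prob h 0 [set 0%N].
  exact: (@probability_setC _ _ _ (poisson_prob h 0)).
by rewrite pE -EFinB lee_fin; have := poisson0_ge; lra.
Qed.

Lemma poisson_gt1_le : poisson_prob h 0 [set n | 1 < n]%N <= (h ^+ 2)%:E.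
Proof.
have -> : [set n | 1 < n]%N = ~` ([set 0%N] `|` [set 1%N]).
  apply/seteqP; split => [n /= n1|n /= H]; first by move=> [] E; rewrite E in n1.
  by case: n H => [|[|n]] // H; exfalso; apply: H; [left|right].
have -> : poisson_prob h 0 (~` ([set 0%N] `|` [set 1%N])) = 1 - poisson_prob h 0 ([set 0%N] `|` [set 1%N]).
  exact: (@probability_setC _ _ _ (poisson_prob h 0)).
have -> : poisson_prob h 0 ([set 0%N] `|` [set 1%N]) = (p 0 + p 1)%:E.
  rewrite EFinD -!pE; apply: measureU => //.
  by apply/seteqP; split => // n [/= ->].
rewrite -EFinB lee_fin.
have p0 := poisson0_ge; have := pS 0; rewrite mul1r => ->.
(* The complement of the values 0 and 1 has mass [1 - (1 + h) * p 0], at most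
   [1 - (1 + h) * (1 - h) = h ^ 2]. *)
have : (0 <= (1 + h) * (p 0%N - (1 - h)))%R by apply: mulr_ge0; [exact: addr_ge0|rewrite subr_ge0].
rewrite mulrDl mul1r !mulrBr mulr1 -expr2; lra.
Qed.

Lemma poisson_point_le n : (0 < h)%R -> poisson_prob h 0 [set n] <= (n.+1%:R / h)%:E.
Proof.
move=> hp; rewrite pE lee_fin ler_pdivlMr// mulrC -pS.
by rewrite ler_piMr.
Qed.

End poisson_tails.

Section clocks.
Context d (T : measurableType d) (R : realType) (P : probability T R).
Variables (X : nat -> T -> plane R) (N : nat -> R -> T -> nat)
  (nu : nat -> nat -> T -> plane R).
Hypothesis mN : forall i t, measurable_fun setT (N i t).
Hypothesis poissonN : forall i, poisson_process P 1 (N i).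
Hypothesis indep : mutually_independent P (source_events X N nu).
Local Open Scope ereal_scope.

Let incr i (a b : R) w := (N i b w - N i a w)%N.

Lemma measurable_incr i a b (V : set nat) : measurable [set w | V (incr i a b w)].
Proof.
rewrite (_ : [set w | _] = \bigcup_k \bigcup_l ([set w | V (k - l)%N] `&`
   ([set w | N i b w = k] `&` [set w | N i a w = l]))).
  apply: bigcupT_measurable => k; apply: bigcupT_measurable => l.
  apply: measurableI; last first.
    by apply: measurableI; [exact: (measurable_preim (A := [set k]) (mN i b))|exact: (measurable_preim (A := [set l]) (mN i a))].
  have [Vkl|nV] := pselect (V (k - l)%N).
    by rewrite (_ : [set _ | _] = setT)//; apply/seteqP; split.
  by rewrite (_ : [set _ | _] = set0)//; apply/seteqP; split.
apply/seteqP; split => w /=.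
  by move=> H; exists (N i b w) => //; exists (N i a w).
by move=> [k _ [l _ [H [bk al]]]]; rewrite /incr bk al.
Qed.

Lemma law_incr i a b (V : set nat) : (0 <= a)%R -> (a <= b)%R ->
  P [set w | V (incr i a b w)] = poisson_prob (b - a) 0 V.
Proof.
move=> a0 ab; apply: nat_law => [|k].
  by move=> _ W _; rewrite setTI; exact: measurable_incr.
have [_ _ _ /(_ a b a0 ab k) + _] := poissonN i.
by rewrite mul1r.
Qed.

Lemma incr_source i a b (V : set nat) : (0 <= a)%R -> (0 <= b)%R ->
  source_events X N nu (Clock i) [set w | V (incr i a b w)].
Proof.
move=> a0 b0 /=; rewrite /sigma_generated; set G := \bigcup_(_ in _) _.
have mS c k : (0 <= c)%R -> @measurable _ (g_sigma_algebraType G) [set w | N i c w = k].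
  by move=> c0; apply: sub_sigma_algebra; exists c => //; exists [set k] => //; rewrite setTI.
rewrite (_ : [set w | _] = \bigcup_k \bigcup_l ([set w | V (k - l)%N] `&`
   ([set w | N i b w = k] `&` [set w | N i a w = l]))).
  apply: (@bigcupT_measurable _ (g_sigma_algebraType G)) => k.
  apply: (@bigcupT_measurable _ (g_sigma_algebraType G)) => l.
  apply: (@measurableI _ (g_sigma_algebraType G)); last first.
    by apply: (@measurableI _ (g_sigma_algebraType G)); exact: mS.
  have [Vkl|nV] := pselect (V (k - l)%N).
    rewrite (_ : [set _ | _] = setT); last by apply/seteqP; split.
    exact: (@measurableT _ (g_sigma_algebraType G)).
  rewrite (_ : [set _ | _] = set0); last by apply/seteqP; split.
  exact: (@measurable0 _ (g_sigma_algebraType G)).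
apply/seteqP; split => w /=.
  by move=> H; exists (N i b w) => //; exists (N i a w).
by move=> [k _ [l _ [H [bk al]]]]; rewrite /incr bk al.
Qed.

Let grid (t : R) (J k : nat) : R := (t * (k%:R / J%:R))%R.

Lemma grid_ge0 t J k : (0 <= t)%R -> (0 <= grid t J k)%R.
Proof. by move=> t0; rewrite mulr_ge0// divr_ge0. Qed.

Lemma le_grid t J k l : (0 <= t)%R -> (k <= l)%N -> (grid t J k <= grid t J l)%R.
Proof. by move=> t0 kl; rewrite ler_wpM2l// ler_wpM2r ?invr_ge0// ler_nat. Qed.

Lemma grid_step t J k : (grid t J k.+1 - grid t J k = t / J%:R)%R.
Proof. by rewrite /grid -mulrBr -mulrBl -natrB// subSnn mul1r. Qed.

Lemma gridJ t J : (0 < J)%N -> grid t J J = t.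
Proof. by move=> J0; rewrite /grid divff ?mulr1// pnatr_eq0 -lt0n. Qed.

(** The union bound over [J] cells of length [t / J] costs [J * (t / J) ^ 2 = t ^ 2 / J], which is
    arbitrarily small. *)
Lemma grid_bad_negligible t (bad : R -> R -> set T) : (0 <= t)%R ->
  (forall a b, (0 <= a)%R -> (a <= b)%R -> measurable (bad a b)) ->
  (forall a b, (0 <= a)%R -> (a <= b)%R -> P (bad a b) <= ((b - a) ^+ 2)%:E) ->
  P.-negligible [set w | ~ exists2 J : nat, (0 < J)%N &
    forall k, (k < J)%N -> ~ bad (grid t J k) (grid t J k.+1) w].
Proof.
move=> t0 mbad Pbad; apply: negligible_small => e e0.
pose J := (Num.truncn (t ^+ 2 / e)).+1.
have mB k : measurable (bad (grid t J k) (grid t J k.+1)).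
  by apply: mbad; [exact: grid_ge0|exact: le_grid].
exists (\big[setU/set0]_(k < J) bad (grid t J k) (grid t J k.+1)); split.
- by apply: bigsetU_measurable => k _; exact: mB.
- move=> w /= H; rewrite -(bigcup_mkord J (fun k => bad (grid t J k) (grid t J k.+1))); apply: contrapT => H'; apply: H.
  by exists J => // k kJ bk; apply: H'; exists k.
- apply: le_trans (@prob_bigsetU_le _ _ _ P J (fun k => bad (grid t J k) (grid t J k.+1)) ((t / J%:R) ^+ 2)%R _ _) _ => //.
    move=> k _; apply: le_trans (Pbad _ _ _ _) _; [exact: grid_ge0|exact: le_grid|].
    by rewrite grid_step.
  have J0 : (0 < J%:R :> R)%R by rewrite ltr0n.
  have -> : (J%:R * (t / J%:R) ^+ 2 = t ^+ 2 / J%:R)%R.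
    by move: (J%:R : R) J0 => j j0; field; rewrite gt_eqF.
  rewrite lee_fin.
  rewrite ler_pdivrMr// -ler_pdivrMl// mulrC ltW//.
  exact: truncnS_gt.
Qed.

(** On a grid with at most one jump per cell, the clock takes all its intermediate values at grid
    times. This makes every partial sum of the jumps an actual position of the walk. *)
Lemma unit_jumps i t : (0 <= t)%R ->
  P.-negligible [set w | ~ forall m, (m <= N i t w)%N -> exists2 s : R, (0 <= s <= t)%R & N i s w = m].
Proof.
move=> t0.
pose bad a b := [set w | [set n | 1 < n]%N (incr i a b w)].
apply: negligibleS (grid_bad_negligible t0 (bad := bad) _ _); last 2 first.
- by move=> a b _ _; exact: measurable_incr.
- move=> a b a0 ab; rewrite law_incr//; apply: poisson_gt1_le.
  by rewrite subr_ge0.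
move=> w /= H [J J0 HJ]; apply: H => m.
have [N0 Nmono _ _ _] := poissonN i.
rewrite -{1}(gridJ t J0).
have : (J <= J)%N by [].
move: {1 4}J => k; elim: k m => [|k IH] m kJ.
  rewrite /grid mul0r mulr0 N0 leqn0 => /eqP ->.
  by exists 0%R; rewrite ?N0// lexx.
move=> mN'; have [/IH|mk] := leqP m (N i (grid t J k) w); first by apply; exact: ltnW.
have := HJ k kJ; rewrite /bad /= /incr => /negP; rewrite -leqNgt => H.
exists (grid t J k.+1); last lia.
by rewrite grid_ge0//= -{2}(gridJ t J0) le_grid.
Qed.

(** By independence, two clocks both move in a cell of length [h] with probability at most [h ^ 2].
    Otherwise one of them is constant on the cell that contains [s]. *)
Lemma no_common_jump i j t : i <> j -> (0 <= t)%R ->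
  P.-negligible [set w | ~ forall s : R, (0 < s <= t)%R -> exists2 u : R, (0 <= u < s)%R &
     (forall v, (u <= v <= s)%R -> N i v w = N i s w) \/
     (forall v, (u <= v <= s)%R -> N j v w = N j s w)].
Proof.
move=> ij t0.
pose bad a b := [set w | [set n | 0 < n]%N (incr i a b w)] `&` [set w | [set n | 0 < n]%N (incr j a b w)].
apply: negligibleS (grid_bad_negligible t0 (bad := bad) _ _); last 2 first.
- by move=> a b _ _; apply: measurableI; exact: measurable_incr.
- move=> a b a0 ab.
  pose E s := match s with Clock k => [set w | [set n | 0 < n]%N (incr k a b w)] | _ => setT end.
  have := @mutually_independent_seq _ _ _ P _ _ [:: Clock i; Clock j] E indep.
  rewrite !big_cons big_nil mule1 /= => H.
  rewrite (_ : bad a b = [set w | forall s, s \in [:: Clock i; Clock j] -> E s w]); last first.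
    apply/seteqP; split => w /=.
      by move=> [? ?] s; rewrite !inE => /orP[] /eqP ->.
    by move=> H'; split; [apply: (H' (Clock i)); rewrite !inE eqxx|apply: (H' (Clock j)); rewrite !inE eqxx orbT].
  rewrite H.
  + have ba : (0 <= b - a)%R by rewrite subr_ge0.
    rewrite (law_incr i [set n | 0 < n]%N a0 ab) (law_incr j [set n | 0 < n]%N a0 ab) expr2 EFinM.
    by apply: lee_pmul => //; exact: poisson_gt0_le.
  + by rewrite !inE andbT; apply/eqP => -[].
  + have b0 := le_trans a0 ab.
    by move=> s; rewrite !inE => /orP[] /eqP ->; exact: incr_source.
move=> w /= H [J J0 HJ]; apply: H => s /andP[s0 st].
(* The cell is open on the left, so that its left end lies strictly before [s]. *)
have [k kJ /andP[ks sk]] : exists2 k, (k < J)%N & (grid t J k < s <= grid t J k.+1)%R.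
  have : (s <= grid t J J)%R by rewrite gridJ.
  elim: {1 4}J (leqnn J) => [|k IH] kJ.
    by rewrite /grid mul0r mulr0 leNgt s0.
  move=> sk; have [/IH|ks] := leP s (grid t J k); first by apply; exact: ltnW.
  by exists k => //; rewrite ks.
exists (grid t J k); first by rewrite grid_ge0.
have := HJ k kJ; rewrite /bad /= => /not_andP[]; rewrite /incr => /negP; rewrite -eqn0Ngt subn_eq0 => H; [left|right] => v /andP[kv vs].
- have [_ Nmono _ _ _] := poissonN i.
  have v0 := le_trans (grid_ge0 J k t0) kv.
  apply/eqP; rewrite eqn_leq Nmono//=; apply: leq_trans (Nmono w _ _ _ _) (leq_trans H (Nmono w _ _ _ _)) => //.
  + exact: ltW.
  + exact: grid_ge0.
- have [_ Nmono _ _ _] := poissonN j.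
  have v0 := le_trans (grid_ge0 J k t0) kv.
  apply/eqP; rewrite eqn_leq Nmono//=; apply: leq_trans (Nmono w _ _ _ _) (leq_trans H (Nmono w _ _ _ _)) => //.
  + exact: ltW.
  + exact: grid_ge0.
Qed.

Lemma clock_unbounded i : P.-negligible [set w | exists n, forall k : nat, (N i k%:R w <= n)%N].
Proof.
rewrite (_ : [set w | _] = \bigcup_n [set w | forall k : nat, (N i k%:R w <= n)%N]); last first.
  by apply/seteqP; split => w /= [n]; [move=> ?; exists n|move=> _ ?; exists n].
apply: negligible_bigcup => n; apply: negligible_small => e e0.
(* Each of the [n + 1] values up to [n] has mass at most [(n + 1) / k] under the Poisson law of
   parameter [k]. *)
pose k := (Num.truncn (n.+1%:R * n.+1%:R / e : R)).+1.
exists [set w | [set m | m <= n]%N (incr i 0 k%:R w)]; split.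
- exact: measurable_incr.
- by move=> w /= /(_ k) H; rewrite /incr; apply: leq_trans H; exact: leq_subr.
- rewrite law_incr// subr0.
  rewrite (_ : [set m | _]%N = \big[setU/set0]_(m < n.+1) [set m : nat]); last first.
    rewrite -bigcup_mkord; apply/seteqP; split => m /=.
      by move=> mn; exists m.
    by move=> [l /= ln ->].
  have k0 : (0 < k%:R :> R)%R by rewrite ltr0n.
  apply: le_trans (@prob_bigsetU_le _ _ R (poisson_prob k%:R 0) n.+1 (fun m => [set m]) (n.+1%:R / k%:R) _ _) _ => //.
    move=> m mn; apply: le_trans (poisson_point_le (ltW k0) m k0) _.
    by rewrite lee_fin ler_wpM2r ?invr_ge0// ler_nat.
  rewrite lee_fin mulrA ler_pdivrMr// -ler_pdivrMl// mulrC ltW//.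
  exact: truncnS_gt.
Qed.

End clocks.

(** * Range of a Gaussian walk *)

Section euclid_facts.
Context {R : realType}.
Implicit Types x y z : plane R.

Lemma euclid_ge0 x : 0 <= euclid x. Proof. exact: sqrtr_ge0. Qed.

Lemma sqr_euclid x : euclid x ^+ 2 = x.1 ^+ 2 + x.2 ^+ 2.
Proof. by rewrite sqr_sqrtr// addr_ge0// sqr_ge0. Qed.

Lemma euclidD x y : euclid (x + y) <= euclid x + euclid y.
Proof.
have cs : x.1 * y.1 + x.2 * y.2 <= euclid x * euclid y.
  have [|neg] := leP (x.1 * y.1 + x.2 * y.2) 0.
    by move/le_trans; apply; rewrite mulr_ge0 ?euclid_ge0.
  rewrite -(@ler_pXn2r _ 2)// ?nnegrE ?mulr_ge0 ?euclid_ge0 ?(ltW neg)//.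
  rewrite exprMn !sqr_euclid -subr_ge0.
  rewrite (_ : _ - _ = (x.1 * y.2 - x.2 * y.1) ^+ 2); last by ring.
  exact: sqr_ge0.
rewrite -(@ler_pXn2r _ 2)// ?nnegrE ?addr_ge0 ?euclid_ge0//.
rewrite sqrrD !sqr_euclid -subr_ge0 /=.
move: cs; move: (euclid x) (euclid y) => a b cs.
rewrite (_ : _ - _ = 2 * (a * b - (x.1 * y.1 + x.2 * y.2))); last by ring.
by rewrite mulr_ge0// subr_ge0.
Qed.

Lemma euclidN x : euclid (- x) = euclid x.
Proof. by rewrite /euclid /= !sqrrN. Qed.

Lemma normr_fst_euclid x : `|x.1| <= euclid x.
Proof. by rewrite -sqrtr_sqr ler_sqrt ?lerDl ?sqr_ge0// addr_ge0// sqr_ge0. Qed.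

End euclid_facts.

Section sausage.
Context {R : realType}.
Local Open Scope ereal_scope.

Let r0 : R := ((Num.sqrt pi)^-1)%R.

Let r0_gt0 : (0 < r0)%R. Proof. by rewrite invr_gt0 sqrtr_gt0 pi_gt0. Qed.

Lemma area_unit_disc_shift (z : plane R) :
  area [set x : plane R | disc r0%:E (x + z)%R] = 1.
Proof.
rewrite area_shift; last exact: measurable_disc.
by rewrite area_disc// darea_r0.
Qed.

Lemma measurable_abs_fst : measurable_fun setT (fun x : plane R => `|x.1|%R).
Proof. by apply: measurableT_comp => //; exact: measurable_fst. Qed.

Lemma measurable_disc_shift (r : \bar R) (z : plane R) :
  measurable [set x : plane R | disc r (x + z)%R].
Proof. by apply: measurable_preim; [exact: measurable_shift|exact: measurable_disc]. Qed.

(* Along an unbounded sequence the union has mass at least [1] outside every strip, hence infinite area. *)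
Lemma infinite_sausage (z : nat -> plane R) :
  (forall K : R, exists m, (K < `|(z m).1|)%R) ->
  area [set x : plane R | exists m, disc r0%:E (x + z m)%R] = +oo.
Proof.
move=> zoo; set U := [set x | _].
have mU : measurable U.
  rewrite (_ : U = \bigcup_m [set x | disc r0%:E (x + z m)%R]); last first.
    by apply/seteqP; split => x /= [m]; [move=> ?; exists m|move=> _ ?; exists m].
  by apply: bigcupT_measurable => m; exact: measurable_disc_shift.
apply/eqP; rewrite -leye_eq leNgt; apply/negP => Ufin.
pose F (k : nat) := U `&` [set x : plane R | (k%:R <= `|x.1|)%R].
have mF k : measurable (F k).
  apply: measurableI => //.
  have mk : measurable [set u : R | (k%:R <= u)%R] by rewrite -set_itvcy.
  exact: (measurable_preim measurable_abs_fst mk).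
have Fge k : 1 <= area (F k).
  have [m zm] := zoo (k%:R + r0)%R.
  rewrite -(area_unit_disc_shift (z m)); apply: le_measure; rewrite ?inE//.
    exact: measurable_disc_shift.
  move=> x /= dx; split; first by exists m.
  rewrite /disc /= lee_fin in dx; have := le_trans (normr_fst_euclid _) dx.
  rewrite /= => H.
  have : (`|(z m).1| <= `|x.1 + (z m).1| + `|x.1|)%R.
    rewrite {1}(_ : (z m).1 = x.1 + (z m).1 - x.1)%R ?ler_normB//.
    by rewrite addrAC subrr add0r.
  lra.
have F0 : \bigcap_k F k = set0.
  apply/seteqP; split => // x /(_ (Num.truncn `|x.1|).+1 I) [_ /=].
  by rewrite leNgt truncnS_gt.
have cvgF : area (F n) @[n --> \oo] --> area (\bigcap_k F k).
  apply: nonincreasing_cvg_mu => //.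
  - by apply: le_lt_trans Ufin; apply: le_measure; rewrite ?inE// => x [].
  - by rewrite F0.
  - move=> k l kl; apply/subsetPset => x [Ux /= lx]; split => //=.
    by apply: le_trans lx; rewrite ler_nat.
rewrite F0 measure0 in cvgF.
have : 1 <= lim (area (F n) @[n --> \oo]).
  by apply: lime_ge; [apply/cvg_ex; exists 0|apply: nearW].
by move/cvg_lim : cvgF => ->//; rewrite lee_fin ler10.
Qed.

End sausage.

Section jumps.
Context d (T : measurableType d) (R : realType) (P : probability T R).
Variables (X : nat -> T -> plane R) (N : nat -> R -> T -> nat)
  (nu : nat -> nat -> T -> plane R).
Hypothesis mnu : forall i m, measurable_fun setT (nu i m).
Hypothesis gaussian : forall i m (A : set (plane R)), measurable A ->
  P [set w | A (nu i m w)] = std_gaussian2 A.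
Hypothesis indep : mutually_independent P (source_events X N nu).
Local Open Scope ereal_scope.

Let strip (K : R) : set (plane R) := [set x | (`|x.1| <= K)%R].

Lemma measurable_strip K : measurable (strip K).
Proof.
have mK : measurable [set u : R | (u <= K)%R] by rewrite -set_itvNyc.
exact: (measurable_preim measurable_abs_fst mK).
Qed.

Lemma gaussian_strip_lt1 K : (0 <= K)%R -> std_gaussian2 (strip K) < 1.
Proof.
move=> K0.
have mA : measurable [set y : R | (`|y| <= K)%R].
  by rewrite (_ : [set _ | _] = `[(-K)%R, K]%classic)//; apply/seteqP; split => y /=;
    rewrite in_itv/= ler_norml.
rewrite (_ : strip K = [set y | (`|y| <= K)%R] `*` setT); last first.
  by apply/seteqP; split => y /=; [|case].
have std_gaussianX (A B : set (measurableTypeR R)) : measurable A -> measurable B ->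
    std_gaussian2 (A `*` B) = normal_prob 0 1 A * normal_prob 0 1 B :> \bar R.
  exact: product_measure1E.
rewrite std_gaussianX// [X in _ * X](probability_setT (normal_prob 0 1)) mule1.
rewrite -(setCK [set y | (`|y| <= K)%R]) probability_setC; last exact: measurableC.
rewrite lteBlDl ?fin_num_measure//; last exact: measurableC.
rewrite -[ltLHS]add0e lteD2rE//.
(* The strip misses the interval []K, K + 1]], where the density is at least its value [c] at the
   right end. *)
pose c : R := (normal_peak 1 * expR (- (K + 1) ^+ 2 / 2))%R.
have c0 : (0 < c)%R by rewrite mulr_gt0 ?expR_gt0// normal_peak_gt0.
apply: (@lt_le_trans _ _ (\int[lebesgue_measure]_(x in `]K, (K + 1)%R]) c%:E)).
  rewrite integral_cst//= lebesgue_measure_itv/= lte_fin ltrDl ltr01.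
  by rewrite -EFinD mule_gt0// lte_fin; lra.
apply: (@le_trans _ _ (normal_prob 0 1 `]K, (K + 1)%R])).
  apply: ge0_le_integral => //.
  - by move=> x _; rewrite lee_fin ltW.
  - by apply/measurable_funTS/measurable_EFinP; exact: measurable_normal_pdf.
  - move=> x /=; rewrite in_itv/= => /andP[Kx xK]; rewrite lee_fin normal_pdfE ?oner_neq0//.
    rewrite ler_pM2l ?normal_peak_gt0 ?oner_neq0// ler_expR subr0 expr1n.
    by rewrite !mulNr lerN2 ler_pM2r ?invr_gt0// ler_pXn2r// nnegrE; lra.
apply: le_measure; rewrite ?inE//; first exact: measurableC.
move=> x /=; rewrite in_itv/= => /andP[Kx _]; apply/negP; rewrite -ltNge.
by apply: lt_le_trans Kx _; exact: ler_norm.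
Qed.

Lemma jumps_unbounded i : P.-negligible [set w | exists K : R, forall m, (`|(nu i m w).1| <= K)%R].
Proof.
rewrite (_ : [set w | _] = \bigcup_(k : nat) [set w | forall m, strip k%:R (nu i m w)]); last first.
  apply/seteqP; split => w /=.
    move=> [K HK]; exists (Num.truncn K).+1 => // m.
    rewrite /strip /= (le_trans (HK m))// ltW//; exact: truncnS_gt.
  by move=> [k _ H]; exists k%:R.
apply: negligible_bigcup => k; apply: negligible_small => e e0.
have mB n : measurable [set w | strip k%:R (nu i n w)].
  by apply: measurable_preim => //; exact: measurable_strip.
pose q := fine (std_gaussian2 (strip k%:R : set (plane R))).
have qE : std_gaussian2 (strip k%:R) = q%:E.
  rewrite fineK// ge0_fin_numE; last exact: measure_ge0.
  by rewrite (lt_trans (gaussian_strip_lt1 _))// ltry.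
have q0 : (0 <= q)%R by rewrite -lee_fin -qE; exact: measure_ge0.
have q1 : (q < 1)%R by rewrite -lte_fin -qE; exact: gaussian_strip_lt1.
have [n qn] : exists n, (q ^+ n <= e)%R.
  have : (q ^+ n @[n --> \oo] --> (0 : R))%R by apply: cvg_expr; rewrite ger0_norm.
  move/cvgr0_norm_le => /(_ e e0)[n _ /(_ n (leqnn _))]; exists n.
  by rewrite -[leLHS]ger0_norm// exprn_ge0.
pose E s := match s with Jump _ m => [set w | strip k%:R (nu i m w)] | _ => setT end.
pose l := [seq Jump i m | m <- iota 0 n].
exists [set w | forall s, s \in l -> E s w]; split.
- rewrite (_ : [set w | _] = \bigcap_(m in `I_n) [set w | strip k%:R (nu i m w)]).
    by apply: fin_bigcap_measurable.
  apply/seteqP; split => w /= H.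
    by move=> m mn; apply: (H (Jump i m)); rewrite map_f// mem_iota.
  by move=> s /mapP[m]; rewrite mem_iota add0n => /andP[_ mn] -> /=; exact: H.
- by move=> w /= H s /mapP[m _ ->] /=; exact: H.
- rewrite (mutually_independent_seq indep).
  + rewrite big_map (eq_bigr (fun=> q%:E)); last first.
      by move=> m _; rewrite gaussian//; exact: measurable_strip.
    suff -> : \prod_(m <- iota 0 n) q%:E = (q ^+ n)%:E by rewrite lee_fin.
    rewrite big_const_seq count_predT size_iota; elim: (n) => //= p ->.
    by rewrite -EFinM -exprS.
  + by rewrite map_inj_uniq ?iota_uniq// => a b [].
  + move=> s /mapP[m _ ->] /=; apply: sub_sigma_algebra; exists tt => //.
    by exists (strip k%:R) => //; rewrite ?setTI//; exact: measurable_strip.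
Qed.

(** A jump is a difference of two consecutive positions, so a bounded walk would have bounded jumps.
    No limit theorem for the sums is involved. *)
Lemma walk_unbounded i : P.-negligible
  [set w | ~ forall K : R, exists m, (K < `|(\sum_(l < m) nu i l w).1|)%R].
Proof.
apply: negligibleS (jumps_unbounded i) => w /=.
move=> /existsNP[K /forallNP H]; exists (K + K)%R => m.
have HK n : (`|(\sum_(l < n) nu i l w).1| <= K)%R by rewrite leNgt; apply/negP/H.
have := HK m.+1; rewrite big_ord_recr /=.
move: (HK m); move: ((\sum_(l < m) nu i l w)%R) => S H0 H1.
rewrite (_ : (nu i m w).1 = (S.1 + (nu i m w).1) - S.1)%R; last by rewrite addrAC subrr add0r.
by apply: le_trans (ler_normB _ _) _; rewrite lerD.
Qed.

End jumps.

(** * Explosion in the supercritical case *)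

Section telescope.
Context d (T : measurableType d) (R : realType) (P : probability T R).
Local Open Scope ereal_scope.

(** The error bounds are required in telescoping form, so that no series has to be evaluated. *)
Lemma prob_bigcup_telescope (A : nat -> set T) (b : nat -> R) :
  (forall n, measurable (A n)) -> (forall n, P (A n) <= (b n - b n.+1)%:E) ->
  (forall n, (0 <= b n)%R) -> P (\bigcup_n A n) <= (b 0)%:E.
Proof.
move=> mA PA b0.
apply: le_trans (measure_sigma_subadditive P mA _ (@subset_refl _ _)) _.
  exact: bigcupT_measurable.
apply: lime_le; first exact: is_cvg_nneseries.
apply: nearW => n; rewrite big_mkord.
apply: (@le_trans _ _ (b 0 - b n)%:E); last by rewrite lee_fin gerBl.
elim: n => [|n IH]; first by rewrite big_ord0 subrr.
rewrite big_ord_recr/= (_ : (_ - _)%:E = (b 0%N - b n)%:E + (b n - b n.+1)%:E) ?leeD//.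
by rewrite -EFinD addrA subrK.
Qed.

End telescope.

Section particles.
Context d (T : measurableType d) (R : realType) (P : probability T R).
Variables (lambda : R) (X : nat -> T -> plane R) (N : nat -> R -> T -> nat)
  (nu : nat -> nat -> T -> plane R).
Hypothesis lambda0 : 0 < lambda.
Hypothesis mX : forall i, measurable_fun setT (X i).
Hypothesis mN : forall i t, measurable_fun setT (N i t).
Hypothesis mnu : forall i m, measurable_fun setT (nu i m).
Hypothesis ppp : poisson_point_process P lambda X.
Hypothesis poissonN : forall i, poisson_process P 1 (N i).
Hypothesis gaussian : forall i m (A : set (plane R)), measurable A ->
  P [set w | A (nu i m w)] = std_gaussian2 A.
Hypothesis indep : mutually_independent P (source_events X N nu).
Local Open Scope ereal_scope.

Let Y t := mark N nu t : nat -> T -> marks R.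

Definition particle_count t (F : set (plane R * marks R)) w : \bar R :=
  counting [set i | F (X i w, Y t i w)].

(** The intensity of [F], in the form given by [product_push]; the mark of particle 0 stands for a
    typical one. *)
Definition mean_count t (F : set (plane R * marks R)) : \bar R :=
  lambda%:E * \int[P]_w area [set x | F (x, Y t 0 w)].

Let mY t i := measurable_mark mN mnu t i.

Lemma particle_chebyshev t F (m u : R) (E : set T) : (0 <= t)%R -> measurable F ->
  mean_count t F = m%:E -> measurable E ->
  (forall w, E w -> particle_count t F w <= (m - u)%:E \/ (m + u)%:E <= particle_count t F w) ->
  (0 <= u)%R -> (u ^+ 2)%:E * P E <= m%:E.
Proof.
move=> t0 mF Fm mE HE u0.
apply: (@marked_chebyshev _ T R P _ (marks R) (push P (mY t 0)) lambda X (Y t) cylinders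
  lambda0 mX ppp (mY t) measurable_marks cylindersI cylindersT _ F m u E) => //.
  move=> i j ij A A' G G' mA mA' cG cG'.
  exact: (mark_indep mN mnu poissonN gaussian indep t0 ij mA mA' cG cG').
by rewrite /intensity -Fm /mean_count -product_push.
Qed.

Lemma measurable_particle_count t F : measurable F -> measurable_fun setT (particle_count t F).
Proof. exact: measurable_Zc. Qed.

End particles.

Section displacement.
Context {R : realType}.

Lemma measurable_planeD d (T : measurableType d) (f g : T -> plane R) :
  measurable_fun setT f -> measurable_fun setT g -> measurable_fun setT (fun w => f w + g w : plane R).
Proof.
move=> mf mg; apply/measurable_fun_pairP; split; apply: measurable_funD.
- exact: (measurableT_comp (@measurable_fst _ _ _ _) mf).
- exact: (measurableT_comp (@measurable_fst _ _ _ _) mg).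
- exact: (measurableT_comp (@measurable_snd _ _ _ _) mf).
- exact: (measurableT_comp (@measurable_snd _ _ _ _) mg).
Qed.

Definition displacement (s : marks R) (n : nat) : plane R := \sum_(m < n) (s m.+1 : plane R).

Lemma measurable_displacement n :
  measurable_fun [set: marks R] (fun s => displacement s n).
Proof.
elim: n => [|n IH].
  rewrite (_ : (fun _ => _) = fun=> 0); first exact: measurable_cst.
  by apply/funext => s; rewrite /displacement big_ord0.
rewrite (_ : (fun _ => _) = fun s => displacement s n + (s n.+1 : plane R)).
  exact: measurable_planeD IH (@measurable_coord R n.+1).
by apply/funext => s; rewrite /displacement big_ord_recr.
Qed.

Let r0 : R := (Num.sqrt pi)^-1.

(** The cap [m < k] leaves finitely many positions, which keeps the mean finite. As [k] also serves
    as the time, the cap disappears in the limit. *)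
Definition hitting (k : nat) : set (plane R * marks R) := [set z | exists n m,
  [/\ (z.2 0%N).1 = n%:R, (m <= n)%N, (m < k)%N & disc r0%:E (z.1 + displacement z.2 m)]].

Definition final (r : R) : set (plane R * marks R) := [set z | exists n,
  (z.2 0%N).1 = n%:R /\ disc r%:E (z.1 + displacement z.2 n)].

Lemma measurable_jump_number n : measurable [set z : plane R * marks R | (z.2 0%N).1 = n%:R].
Proof.
pose f (z : plane R * marks R) := (z.2 0%N).1 : measurableTypeR R.
have mf : measurable_fun setT f.
  apply: (measurableT_comp (@measurable_fst _ _ _ _)).
  exact: (measurableT_comp (@measurable_coord R 0) (@measurable_snd _ _ _ _)).
exact: (measurable_preim mf (measurable_set1 _)).
Qed.

Lemma measurable_position r m :
  measurable [set z : plane R * marks R | disc r (z.1 + displacement z.2 m)].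
Proof.
have mf : measurable_fun setT (fun z : plane R * marks R => z.1 + displacement z.2 m : plane R).
  apply: measurable_planeD; first exact: measurable_fst.
  exact: (measurableT_comp (measurable_displacement m) (@measurable_snd _ _ _ _)).
exact: (measurable_preim mf (measurable_disc r)).
Qed.

Lemma measurable_hitting k : measurable (hitting k).
Proof.
rewrite (_ : hitting k = \bigcup_n \bigcup_(m in [set m | (m <= n) && (m < k)]%N)
  ([set z | (z.2 0%N).1 = n%:R] `&` [set z | disc r0%:E (z.1 + displacement z.2 m)])).
  apply: bigcupT_measurable => n; apply: bigcup_measurable => m _.
  by apply: measurableI; [exact: measurable_jump_number|exact: measurable_position].
apply/seteqP; split => z /=.
  by move=> [n [m [zn mn mk zd]]]; exists n => //; exists m => //=; rewrite mn.
by move=> [n _ [m /= /andP[mn mk] [zn zd]]]; exists n, m.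
Qed.

Lemma measurable_final r : measurable (final r).
Proof.
rewrite (_ : final r = \bigcup_n
  ([set z | (z.2 0%N).1 = n%:R] `&` [set z | disc r%:E (z.1 + displacement z.2 n)])).
  apply: bigcupT_measurable => n.
  by apply: measurableI; [exact: measurable_jump_number|exact: measurable_position].
apply/seteqP; split => z /=.
  by move=> [n [zn zd]]; exists n.
by move=> [n _ [zn zd]]; exists n.
Qed.

End displacement.

Section explosion.
Context d (T : measurableType d) (R : realType) (P : probability T R).
Variables (lambda : R) (X : nat -> T -> plane R) (N : nat -> R -> T -> nat)
  (nu : nat -> nat -> T -> plane R).
Hypothesis lambda0 : 0 < lambda.
Hypothesis mX : forall i, measurable_fun setT (X i).
Hypothesis mN : forall i t, measurable_fun setT (N i t).
Hypothesis mnu : forall i m, measurable_fun setT (nu i m).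
Hypothesis ppp : poisson_point_process P lambda X.
Hypothesis poissonN : forall i, poisson_process P 1 (N i).
Hypothesis gaussian : forall i m (A : set (plane R)), measurable A ->
  P [set w | A (nu i m w)] = std_gaussian2 A.
Hypothesis indep : mutually_independent P (source_events X N nu).
Local Open Scope ereal_scope.

Local Notation mean := (mean_count P lambda N nu).
Local Notation cnt := (particle_count X N nu).
Let r0 : R := ((Num.sqrt pi)^-1)%R.
Let S (w : T) m : plane R := (\sum_(l < m) nu 0 l w)%R.

(** For each value of the displacement, the admissible starting points form a translate of the disc:
    the motion preserves the intensity. *)
Lemma mean_final t r : (0 < r)%R -> mean t (final r) = lambda%:E * darea r%:E.
Proof.
move=> rp; rewrite /mean_count; congr (_ * _).
transitivity (\int[P]_w darea r%:E).
  apply: eq_integral => w _; rewrite -area_disc//.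
  rewrite -[RHS](area_shift (S w (N 0 t w)) (measurable_disc r%:E)); congr area.
  apply/seteqP; split => x /=.
    by move=> [n [/eqP]]; rewrite eqr_nat => /eqP <-.
  by exists (N 0 t w).
by rewrite integral_cst// [X in _ * X]probability_setT mule1.
Qed.

Let g (k : nat) w := area [set x | hitting k (x, mark N nu k%:R 0 w)].

Let gE k w : [set x | hitting k (x, mark N nu k%:R 0 w)] =
  \big[setU/set0]_(m < k) [set x | (m <= N 0 k%:R w)%N /\ disc r0%:E (x + S w m)%R].
Proof.
rewrite -(bigcup_mkord k (fun m => [set x | (m <= N 0 k%:R w)%N /\ disc r0%:E (x + S w m)%R])).
apply/seteqP; split => x /=.
  by move=> [n [m [/eqP]]]; rewrite eqr_nat => /eqP <- mn mk xd; exists m.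
by move=> [m mk [mn xd]]; exists (N 0 k%:R w), m.
Qed.

Let mg k : measurable_fun setT (g k).
Proof. exact: (measurable_area_section (measurable_mark mN mnu _ _) (measurable_hitting k)). Qed.

Let mU k w m : measurable [set x | (m <= N 0 k%:R w)%N /\ disc r0%:E (x + S w m)%R].
Proof.
have [mN'|mN'] := leqP m (N 0 k%:R w).
  rewrite (_ : [set x | _] = [set x | disc r0%:E (x + S w m)%R]).
    exact: measurable_disc_shift.
  by apply/seteqP; split => x /= [].
by rewrite (_ : [set x | _] = set0)//; apply/seteqP; split => x /= [].
Qed.

Let mhit k w : measurable [set x | hitting k (x, mark N nu k%:R 0 w)].
Proof. by rewrite gE; apply: bigsetU_measurable => m _; exact: mU. Qed.

Let g_le k w : g k w <= k%:R%:E.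
Proof.
rewrite /g gE; apply: le_trans (Boole_inequality (@area R) (fun m _ => mU k w m)) _.
rewrite (_ : k%:R%:E = \sum_(m < k) (1 : \bar R)).
  apply: lee_sum => m _; rewrite -(area_unit_disc_shift (S w m)).
  by apply: le_measure; rewrite ?inE; [exact: mU|exact: measurable_disc_shift|move=> x []].
by rewrite sumEFin sumr_const card_ord.
Qed.

Let hit_mono w k l : (k <= l)%N ->
  [set x | hitting k (x, mark N nu k%:R 0 w)] `<=` [set x | hitting l (x, mark N nu l%:R 0 w)].
Proof.
move=> kl x /= [n [m [/eqP]]]; rewrite eqr_nat => /eqP <- mn mk xd.
exists (N 0 l%:R w), m; split => //; last exact: leq_trans mk kl.
apply: leq_trans mn _; have [_ Nmono _ _ _] := poissonN 0.
by apply: Nmono; rewrite ?ler_nat.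
Qed.

Let g_cvg w : (forall n, exists k : nat, (n < N 0 k%:R w)%N) ->
  (forall K : R, exists m, (K < `|(S w m).1|)%R) -> limn (fun k => g k w) = +oo.
Proof.
move=> Noo Soo; apply/cvg_lim => //.
have := @nondecreasing_cvg_mu _ _ _ (@area R) (fun k => [set x | hitting k (x, mark N nu k%:R 0 w)]).
rewrite (_ : \bigcup_k _ = [set x | exists m, disc r0%:E (x + S w m)%R]); last first.
  apply/seteqP; split => x /=.
    by move=> [k _ [n [m [_ _ _ xd]]]]; exists m.
  move=> [m xd]; have [k mk] := Noo m.
  exists (maxn k m.+1) => //; exists (N 0 (maxn k m.+1)%:R w), m; split => //; last exact: leq_maxr.
  apply: leq_trans (ltnW mk) _; have [_ Nmono _ _ _] := poissonN 0.
  by apply: Nmono; rewrite ?ler_nat ?leq_maxl.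
have sE : area [set x | exists m, disc r0%:E (x + S w m)%R] = +oo := infinite_sausage Soo.
rewrite -sE; apply => //.
  rewrite (_ : [set x | _] = \bigcup_m [set x | disc r0%:E (x + S w m)%R]).
    by apply: bigcupT_measurable => m; exact: measurable_disc_shift.
  by apply/seteqP; split => x /= [m]; [move=> ?; exists m|move=> _ ?; exists m].
by move=> k l kl; apply/subsetPset; exact: hit_mono.
Qed.

Let intg_fin k : \int[P]_w g k w \is a fin_num.
Proof.
rewrite ge0_fin_numE ?integral_ge0//.
apply: (@le_lt_trans _ _ (\int[P]_w k%:R%:E)).
  by apply: ge0_le_integral => //; exact: mg.
by rewrite integral_cst// [X in _ * X]probability_setT mule1 ltry.
Qed.

Lemma mean_hitting_fin k : mean k%:R (hitting k) \is a fin_num.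
Proof. by rewrite fin_numM// intg_fin. Qed.

Lemma mean_hitting_unbounded (M : R) : exists k, M%:E <= mean k%:R (hitting k).
Proof.
apply: contrapT => /forallNP HM.
have HM' k : \int[P]_w g k w <= (M / lambda)%:E.
  have := HM k; rewrite /mean_count -/(g k) => /negP; rewrite -ltNge => /ltW.
  by rewrite -(fineK (intg_fin k)) -EFinM !lee_fin ler_pdivlMr// mulrC.
have := @monotone_convergence _ T R P setT measurableT (fun k w => g k w) mg.
have -> : \int[P]_w limn (fun k => g k w) = +oo.
  transitivity (\int[P]_w (+oo : \bar R)); last by rewrite integral_cst// [X in _ * X]probability_setT mule1.
  apply: ae_eq_integral => //.
    refine (emeasurable_fun_cvg (fun k w => g k w) _ mg _) => w _; apply: ereal_nondecreasing_is_cvgn => k l kl.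
    by apply: le_measure; rewrite ?inE//; exact: hit_mono.
  apply: negligibleS (negligibleU (clock_unbounded mN poissonN 0) (walk_unbounded mnu gaussian indep 0)).
  move=> w /= /not_implyP[_ H]; apply: contrapT => /not_orP[/forallNP H1 /contrapT H2]; apply: H.
  apply: g_cvg => // n.
  by have /existsNP[k /negP] := H1 n; rewrite -ltnNge; exists k.
move=> mc; have {mc}E : +oo = limn (fun k => \int[P]_w g k w).
  apply: mc => [k w _|w _ k l kl]; first exact: measure_ge0.
  by apply: le_measure; rewrite ?inE//; exact: hit_mono.
have : limn (fun k => \int[P]_w g k w) <= (M / lambda)%:E.
  apply: lime_le; last exact: nearW.
  apply: ereal_nondecreasing_is_cvgn => k l kl.
  apply: ge0_le_integral.
  - exact: measurableT.
  - by move=> w _; exact: measure_ge0.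
  - exact: mg.
  - exact: mg.
  - by move=> w _; apply: le_measure; rewrite ?inE; [exact: mhit|exact: mhit|exact: hit_mono].
by rewrite -E leye_eq.
Qed.


(** Integer horizons keep the number of exceptional events countable. *)
Definition regular_clocks w := forall k : nat,
  (forall i m, (m <= N i k%:R w)%N -> exists2 s : R, (0 <= s <= k%:R)%R & N i s w = m) /\
  (forall i j, i <> j -> forall s : R, (0 < s <= k%:R)%R -> exists2 u : R, (0 <= u < s)%R &
     (forall v, (u <= v <= s)%R -> N i v w = N i s w) \/
     (forall v, (u <= v <= s)%R -> N j v w = N j s w)).

Lemma regular_clocks_ae : P.-negligible [set w | ~ regular_clocks w].
Proof.
have nU (k i : nat) := @unit_jumps _ _ _ P N mN poissonN i k%:R (ler0n _ _).
have nC (k i j : nat) : P.-negligible [set w | ~ (i <> j -> forall s : R, (0 < s <= k%:R)%R ->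
    exists2 u : R, (0 <= u < s)%R &
     (forall v, (u <= v <= s)%R -> N i v w = N i s w) \/
     (forall v, (u <= v <= s)%R -> N j v w = N j s w))].
  have [<-|/eqP ij] := eqVneq i j; first by apply: negligibleS (negligible_set0 P) => w /= [].
  by apply: negligibleS (no_common_jump mN poissonN indep ij (ler0n R k)) => w /= /not_implyP[].
apply: negligibleS (negligible_bigcup (fun k => negligibleU
  (negligible_bigcup (fun i => nU k i))
  (negligible_bigcup (fun i => negligible_bigcup (fun j => nC k i j))))).
move=> w /= /existsNP[k /not_andP[]] H; exists k => //; [left|right].
  by move/existsNP : H => [i Hi]; exists i.
by move/existsNP : H => [i /existsNP[j Hj]]; exists i => //; exists j.
Qed.

Lemma non_explosion_mass w (k : nat) : regular_clocks w ->
  pool_radius (walk X N nu w) k%:R != +oo ->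
  exists2 E : R, (0 <= E)%R & 1 + cnt k%:R (hitting k) w <= darea E%:E /\
    1 + cnt k%:R (final E) w <= darea E%:E.
Proof.
move=> /(_ k)[unit nosim] rfin.
have walk_nosim t : (0 < t <= k%:R)%R -> forall i j, i <> j -> exists2 s : R, (0 <= s < t)%R &
    (forall u, (s <= u <= t)%R -> walk X N nu w i u = walk X N nu w i t) \/
    (forall u, (s <= u <= t)%R -> walk X N nu w j u = walk X N nu w j t).
  move=> tk i j ij; have [u us H] := nosim i j ij t tk; exists u => //.
  by case: H => H; [left|right] => v vI; rewrite /walk H.
have kk : (0 <= (k%:R : R) <= k%:R)%R by apply/andP; split; [exact: ler0n|exact: lexx].
have [E E0 mE] := pool_mass walk_nosim kk rfin.
exists E => //; split; apply: le_trans mE; rewrite leeD2l//; apply: le_counting => i.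
  (* A time at which the clock reads [m] is a time at which the walk sits at its [m]-th position. *)
  move=> [n [m [/eqP]]]; rewrite eqr_nat => /eqP <- /unit[s sk Ns] _ dm; left.
  by exists s => //; rewrite /walk Ns.
by move=> [n [/eqP]]; rewrite eqr_nat => /eqP <- dn; right.
Qed.

Let rho (n : nat) : R := (n%:R / Num.sqrt pi)%R.
(** A surviving pool with area between [n ^ 2] and [(n + 1) ^ 2] belongs to this event: it contains
    the disc of area [n ^ 2] and holds fewer particles than its own area. Countably many events thus
    handle all radii. *)
Let crowded (k n : nat) := [set w | cnt k%:R (final (rho n)) w <= (n.+1%:R ^+ 2)%:E].

Let darea_rho n : darea (rho n)%:E = (n%:R ^+ 2)%:E.
Proof.
rewrite /darea /rho -EFin_expe -EFinM; congr _%:E.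
by rewrite exprMn exprVn sqr_sqrtr ?pi_ge0// mulfVK// gt_eqF// pi_gt0.
Qed.

Let measurable_cnt_le t F (c : \bar R) : measurable F -> measurable [set w | cnt t F w <= c].
Proof.
move=> mF; rewrite -[X in measurable X]setTI; apply: emeasurable_fun_infty_c => //.
exact: measurable_particle_count.
Qed.

(** With [del = lambda - 1], the condition [6 <= del * n] makes the deviation
    [del * n ^ 2 - 2 * n - 1] at least half of [del * n ^ 2]. So [p] is at most
    [4 * lambda / (del ^ 2 * n ^ 2)], and [n + 1 <= 2 * n] gives the telescoping form. *)
Lemma crowded_arith (n p : R) : (1 < lambda)%R -> (1 <= n)%R -> (6 <= (lambda - 1) * n)%R ->
  (0 <= p)%R -> ((lambda * n ^+ 2 - (n + 1) ^+ 2) ^+ 2 * p <= lambda * n ^+ 2)%R ->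
  (p <= 8 * lambda / (lambda - 1) ^+ 2 / n - 8 * lambda / (lambda - 1) ^+ 2 / (n + 1))%R.
Proof.
move=> l1 n1 n6 p0 H; set del := (lambda - 1)%R in n6 *.
have del0 : (0 < del)%R by rewrite /del subr_gt0.
have -> : (8 * lambda / del ^+ 2 / n - 8 * lambda / del ^+ 2 / (n + 1) =
  8 * lambda / (del ^+ 2 * n * (n + 1)))%R.
  by field; rewrite !gt_eqF//; lra.
rewrite ler_pdivlMr; last by rewrite !mulr_gt0 ?exprn_gt0//; lra.
have vu : (del * n ^+ 2 / 2 <= lambda * n ^+ 2 - (n + 1) ^+ 2)%R.
  have -> : lambda = (del + 1)%R by rewrite /del subrK.
  by nra.
have v0 : (0 <= del * n ^+ 2 / 2)%R by rewrite divr_ge0// mulr_ge0 ?sqr_ge0// ltW.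
have H1 : ((del * n ^+ 2 / 2) ^+ 2 * p <= lambda * n ^+ 2)%R.
  by apply: le_trans H; rewrite ler_wpM2r// ler_pXn2r// ?nnegrE// (le_trans v0).
have H2 : (del ^+ 2 * n ^+ 2 * p <= 4 * lambda)%R.
  have n20 : (0 < n ^+ 2)%R by rewrite exprn_gt0//; lra.
  rewrite -(ler_pM2r n20); move: H1; move: (n ^+ 2)%R => q; nra.
apply: (@le_trans _ _ (2 * (del ^+ 2 * n ^+ 2 * p))%R); last by lra.
have : (0 <= del ^+ 2 * p * n * (n - 1))%R by rewrite !mulr_ge0 ?sqr_ge0//; lra.
by nra.
Qed.

Lemma crowded_prob k n : (1 < lambda)%R -> (0 < n)%N -> (6 <= (lambda - 1) * n%:R)%R ->
  P (crowded k n) <= (8 * lambda / (lambda - 1) ^+ 2 / n%:R -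
    8 * lambda / (lambda - 1) ^+ 2 / n.+1%:R)%:E.
Proof.
move=> l1 n0 n6.
have n1 : (1 <= n%:R :> R)%R by rewrite ler1n.
have rho0 : (0 < rho n)%R by rewrite divr_gt0 ?ltr0n// sqrtr_gt0 pi_gt0.
have mC : measurable (crowded k n).
  by apply: measurable_cnt_le; exact: measurable_final.
have := @particle_chebyshev _ T R P lambda X N nu lambda0 mX mN mnu ppp poissonN gaussian indep
  k%:R (final (rho n)) (lambda * n%:R ^+ 2) (lambda * n%:R ^+ 2 - n.+1%:R ^+ 2) (crowded k n)
  (ler0n _ _) (measurable_final _) _ mC.
rewrite -(fineK (fin_num_measure P _ mC)) -EFinM !lee_fin -natr1 => H.
apply: crowded_arith => //; first by rewrite fine_ge0.
apply: H.
- by rewrite mean_final// darea_rho.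
- by move=> w H; left; rewrite opprB addrCA subrr addr0 natr1.
- by rewrite subr_ge0; nra.
Qed.

Lemma explosion_finite_ae : (1 < lambda)%R ->
  P.-negligible [set w | ~ explosion_time (walk X N nu w) < +oo].
Proof.
move=> l1; pose Bad := [set w | regular_clocks w /\ ~ explosion_time (walk X N nu w) < +oo].
suff : P.-negligible Bad.
  move=> /(negligibleU regular_clocks_ae); apply: negligibleS => w /= H.
  by have [?|?] := pselect (regular_clocks w); [right|left].
apply: negligible_small => e e0.
set C := (8 * lambda / (lambda - 1) ^+ 2)%R.
have C0 : (0 <= C)%R by rewrite divr_ge0 ?sqr_ge0// mulr_ge0// ltW.
(* The first term brings all [n >= n1] within the scope of [crowded_prob], the second makes the sum
   of these probabilities, at most [C / n1], smaller than [e / 2]. *)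
pose n1 := (Num.truncn (6 / (lambda - 1) + 2 * C / e)%R).+1.
have n1g : (6 / (lambda - 1) + 2 * C / e <= n1%:R)%R by rewrite ltW// truncnS_gt.
have q1 : (0 <= 6 / (lambda - 1))%R by rewrite divr_ge0// subr_ge0 ltW.
have q2 : (0 <= 2 * C / e)%R by rewrite divr_ge0 ?(ltW e0)// mulr_ge0.
have n16 : (6 <= (lambda - 1) * n1%:R)%R.
  by rewrite mulrC -ler_pdivrMr ?subr_gt0//; lra.
have n1C : (C / n1%:R <= e / 2)%R.
  rewrite ler_pdivrMr ?ltr0n// mulrC mulrA ler_pdivlMr//.
  have : (2 * C / e <= n1%:R)%R by lra.
  by rewrite ler_pdivrMr// (mulrC C).
(* With [mu] the mean, the Chebyshev error [4 / mu] is at most [e / 2] because [mu >= 8 / e]; half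
   the mean exceeds [n1 ^ 2], which forces the pool to be large. *)
have [k kM] := mean_hitting_unbounded (8 / e + 2 * n1%:R ^+ 2)%R.
have := mean_hitting_fin k; move muE : (mean k%:R (hitting k)) kM => [mu| |]// + _.
rewrite lee_fin => muM.
have q3 : (0 < 8 / e)%R by rewrite divr_gt0.
have q4 : (0 <= n1%:R ^+ 2 :> R)%R by exact: sqr_ge0.
have mu0 : (0 < mu)%R by lra.
pose E1 := [set w | cnt k%:R (hitting k) w <= (mu - mu / 2)%:E].
have mE1 : measurable E1 by apply: measurable_cnt_le; exact: measurable_hitting.
have PE1 : P E1 <= (e / 2)%:E.
  have := @particle_chebyshev _ T R P lambda X N nu lambda0 mX mN mnu ppp poissonN gaussian indep
    k%:R (hitting k) mu (mu / 2) E1 (ler0n _ _) (measurable_hitting _) muE mE1.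
  rewrite -(fineK (fin_num_measure P _ mE1)) -EFinM !lee_fin => H.
  have {}H : ((mu / 2) ^+ 2 * fine (P E1) <= mu)%R.
    by apply: H; [move=> w ?; left|rewrite divr_ge0// ltW].
  have mue : (8 <= e * mu)%R.
    by rewrite mulrC -ler_pdivrMr//; lra.
  have H2 : (mu * fine (P E1) <= 4)%R.
    rewrite -(ler_pM2r mu0); nra.
  rewrite -(ler_pM2l mu0); lra.
exists (E1 `|` \bigcup_n crowded k (n1 + n)); split.
- apply: measurableU => //; apply: bigcupT_measurable => n.
  by apply: measurable_cnt_le; exact: measurable_final.
- move=> w [reg noexp].
  have rfin : pool_radius (walk X N nu w) k%:R != +oo.
    apply/eqP => rk; apply: noexp; apply: (@le_lt_trans _ _ k%:R%:E); last by rewrite ltry.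
    by apply: ereal_inf_lbound; exists k%:R.
  have [E E0 [mH mF]] := non_explosion_mass reg rfin.
  have [?|nE1] := pselect (E1 w); [by left|right].
  pose a := (E ^+ 2 * pi)%R.
  have aE : darea E%:E = a%:E by rewrite /darea -EFin_expe -EFinM.
  have a0 : (0 <= a)%R by rewrite mulr_ge0 ?sqr_ge0 ?pi_ge0.
  have an1 : (n1%:R ^+ 2 <= a)%R.
    move/negP : nE1; rewrite /E1 /= -ltNge => nE1.
    rewrite -lee_fin -aE; apply: le_trans mH; apply: (@le_trans _ _ (mu - mu / 2)%:E).
      by rewrite lee_fin; lra.
    by apply: (le_trans (ltW nE1)); rewrite leeDr.
  (* The pool area lies between [n ^ 2] and [(n + 1) ^ 2]. *)
  pose n := Num.truncn (Num.sqrt a).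
  have /andP[na an] : (n%:R <= Num.sqrt a < n.+1%:R)%R.
    by rewrite /n truncn_le ?sqrtr_ge0// truncnS_gt.
  have n1n : (n1 <= n)%N.
    rewrite -ltnS -(@ltr_nat R); apply: le_lt_trans an.
    by rewrite -[leLHS]ger0_norm// -sqrtr_sqr ler_sqrt.
  exists (n - n1)%N => //; rewrite /crowded /= subnKC//.
  apply: (@le_trans _ _ (cnt k%:R (final E) w)).
    apply: le_counting => i [l [Nl dl]]; exists l; split => //.
    apply: disc_sub dl; rewrite -le_darea; last 2 first.
    - by rewrite lee_fin divr_ge0// sqrtr_ge0.
    - by rewrite lee_fin.
    rewrite [leLHS]darea_rho aE lee_fin.
    by rewrite -[leRHS]sqr_sqrtr// ler_pXn2r// ?nnegrE ?sqrtr_ge0.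
  apply: (@le_trans _ _ (darea E%:E)); first by apply: le_trans mF; rewrite leeDr.
  by rewrite aE lee_fin -[leLHS]sqr_sqrtr// ler_pXn2r// ?nnegrE ?sqrtr_ge0// ltW.
- apply: le_trans (measureU2 _ _ _) _ => //.
    apply: bigcupT_measurable => n.
    by apply: measurable_cnt_le; exact: measurable_final.
  rewrite [e]splitr EFinD leeD//.
  apply: (@le_trans _ _ (C / n1%:R)%:E); last by rewrite lee_fin.
  rewrite -[n1 in leRHS]addn0.
  apply: (@prob_bigcup_telescope _ _ _ P (fun n => crowded k (n1 + n)) (fun n => C / (n1 + n)%:R)%R).
  + by move=> n; apply: measurable_cnt_le; exact: measurable_final.
  + move=> n; rewrite addnS; apply: crowded_prob => //.
    by apply: le_trans n16 _; rewrite ler_pM2l ?subr_gt0// ler_nat leq_addr.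
  + by move=> n; rewrite divr_ge0.
Qed.

End explosion.

(** * Path length of a walk *)

Section gaussian_moment.
Context {R : realType}.
Local Open Scope ereal_scope.

Let layer (k : nat) : set R := [set y | k%:R <= `|y| < k.+1%:R]%R.

Let measurable_layer k : measurable (layer k).
Proof.
have mabs : measurable_fun setT (fun y : measurableTypeR R => `|y|%R : measurableTypeR R).
  exact: normr_measurable.
have mI : measurable [set u : measurableTypeR R | (k%:R <= u < k.+1%:R)%R].
  by rewrite -set_itvco.
exact: (measurable_preim mabs mI).
Qed.

Let layerT : \bigcup_k layer k = setT.
Proof.
apply/seteqP; split => // y _; exists (Num.truncn `|y|) => //=.
by apply/andP; split; [rewrite truncn_le|exact: truncnS_gt].
Qed.

Let trivIset_layer : trivIset setT layer.
Proof.
apply/trivIsetP => i j _ _ ij; apply/seteqP; split => // y /= [/andP[a b] /andP[c e]].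
have := le_lt_trans a e; have := le_lt_trans c b; rewrite !ltr_nat !ltnS => ji ij'.
by move: ij; rewrite eqn_leq ji ij'.
Qed.

Let s2 : R := Num.sqrt 2.
Let C : R := (8 * normal_peak 1 / normal_peak s2)%R.

Let s2_neq0 : s2 != 0%R. Proof. by rewrite gt_eqF// sqrtr_gt0. Qed.

(* [1 + u <= expR u] trades the polynomial factor for a wider Gaussian. *)
Let expR_sqr_le (k y : R) : (0 <= k <= `|y| + 1)%R ->
  (k ^+ 2 * expR (- y ^+ 2 / 2) <= 8 * expR (- y ^+ 2 / (2 *+ 2)))%R.
Proof.
move=> /andP[k0 ky]; pose u := (y ^+ 2 / 4)%R.
have -> : (- y ^+ 2 / 2 = - u + - u)%R by rewrite /u; field.
have -> : (- y ^+ 2 / (2 *+ 2) = - u)%R by rewrite /u; field.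
rewrite expRD mulrA ler_pM2r ?expR_gt0// expRN ler_pdivrMr ?expR_gt0//.
apply: (@le_trans _ _ (8 * (1 + u))%R); last by rewrite ler_pM2l// expR_ge1Dx.
apply: (@le_trans _ _ ((`|y| + 1) ^+ 2)%R).
  by rewrite ler_pXn2r// nnegrE ?addr_ge0.
have := sqr_ge0 (`|y| - 1)%R; rewrite /u -[(y ^+ 2)%R]real_normK ?num_real//.
by move: `|y|%R => v; nra.
Qed.

Let density_le (k : nat) (y : R) : layer k y ->
  (k.+1%:R ^+ 2 * normal_pdf 0 1 y <= C * normal_pdf 0 s2 y)%R.
Proof.
move=> /andP[ky _]; rewrite !normal_pdfE ?oner_neq0// /normal_fun subr0 expr1n sqr_sqrtr//.
have p1 : (0 < normal_peak (1 : R))%R by exact: normal_peak_gt0 (oner_neq0 _).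
have p2 : (0 < normal_peak s2)%R by exact: normal_peak_gt0.
have := @expR_sqr_le k.+1%:R y; rewrite ler0n -natr1 lerD2r ky => /(_ isT).
rewrite /C; move: p1 p2; move: (normal_peak 1) (normal_peak s2) (expR _) (expR _) => a b e f a0 b0 H.
rewrite (_ : 8 * a / b * (b * e) = a * (8 * e))%R; last by field; rewrite gt_eqF.
by rewrite mulrCA ler_pM2l.
Qed.

Let msqr : measurable_fun setT (fun y : measurableTypeR R => (y ^+ 2)%:E : \bar R).
Proof. by apply/measurable_EFinP; exact: measurable_funX. Qed.

(** Only finiteness matters: on each layer [y ^ 2] times the density is at most [C] times the
    density of the normal law of variance 2, and the masses of the layers under that law add up to
    1. *)
Lemma normal_second_moment :
  \int[@normal_prob R 0 1]_y ((y : measurableTypeR R) ^+ 2)%:E < +oo.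
Proof.
rewrite -layerT ge0_integral_bigcup//; last 2 first.
- by rewrite layerT.
- by move=> y _; rewrite lee_fin sqr_ge0.
apply: (@le_lt_trans _ _ (\sum_(0 <= k <oo) C%:E * normal_prob 0 s2 (layer k))); last first.
  rewrite nneseriesZl//.
  have -> : \sum_(0 <= k <oo) normal_prob 0 s2 (layer k) = 1; last by rewrite mule1 ltry.
  transitivity (normal_prob 0 s2 (\bigcup_k layer k)).
    by rewrite -eseries_setT; apply/esym; apply: measure_bigcup => [k _|]; [exact: measurable_layer|exact: trivIset_layer].
  by rewrite layerT; exact: probability_setT.
apply: lee_nneseries => // k _.
  by move=> _; apply: integral_ge0 => y _; rewrite lee_fin sqr_ge0.
apply: (@le_trans _ _ ((k.+1%:R ^+ 2)%:E * normal_prob 0 1 (layer k))).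
  rewrite -[leRHS](@integral_cst _ _ _ (@normal_prob R 0 1) _ (measurable_layer k)).
  apply: ge0_le_integral => //.
  - exact: measurable_layer.
  - by move=> y _; rewrite lee_fin sqr_ge0.
  - exact: measurable_funTS.
  - move=> y /andP[_ yk]; rewrite lee_fin -[leLHS]real_normK ?num_real//.
    by rewrite ler_pXn2r ?nnegrE// ltW.
have mp s : measurable_fun (layer k) (fun y => (normal_pdf 0 s y)%:E).
  by apply/measurable_funTS/measurable_EFinP; exact: measurable_normal_pdf.
have C0 : (0 <= C)%R by rewrite !mulr_ge0 ?normal_peak_ge0// invr_ge0 normal_peak_ge0.
have scaled (c s : R) : (0 <= c)%R ->
    c%:E * normal_prob 0 s (layer k) = \int[lebesgue_measure]_(y in layer k) (c * normal_pdf 0 s y)%:E.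
  move=> c0; under [RHS]eq_integral do rewrite EFinM.
  rewrite [RHS]ge0_integralZl//; [exact: measurable_layer|exact: mp|].
  by move=> y _; rewrite lee_fin normal_pdf_ge0.
rewrite !scaled//; apply: ge0_le_integral.
- exact: measurable_layer.
- by move=> y _; rewrite lee_fin mulr_ge0// normal_pdf_ge0.
- by apply/measurable_funTS/measurable_EFinP/measurable_funM => //; exact: measurable_normal_pdf.
- by apply/measurable_funTS/measurable_EFinP/measurable_funM => //; exact: measurable_normal_pdf.
- by move=> y yk; rewrite lee_fin density_le.
Qed.

Lemma gaussian2_second_moment :
  \int[@normal_prob R 0 1 \x @normal_prob R 0 1]_x ((euclid x) ^+ 2)%:E < +oo.
Proof.
have -> : \int[@normal_prob R 0 1 \x @normal_prob R 0 1]_x ((euclid x) ^+ 2)%:E =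
  \int[@normal_prob R 0 1 \x @normal_prob R 0 1]_x (((x.1 : measurableTypeR R) ^+ 2)%:E + ((x.2 : measurableTypeR R) ^+ 2)%:E).
  by apply: eq_integral => x _; rewrite sqr_euclid EFinD.
have m1 : measurable_fun setT (fun x : plane R => ((x.1 : measurableTypeR R) ^+ 2)%:E : \bar R).
  exact: (measurableT_comp msqr (@measurable_fst _ _ _ _)).
have m2 : measurable_fun setT (fun x : plane R => ((x.2 : measurableTypeR R) ^+ 2)%:E : \bar R).
  exact: (measurableT_comp msqr (@measurable_snd _ _ _ _)).
rewrite ge0_integralD//; last 2 first.
- by move=> x _; rewrite lee_fin sqr_ge0.
- by move=> x _; rewrite lee_fin sqr_ge0.
have normalX (A B : set (measurableTypeR R)) : measurable A -> measurable B ->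
    (@normal_prob R 0 1 \x @normal_prob R 0 1) (A `*` B) = normal_prob 0 1 A * normal_prob 0 1 B :> \bar R.
  exact: product_measure1E.
have -> : \int[@normal_prob R 0 1 \x @normal_prob R 0 1]_x ((x.1 : measurableTypeR R) ^+ 2)%:E = \int[@normal_prob R 0 1]_y ((y : measurableTypeR R) ^+ 2)%:E.
  transitivity (\int[push (@normal_prob R 0 1 \x @normal_prob R 0 1) (@measurable_fst _ _ _ _)]_y ((y : measurableTypeR R) ^+ 2)%:E).
    by rewrite /push [RHS]ge0_integral_pushforward// => y _; rewrite lee_fin sqr_ge0.
  apply: eq_measure_integral => A mA _.
  have E : [set x : plane R | A x.1] = A `*` setT by apply/seteqP; split => x //= [].
  transitivity ((@normal_prob R 0 1 \x @normal_prob R 0 1) (A `*` setT)); first by rewrite -E.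
  by rewrite [LHS]normalX// [X in _ * X]probability_setT mule1.
have -> : \int[@normal_prob R 0 1 \x @normal_prob R 0 1]_x ((x.2 : measurableTypeR R) ^+ 2)%:E = \int[@normal_prob R 0 1]_y ((y : measurableTypeR R) ^+ 2)%:E.
  transitivity (\int[push (@normal_prob R 0 1 \x @normal_prob R 0 1) (@measurable_snd _ _ _ _)]_y ((y : measurableTypeR R) ^+ 2)%:E).
    by rewrite /push [RHS]ge0_integral_pushforward// => y _; rewrite lee_fin sqr_ge0.
  apply: eq_measure_integral => A mA _.
  have E : [set x : plane R | A x.2] = setT `*` A by apply/seteqP; split => x //= [].
  transitivity ((@normal_prob R 0 1 \x @normal_prob R 0 1) (setT `*` A)); first by rewrite -E.
  by rewrite [LHS]normalX// [X in X * _]probability_setT mul1e.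
by rewrite lte_add_pinfty// normal_second_moment.
Qed.

End gaussian_moment.

Lemma sqr_sum_le (R : realType) (a : nat -> R) n :
  (\sum_(m < n) a m) ^+ 2 <= n%:R * \sum_(m < n) a m ^+ 2.
Proof.
elim: n => [|n IH]; first by rewrite !big_ord0 expr0n mul0r.
rewrite !big_ord_recr/=; move: IH; case: n => [|n].
  by rewrite !big_ord0 !add0r mul1r.
move: (\sum_(m < _) _) (\sum_(m < _) _) (a n.+1) => Q S b.
have n0 : (0 < n.+1%:R :> R) by rewrite ltr0n.
rewrite -[n.+2]addn1 natrD; move: (n.+1%:R) n0 => c c0 IH.
rewrite -(ler_pM2l c0).
have := sqr_ge0 (S - c * b).
have : (c + 1) * S ^+ 2 <= (c + 1) * (c * Q) by rewrite ler_pM2l// addr_gt0.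
lra.
Qed.

Lemma measurable_select d d' (T : measurableType d) (U : measurableType d') (f : nat -> T -> U)
    (n : T -> nat) : (forall k, measurable_fun setT (f k)) -> measurable_fun setT n ->
  measurable_fun setT (fun w => f (n w) w).
Proof.
move=> mf mn _ A mA; rewrite setTI.
rewrite (_ : _ @^-1` A = \bigcup_k ([set w | n w = k] `&` [set w | A (f k w)])).
  apply: bigcupT_measurable => k; apply: measurableI; last exact: measurable_preim.
  exact: (measurable_preim (A := [set k]) mn).
by apply/seteqP; split => w /=; [move=> ?; exists (n w)|move=> [k _ [<-]]].
Qed.

(** * Length of a path, and particles that may enter a disc *)

Section path_length.
Context d (T : measurableType d) (R : realType) (P : probability T R).
Variables (lambda : R) (X : nat -> T -> plane R) (N : nat -> R -> T -> nat)
  (nu : nat -> nat -> T -> plane R).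
Hypothesis lambda0 : 0 < lambda.
Hypothesis mN : forall i t, measurable_fun setT (N i t).
Hypothesis mnu : forall i m, measurable_fun setT (nu i m).
Hypothesis poissonN : forall i, poisson_process P 1 (N i).
Hypothesis gaussian : forall i m (A : set (plane R)), measurable A ->
  P [set w | A (nu i m w)] = std_gaussian2 A.
Hypothesis indep : mutually_independent P (source_events X N nu).
Variable t : R.
Hypothesis t0 : 0 <= t.
Local Open Scope ereal_scope.

Let sigma2 : \bar R := \int[@normal_prob R 0 1 \x @normal_prob R 0 1]_x ((euclid x) ^+ 2)%:E.
Let p n : \bar R := poisson_prob t 0 [set n].
Let D n := [set w | N 0 t w = n].

Let mD n : measurable (D n).
Proof. exact: (measurable_preim (A := [set n]) (mN 0 t)). Qed.

Let mE2 : measurable_fun setT (fun x : plane R => ((euclid x) ^+ 2)%:E : \bar R).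
Proof. by apply/measurable_EFinP; apply: measurable_funX; exact: measurable_euclid. Qed.

Lemma indep_clock_jump n m (A : set (plane R)) : measurable A ->
  P ([set w | A (nu 0 m w)] `&` D n) = p n * std_gaussian2 A.
Proof.
move=> mA; pose E s := match s with Clock _ => D n | Jump _ _ => [set w | A (nu 0 m w)] | _ => setT end.
have := @mutually_independent_seq _ _ _ P _ _ [:: Clock 0; Jump 0 m] E indep.
rewrite !big_cons big_nil mule1 /= gaussian// (law_N poissonN t0) => <-//.
- congr (P _); apply/seteqP; split => w /=.
    by move=> [? ?] s; rewrite !inE => /orP[] /eqP ->.
  by move=> H; split; [apply: (H (Jump 0 m)); rewrite !inE eqxx orbT|apply: (H (Clock 0)); rewrite !inE eqxx].
- by rewrite !inE andbT; apply/eqP.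
- move=> s; rewrite !inE => /orP[] /eqP -> /=; apply: sub_sigma_algebra.
    by exists t => //; exists [set n] => //; rewrite setTI.
  by exists tt => //; exists A => //; rewrite setTI.
Qed.

Lemma jump_moment n m :
  \int[P]_(w in D n) ((euclid (nu 0 m w)) ^+ 2)%:E = p n * sigma2.
Proof.
have pfin : p n \is a fin_num by rewrite /p fin_num_measure.
have p0 : (0 <= fine (p n))%R by rewrite fine_ge0// measure_ge0.
have E0 (x : plane R) : 0 <= ((euclid x) ^+ 2)%:E by rewrite lee_fin sqr_ge0.
have m2 : measurable_fun setT (fun w => ((euclid (nu 0 m w)) ^+ 2)%:E : \bar R).
  exact: (measurableT_comp mE2 (mnu 0 m)).
rewrite -(integral_mrestr P (mD n))//.
transitivity (\int[push (mrestr P (mD n)) (mnu 0 m)]_x ((euclid x) ^+ 2)%:E).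
  by rewrite /push [RHS]ge0_integral_pushforward// => x _; exact: E0.
transitivity (\int[mscale (NngNum p0) (@normal_prob R 0 1 \x @normal_prob R 0 1)]_x ((euclid x) ^+ 2)%:E).
  apply: eq_measure_integral => A mA _.
  transitivity (p n * std_gaussian2 A); first exact: indep_clock_jump.
  by rewrite /= /mscale /= fineK.
rewrite ge0_integral_mscale//.
by rewrite /= fineK.
Qed.

(** Bounds the displacement at all times up to [t] at once, so no maximal inequality is required. *)
Definition path_length w : R := (\sum_(m < N 0 t w) euclid (nu 0 m w))%R.

Lemma measurable_path_length : measurable_fun setT path_length.
Proof.
apply: (measurable_select (f := fun k w => \sum_(m < k) euclid (nu 0 m w))%R) => // k.
apply: measurable_sum => m; exact: (measurableT_comp (@measurable_euclid R) (mnu 0 m)).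
Qed.

Lemma path_length_ge0 w : (0 <= path_length w)%R.
Proof. by apply: sumr_ge0 => m _; exact: euclid_ge0. Qed.

(** On the event of [n] jumps, [sqr_sum_le] and independence of clock and jumps bound the integral
    by [sigma2 * n ^ 2 * p n]; what remains is the second moment of the clock. *)
Lemma path_second_moment : \int[P]_w ((path_length w) ^+ 2)%:E < +oo.
Proof.
have mL2 : measurable_fun setT (fun w => ((path_length w) ^+ 2)%:E : \bar R).
  by apply/measurable_EFinP; apply: measurable_funX; exact: measurable_path_length.
have L20 w : 0 <= ((path_length w) ^+ 2)%:E by rewrite lee_fin sqr_ge0.
pose C w : \bar R := (N 0 t w)%:R%:E.
have CE n : [set w | C w = n%:R%:E] = D n.
  by apply/seteqP; split => w /=; rewrite /C /D /=; [move=> [] /eqP; rewrite eqr_nat => /eqP|move=> ->].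
have sfin : sigma2 \is a fin_num.
  by rewrite ge0_fin_numE ?gaussian2_second_moment// integral_ge0// => x _; rewrite lee_fin sqr_ge0.
rewrite (@discrete_split _ T R P C p _ _ _ _ _ mL2 L20); last 4 first.
- apply/measurable_EFinP; exact: (@measurableT_comp _ _ _ _ _ _ (fun n : nat => n%:R : R)).
- by move=> n; rewrite CE; exact: (law_N poissonN t0).
- by rewrite [X in X < _]probability_setT ltry.
- by rewrite [RHS]probability_setT; exact: poisson_sum.
apply: (@le_lt_trans _ _ (\sum_(0 <= n <oo) (fine sigma2)%:E * (n%:R%:E * n%:R%:E * p n))).
  apply: lee_nneseries => [n _ _|n _]; first exact: integral_ge0.
  have m2 m : measurable_fun (D n) (fun w => n%:R%:E * ((euclid (nu 0 m w)) ^+ 2)%:E : \bar R).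
    apply: emeasurable_funM; first exact: measurable_cst.
    exact/measurable_funTS/(measurableT_comp mE2 (mnu 0 m)).
  have E0 m w : 0 <= n%:R%:E * ((euclid (nu 0 m w)) ^+ 2)%:E.
    by rewrite mule_ge0// lee_fin sqr_ge0.
  rewrite CE fineK//.
  apply: (@le_trans _ _ (\int[P]_(w in D n) (\sum_(m < n) n%:R%:E * ((euclid (nu 0 m w)) ^+ 2)%:E))).
    apply: ge0_le_integral.
    - exact: mD.
    - by [].
    - exact: measurable_funTS.
    - by apply: emeasurable_sum => m _; exact: m2.
    - move=> w; rewrite /D /= /path_length => ->.
      under eq_bigr do rewrite -EFinM.
      rewrite sumEFin lee_fin -mulr_sumr.
      exact: (sqr_sum_le (fun m => euclid (nu 0 m w)) n).
  rewrite (@ge0_integral_sum _ _ _ P _ (mD n) 'I_n (fun m w => n%:R%:E * ((euclid (nu 0 m w)) ^+ 2)%:E)); last 2 first.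
  - by move=> m; exact: m2.
  - by move=> m w _; exact: E0.
  rewrite (eq_bigr (fun=> n%:R%:E * (p n * sigma2))); last first.
    move=> m _; rewrite ge0_integralZl//; [by rewrite jump_moment| |].
    - exact/measurable_funTS/(measurableT_comp mE2 (mnu 0 m)).
    - by move=> w _; rewrite lee_fin sqr_ge0.
  have pfin : p n \is a fin_num by rewrite fin_num_measure.
  rewrite -(fineK pfin) -(fineK sfin) -!EFinM sumEFin sumr_const card_ord lee_fin -[X in (X <= _)%R]mulr_natr.
  by move: (n%:R : R) => x; rewrite le_eqVlt; apply/orP; left; apply/eqP; ring.
rewrite nneseriesZl; last first.
  by move=> n _; rewrite !mule_ge0 ?measure_ge0// lee_fin.
rewrite poisson_moment2//.
have -> : t%:E * t%:E + t%:E = (t * t + t)%:E by [].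
by rewrite -EFinM ltry.
Qed.

(** A necessary condition for entering the disc from outside, with the path length in place of the
    trajectory: the starting points it allows form an annulus. *)
Definition visiting (rho : R) : set (plane R * marks R) := [set z | ~ disc rho%:E z.1 /\
  exists n, (z.2 0%N).1 = n%:R%R /\ (euclid z.1 <= rho + \sum_(m < n) euclid (z.2 m.+1))%R].

Lemma measurable_visiting rho : measurable (visiting rho).
Proof.
rewrite (_ : visiting rho = [set z | ~ disc rho%:E z.1] `&` \bigcup_n
  ([set z | (z.2 0%N).1 = n%:R%R] `&`
   [set z | (euclid z.1 - \sum_(m < n) euclid (z.2 m.+1) <= rho)%R])).
  apply: measurableI.
    have mC : measurable (~` @disc R rho%:E) by apply: measurableC; exact: measurable_disc.
    exact: (measurable_preim (@measurable_fst _ _ (plane R) (marks R)) mC).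
  apply: bigcupT_measurable => n; apply: measurableI; first exact: measurable_jump_number.
  have mf : measurable_fun setT (fun z : plane R * marks R =>
      (euclid z.1 - \sum_(m < n) euclid (z.2 m.+1))%R : measurableTypeR R).
    apply: measurable_funB; first exact: (measurableT_comp (@measurable_euclid R) (@measurable_fst _ _ _ _)).
    apply: measurable_sum => m; apply: (measurableT_comp (@measurable_euclid R)).
    exact: (measurableT_comp (@measurable_coord R m.+1) (@measurable_snd _ _ _ _)).
  have mI : measurable [set u : measurableTypeR R | (u <= rho)%R] by rewrite -set_itvNyc.
  exact: (measurable_preim mf mI).
apply/seteqP; split => z /=.
  by move=> [zd [n [zn zl]]]; split => //; exists n => //; split => //=; rewrite lerBlDr.
by move=> [zd [n _ [zn zl]]]; split => //; exists n; rewrite -lerBlDr.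
Qed.

Let annulus_area rho w : (0 < rho)%R ->
  area [set x | visiting rho (x, mark N nu t 0 w)] =
  (((rho + path_length w) ^+ 2 - rho ^+ 2) * pi)%:E.
Proof.
move=> r0; have L0 := path_length_ge0 w.
have -> : [set x | visiting rho (x, mark N nu t 0 w)] =
    disc (rho + path_length w)%:E `\` disc rho%:E.
  apply/seteqP; split => x /=.
    by move=> [nd [n [/eqP]]]; rewrite eqr_nat => /eqP <- H; split.
  by move=> [H nd]; split => //; exists (N 0 t w).
rewrite measureD; [|exact: measurable_disc|exact: measurable_disc|].
- rewrite (_ : _ `&` _ = disc rho%:E); last first.
    by apply/setIidPr; apply: disc_sub; rewrite lee_fin lerDl.
  rewrite [X in X - _]area_disc; last by rewrite (lt_le_trans r0)// lerDl.
  by rewrite [X in _ - X]area_disc// /darea -!EFin_expe -!EFinM -EFinB mulrBl.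
- rewrite [X in X < _]area_disc; last by rewrite (lt_le_trans r0)// lerDl.
  by rewrite /darea -EFin_expe -EFinM ltry.
Qed.

(** The annulus has area [pi * (2 * rho * L + L ^ 2)], at most [pi * (1 + rho) * (1 + L ^ 2)] as
    [2 * L <= 1 + L ^ 2]. What counts is that the mean grows like the radius and not like the
    area. *)
Lemma mean_visiting_le : exists2 K : R, (0 <= K)%R & forall rho, (0 < rho)%R ->
  mean_count P lambda N nu t (visiting rho) <= (K * (1 + rho))%:E.
Proof.
set V := fine (\int[P]_w ((path_length w) ^+ 2)%:E).
have V0 : (0 <= V)%R by rewrite fine_ge0// integral_ge0// => w _; rewrite lee_fin sqr_ge0.
have VE : \int[P]_w ((path_length w) ^+ 2)%:E = V%:E.
  by rewrite fineK// ge0_fin_numE ?path_second_moment// integral_ge0// => w _; rewrite lee_fin sqr_ge0.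
exists (lambda * pi * (1 + V))%R.
  by rewrite !mulr_ge0 ?pi_ge0 ?addr_ge0// ltW.
have mL2 : measurable_fun setT (fun w => ((path_length w) ^+ 2)%:E : \bar R).
  by apply/measurable_EFinP; apply: measurable_funX; exact: measurable_path_length.
have L20 w : 0 <= ((path_length w) ^+ 2)%:E by rewrite lee_fin sqr_ge0.
move=> rho r0; rewrite /mean_count -!mulrA EFinM lee_pmul2l ?lte_fin//.
apply: (@le_trans _ _ (\int[P]_w ((pi * (1 + rho))%:E * (1 + ((path_length w) ^+ 2)%:E)))).
  apply: ge0_le_integral => //.
  - exact: (measurable_area_section (measurable_mark mN mnu _ _) (measurable_visiting rho)).
  - apply: emeasurable_funM; first exact: measurable_cst.
    by apply: emeasurable_funD => //; exact: measurable_cst.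
  - move=> w _; rewrite annulus_area// -EFinD -EFinM lee_fin.
    have := path_length_ge0 w; move: (path_length w) => L L0.
    rewrite mulrC -mulrA ler_pM2l ?pi_gt0//.
    have := sqr_ge0 (L - 1); nra.
have c0 : (0 <= pi * (1 + rho))%R by rewrite mulr_ge0 ?pi_ge0// addr_ge0// ltW.
rewrite ge0_integralZl//; last 2 first.
- by apply: emeasurable_funD => //; exact: measurable_cst.
- by move=> w _; rewrite adde_ge0.
rewrite ge0_integralD//.
rewrite integral_cst// [X in _ * (_ * X + _)]probability_setT mule1 VE -EFinD -EFinM lee_fin.
by rewrite -mulrA [X in (_ * X <= _)%R]mulrC.
Qed.

End path_length.

(** * Lower tail of a Poisson law *)

Section poisson_mode.
Context {R : realType}.
Variables (s k : nat) (p : nat -> R).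
Hypothesis s0 : (0 < s)%N.
Hypothesis ks : (4 * k <= s)%N.
Hypothesis p0 : forall n, 0 <= p n.
Hypothesis pS : forall n, n.+1%:R * p n.+1 = (s ^ 2)%:R * p n.

Let b := (s ^ 2)%N.
Let b0 : 0 < b%:R :> R. Proof. by rewrite ltr0n expn_gt0 s0. Qed.

(** The ratio of consecutive masses, [b / (n + 1)], is at least 1 below [b] and at most 1 from [b]
    on. *)
Lemma poisson_mode n : p n <= p b.
Proof.
have up m : (m <= b)%N -> p (b - m)%N <= p b.
  elim: m => [|m IH] mb; first by rewrite subn0.
  apply: le_trans (IH (ltnW mb)); have := pS (b - m.+1)%N; rewrite subnSK// => E.
  have bm : 0 < (b - m)%:R :> R by rewrite ltr0n subn_gt0.
  by rewrite -(ler_pM2l bm) E ler_wpM2r// ler_nat leq_subr.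
have down m : p (b + m)%N <= p b.
  elim: m => [|m IH]; first by rewrite addn0.
  apply: le_trans IH; have := pS (b + m)%N; rewrite -addnS => E.
  have bm : 0 < (b + m.+1)%:R :> R by rewrite ltr0n addnS.
  by rewrite -(ler_pM2l bm) E ler_wpM2r// ler_nat leq_addr.
have [nb|/ltnW bn] := leqP n b; first by rewrite -(subKn nb) up// leq_subr.
by rewrite -(subnKC bn).
Qed.

Lemma onem_ge_expR (x : R) : 0 <= x <= 2^-1 -> expR (- (2 * x)) <= 1 - x.
Proof.
move=> /andP[x0 x1]; rewrite expRN -div1r ler_pdivrMr ?expR_gt0//.
apply: (@le_trans _ _ ((1 - x) * (1 + 2 * x))); first by nra.
by rewrite ler_wpM2l ?expR_ge1Dx//; lra.
Qed.

(** A step down from [b - j] multiplies the mass by [(b - j) / b], at least [1 - x] with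
    [x = 2 * k / s], hence at least [expR (- (2 * x))]. Over [2 * k * s] steps the exponents add up
    to [8 * k ^ 2], whatever [s]. *)
Lemma poisson_below_mode i : (i <= 2 * k * s)%N ->
  expR (- (8 * k%:R ^+ 2)) * p b <= p (b - i)%N.
Proof.
have sR : 0 < s%:R :> R by rewrite ltr0n.
pose x : R := 2 * k%:R / s%:R.
have x2 : 0 <= x <= 2^-1.
  apply/andP; split; first by rewrite divr_ge0// mulr_ge0.
  rewrite ler_pdivrMr//; have : (4 * k)%:R <= s%:R :> R by rewrite ler_nat.
  by rewrite natrM; lra.
pose q := expR (- (2 * x)).
have q01 : 0 <= q <= 1.
  rewrite expR_ge0/= -expR0 ler_expR oppr_le0; move: x2 => /andP[? _].
  by rewrite mulr_ge0.
have bound : (2 * k * s <= b)%N by rewrite /b expnS expn1 leq_mul2r; apply/orP; right; lia.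
have H j : (j <= 2 * k * s)%N -> q ^+ j * p b <= p (b - j)%N.
  elim: j => [|j IH] jks; first by rewrite expr0 mul1r subn0.
  have jb : (j < b)%N by exact: leq_trans jks bound.
  have := pS (b - j.+1)%N; rewrite subnSK// => E.
  rewrite -(ler_pM2l b0) -E; apply: (@le_trans _ _ ((b - j)%:R * (q ^+ j * p b))); last first.
    by rewrite ler_wpM2l// IH// ltnW.
  have -> : b%:R * (q ^+ j.+1 * p b) = b%:R * q * (q ^+ j * p b) by rewrite exprS !mulrA.
  rewrite ler_wpM2r ?mulr_ge0 ?exprn_ge0//; first by case/andP: q01.
  rewrite natrB ?(ltnW jb)//.
  apply: (@le_trans _ _ (b%:R * (1 - x))); first by rewrite ler_wpM2l ?onem_ge_expR// ltW.
  rewrite mulrBr mulr1 lerB// /x /b natrX expr2.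
  have -> : s%:R * s%:R * (2 * k%:R / s%:R) = (2 * k * s)%:R :> R.
    by rewrite !natrM; move: (s%:R) sR => u u0; field; rewrite gt_eqF.
  by rewrite ler_nat ltnW.
move=> iks; apply: le_trans (H i iks); rewrite ler_wpM2r//.
apply: (@le_trans _ _ (q ^+ (2 * k * s))).
  rewrite /q -expRM_natl ler_expR /x.
  rewrite le_eqVlt; apply/orP; left; apply/eqP.
  by rewrite !natrM; move: (s%:R) (k%:R) sR => u v u0; field; rewrite gt_eqF.
by move: q01 => /andP[q0 q1]; apply: ler_wiXn2l.
Qed.

(** The [s] values starting [k * s] below the mode stay within [2 * k * s] of it as [k >= 1], and
    the mode has mass at least [3 / (16 * s)]. *)
Lemma poisson_lower_sum : (0 < k)%N -> 3 / 4 <= (4 * s)%:R * p b ->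
  3 / 16 * expR (- (8 * k%:R ^+ 2)) <= \sum_(i < s) p (b - (k * s + i))%N.
Proof.
move=> k0 pb; have sR : 0 < s%:R :> R by rewrite ltr0n.
apply: (@le_trans _ _ (\sum_(i < s) expR (- (8 * k%:R ^+ 2)) * p b)); last first.
  apply: ler_sum => i _; apply: poisson_below_mode.
  have := ltn_ord i; nia.
rewrite sumr_const card_ord -[leRHS]mulr_natr; move: pb; rewrite natrM.
have := expR_gt0 (- (8 * k%:R ^+ 2) : R); move: (expR _) (p b) (s%:R) => e y z e0 H.
by have := ler_wpM2l (ltW e0) H; lra.
Qed.

End poisson_mode.

(** * Absence of explosion at criticality *)

Section growing_annuli.
Variable a0 : nat.
Hypothesis a0_gt0 : (0 < a0)%N.

Definition growing_area (n : nat) : nat := iter n (fun a => a + a ^ 2)%N a0.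

Lemma growing_areaS n : growing_area n.+1 = (growing_area n + growing_area n ^ 2)%N.
Proof. by []. Qed.

Lemma growing_area_ge n : (a0 <= growing_area n)%N.
Proof. by elim: n => // n IH; rewrite growing_areaS (leq_trans IH)// leq_addr. Qed.

Lemma growing_area_gt0 n : (0 < growing_area n)%N.
Proof. exact: leq_trans a0_gt0 (growing_area_ge n). Qed.

Lemma le_growing_area m n : (m <= n)%N -> (growing_area m <= growing_area n)%N.
Proof.
elim: n => [|n IH]; first by rewrite leqn0 => /eqP ->.
rewrite leq_eqVlt => /predU1P[->//|/IH/leq_trans]; apply.
by rewrite growing_areaS leq_addr.
Qed.

Context {R : realType}.

(** With [a] the area, the right side is [1 / a] times [2 * a / (1 + a)], and [a >= 1]. Failure
    probabilities of order [1 / a] are summable in this way. *)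
Lemma growing_area_telescope n :
  (growing_area n)%:R^-1 <= 2 / (growing_area n)%:R - 2 / (growing_area n.+1)%:R :> R.
Proof.
rewrite growing_areaS natrD natrX.
have a1 : 1 <= (growing_area n)%:R :> R by rewrite ler1n growing_area_gt0.
move: ((growing_area n)%:R : R) a1 => a a1; have a0' : 0 < a by lra.
have q : 0 < a + a ^+ 2 by nra.
rewrite (_ : 2 / a - 2 / (a + a ^+ 2) = a^-1 * (2 * a / (1 + a))); last first.
  by field; rewrite !gt_eqF//; lra.
by rewrite ler_pMr ?invr_gt0// ler_pdivlMr; lra.
Qed.

Definition growing_radius (n : nat) : R := Num.sqrt ((growing_area n)%:R / pi).

Lemma growing_radius_gt0 n : 0 < growing_radius n.
Proof. by rewrite sqrtr_gt0 divr_gt0 ?pi_gt0// ltr0n growing_area_gt0. Qed.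

Lemma darea_growing_radius n : (darea (growing_radius n)%:E = (growing_area n)%:R%:E)%E.
Proof.
rewrite /darea -EFin_expe -EFinM sqr_sqrtr ?divr_ge0 ?pi_ge0//.
by rewrite divfK// gt_eqF// pi_gt0.
Qed.

Lemma le_growing_radius m n : (m <= n)%N -> growing_radius m <= growing_radius n.
Proof.
move=> mn; rewrite ler_sqrt ?divr_ge0 ?pi_ge0//.
by rewrite ler_pM2r ?invr_gt0 ?pi_gt0// ler_nat le_growing_area.
Qed.

(** The outer radius, and with it the mean number of entering particles, is on the scale of the
    fluctuations in the annulus. *)
Lemma growing_radiusS_le n : growing_radius n.+1 <= (growing_area n)%:R.
Proof.
have a1 : 1 <= (growing_area n)%:R :> R by rewrite ler1n growing_area_gt0.
rewrite -[leRHS]ger0_norm// -sqrtr_sqr ler_sqrt ?sqr_ge0//.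
rewrite ler_pdivrMr ?pi_gt0// growing_areaS natrD natrX.
have := pi_ge2 R; move: ((growing_area n)%:R : R) a1 => a a1 p2.
by apply: (@le_trans _ _ (a ^+ 2 * 2)); [nra|rewrite ler_wpM2l ?sqr_ge0].
Qed.

Definition annulus n : set (plane R) :=
  disc (growing_radius n.+1)%:E `\` disc (growing_radius n)%:E.

Lemma measurable_annulus n : measurable (annulus n).
Proof. by apply: measurableD; exact: measurable_disc. Qed.

Lemma area_growing_disc n : (area (disc (growing_radius n)%:E : set (plane R)) = (growing_area n)%:R%:E)%E.
Proof. by rewrite area_disc ?growing_radius_gt0// darea_growing_radius. Qed.

Lemma area_annulus n : (area (annulus n) = ((growing_area n) ^ 2)%:R%:E)%E.
Proof.
rewrite measureD; [|exact: measurable_disc|exact: measurable_disc|].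
- rewrite (_ : _ `&` _ = disc (growing_radius n)%:E); last first.
    by apply/setIidPr; apply: disc_sub; rewrite lee_fin le_growing_radius.
  rewrite [X in (X - _)%E]area_growing_disc [X in (_ - X)%E]area_growing_disc.
  by rewrite -EFinB -natrB growing_areaS ?leq_addr// addKn.
- by rewrite [X in (X < _)%E]area_growing_disc ltry.
Qed.

Lemma trivIset_annulus : trivIset setT annulus.
Proof.
have lt_disj i j : (i < j)%N -> annulus i `&` annulus j = set0.
  move=> ij; apply/seteqP; split => // x [[xi _] [_ xj]]; apply: xj.
  by apply: disc_sub xi; rewrite lee_fin le_growing_radius.
apply/trivIsetP => i j _ _; case: ltngtP => // ij _; first exact: lt_disj.
by rewrite setIC lt_disj.
Qed.

End growing_annuli.

Section no_explosion.
Context d (T : measurableType d) (R : realType) (P : probability T R).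
Variables (X : nat -> T -> plane R) (N : nat -> R -> T -> nat)
  (nu : nat -> nat -> T -> plane R).
Hypothesis mX : forall i, measurable_fun setT (X i).
Hypothesis mN : forall i t, measurable_fun setT (N i t).
Hypothesis mnu : forall i m, measurable_fun setT (nu i m).
Hypothesis ppp : poisson_point_process P 1 X.
Hypothesis poissonN : forall i, poisson_process P 1 (N i).
Hypothesis gaussian : forall i m (A : set (plane R)), measurable A ->
  P [set w | A (nu i m w)] = std_gaussian2 A.
Hypothesis indep : mutually_independent P (source_events X N nu).
Local Open Scope ereal_scope.

Local Notation C A := (point_count X A).

Let mC A : measurable A -> measurable_fun setT (C A).
Proof. exact: measurable_point_count. Qed.

Let measurable_le (Z : T -> \bar R) c : measurable_fun setT Z -> measurable [set w | Z w <= c].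
Proof. by move=> mZ; rewrite -[X in measurable X]setTI; exact: emeasurable_fun_infty_c. Qed.

Let measurable_ge (Z : T -> \bar R) c : measurable_fun setT Z -> measurable [set w | c <= Z w].
Proof. by move=> mZ; rewrite -[X in measurable X]setTI; exact: emeasurable_fun_c_infty. Qed.

Lemma point_count_chebyshev A (m u : R) (E : set T) : measurable A -> area A = m%:E ->
  measurable E -> (forall w, E w -> C A w <= (m - u)%:E \/ (m + u)%:E <= C A w) ->
  (0 <= u)%R -> (u ^+ 2)%:E * P E <= m%:E.
Proof.
move=> mA Am; apply: (particle_chebyshev ltr01 mX mN mnu ppp poissonN gaussian indep
  (lexx 0%R) (F := [set z | A z.1])).
  exact: (measurable_preim (@measurable_fst _ _ (plane R) (marks R)) mA).
rewrite /mean_count mul1e.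
transitivity (\int[P]_w m%:E); first by apply: eq_integral => w _; rewrite -Am.
by rewrite integral_cst// [X in _ * X]probability_setT mule1.
Qed.

(** The bound does not depend on [s], so all annuli offer the same chance of a deficit of [k]
    standard deviations. *)
Lemma low_count_prob A (s k : nat) : measurable A -> area A = (s ^ 2)%:R%:E ->
  (0 < k)%N -> (4 * k <= s)%N ->
  (3 / 16 * expR (- (8 * k%:R ^+ 2)))%:E <= P [set w | C A w <= (s ^ 2 - k * s)%:R%:E].
Proof.
move=> mA Am k0 ks; have s0 : (0 < s)%N by lia.
have mCA := mC mA.
have Afin : area A < +oo by rewrite Am ltry.
pose p n := fine (P [set w | C A w = n%:R%:E]).
have mp n : measurable [set w | C A w = n%:R%:E].
  exact: (measurable_preim mCA (emeasurable_set1 _)).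
have pE n : P [set w | C A w = n%:R%:E] = (p n)%:E by rewrite fineK// fin_num_measure.
have p0 n : (0 <= p n)%R by rewrite fine_ge0.
have pS n : (n.+1%:R * p n.+1 = (s ^ 2)%:R * p n)%R.
  apply/EFin_inj; rewrite !EFinM -!pE !(point_count_law ppp)//.
  by rewrite poissonS Am mul1r.
have bound : (2 * k * s <= s ^ 2)%N by rewrite expnS expn1 leq_mul2r; apply/orP; right; lia.
pose E := [set w | C A w <= ((s ^ 2)%:R - 2 * s%:R)%:E] `|` [set w | ((s ^ 2)%:R + 2 * s%:R)%:E <= C A w].
have mE : measurable E by apply: measurableU; [exact: measurable_le|exact: measurable_ge].
have PE : (fine (P E) <= 1 / 4)%R.
  have := @point_count_chebyshev A (s ^ 2)%:R (2 * s%:R) E mA Am mE.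
  rewrite -(fineK (fin_num_measure P _ mE)) -EFinM !lee_fin => H.
  have {}H : ((2 * s%:R) ^+ 2 * fine (P E) <= (s ^ 2)%:R)%R by apply: H => //; rewrite mulr_ge0.
  have s2 : (0 < (s ^ 2)%:R :> R)%R by rewrite ltr0n expn_gt0 s0.
  rewrite -(ler_pM2l s2); move: H; rewrite exprMn -natrX; lra.
(* Chebyshev leaves mass at least 3/4 on a window of [4 * s] values around the mean, none of which
   has more mass than the mode. *)
have window : (3 / 4 <= (4 * s)%:R * p (s ^ 2)%N)%R.
  pose W := \big[setU/set0]_(i < 4 * s) [set w | C A w = (s ^ 2 - 2 * s + i)%:R%:E].
  have mW : measurable W by apply: bigsetU_measurable => i _; exact: mp.
  have CEW : ~` E `<=` W.
    move=> w /= /not_orP[/negP + /negP]; rewrite -!ltNge => lo hi.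
    have [c Cc] := counting_natP (lt_trans hi (ltry _)).
    rewrite -[counting _]/(C A w) in Cc.
    move: lo hi; rewrite Cc !lte_fin => lo hi.
    have lo' : (s ^ 2 < c + 2 * s)%N by rewrite -(@ltr_nat R) natrD natrM; lra.
    have hi' : (c < s ^ 2 + 2 * s)%N by rewrite -(@ltr_nat R) natrD natrM.
    rewrite /W -(bigcup_mkord _ (fun i => [set w | C A w = (s ^ 2 - 2 * s + i)%:R%:E])).
    exists (c - (s ^ 2 - 2 * s))%N; first by rewrite /=; lia.
    by rewrite /= subnKC//; lia.
  have PW : P W <= ((4 * s)%:R * p (s ^ 2)%N)%:E.
    apply: (@prob_bigsetU_le _ _ _ P _ (fun i => [set w | C A w = (s ^ 2 - 2 * s + i)%:R%:E])).
      by move=> i _; exact: mp.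
    by move=> i _; rewrite pE lee_fin; exact: poisson_mode.
  rewrite -lee_fin; apply: le_trans PW.
  apply: (@le_trans _ _ (P (~` E))); last by apply: le_measure; rewrite ?inE//; exact: measurableC.
  rewrite probability_setC// -(fineK (fin_num_measure P _ mE)) -EFinB lee_fin; lra.
have := poisson_lower_sum s0 ks p0 pS k0 window.
rewrite -lee_fin => /le_trans; apply.
rewrite -sumEFin; under eq_bigr do rewrite -pE.
rewrite -(@measure_semi_additive_ord_I _ _ _ P (fun i => [set w | C A w = (s ^ 2 - (k * s + i))%:R%:E]) s); first last.
- by apply: bigsetU_measurable => i _; exact: mp.
- apply/trivIsetP => i j /= si sj ij; apply/seteqP; split => // w [/= ->] [] /eqP.
  rewrite eqr_nat => /eqP H; move: ij; rewrite (_ : i = j) ?eqxx//; nia.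
- by move=> i _; exact: mp.
apply: le_measure; rewrite ?inE; [|exact: measurable_le|].
- by apply: bigsetU_measurable => i _; exact: mp.
- rewrite -(bigcup_mkord s (fun i => [set w | C A w = (s ^ 2 - (k * s + i))%:R%:E])).
  by move=> w [i /= _ ->]; rewrite lee_fin ler_nat; lia.
Qed.

Lemma visited_count_le w t rho : (0 <= t)%R -> (0 <= rho)%R ->
  counting [set i | exists2 s : R, (0 <= s <= t)%R & disc rho%:E (walk X N nu w i s)] <=
  C (disc rho%:E) w + particle_count X N nu t (visiting rho) w.
Proof.
move=> t0 rho0; rewrite /point_count /particle_count -countingU; last first.
  by apply/seteqP; split => // i [/= Xi [/= nXi _]]; exact: nXi.
apply: le_counting => i [s /andP[s0 st] ds].
have [Xi|nXi] := pselect (disc rho%:E (X i w)); [by left|right; split => //].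
exists (N i t w); split => //=.
rewrite /disc /= lee_fin in ds.
rewrite -[X i w](addrK (\sum_(m < N i s w) nu i m w)%R).
apply: le_trans (euclidD _ _) _; rewrite euclidN lerD//.
apply: (@le_trans _ _ (\sum_(m < N i s w) euclid (nu i m w))%R).
  elim: (N i s w) => [|n IH]; first by rewrite !big_ord0 /euclid /= expr0n /= addr0 sqrtr0.
  by rewrite !big_ord_recr/=; apply: le_trans (euclidD _ _) _; rewrite lerD2r.
have [_ Nmono _ _ _] := poissonN i.
rewrite -!(big_mkord xpredT (fun m => euclid (nu i m w))).
rewrite (big_cat_nat (n := N i s w) (p := N i t w))//=; last exact: Nmono.
by rewrite lerDl sumr_ge0// => m _; exact: euclid_ge0.
Qed.

Let prod_le n (f : 'I_n -> \bar R) (c : R) :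
  (forall k, 0 <= f k <= c%:E) -> \prod_(k < n) f k <= (c ^+ n)%:E.
Proof.
elim: n f => [|n IH] f Hf; first by rewrite big_ord0.
rewrite big_ord_recl exprS EFinM; apply: lee_pmul.
- by case/andP: (Hf ord0).
- by apply: prode_ge0 => k _; case/andP: (Hf (lift ord0 k)).
- by case/andP: (Hf ord0).
- exact: IH.
Qed.

Lemma enclosing_disc_ae t : (0 <= t)%R -> P.-negligible [set w | ~ exists2 rho : R, (0 <= rho)%R &
  1 + counting [set i | exists2 s : R, (0 <= s <= t)%R & disc rho%:E (walk X N nu w i s)] <=
  darea rho%:E].
Proof.
move=> t0; have [K0 K00 HK0] := mean_visiting_le ltr01 mN mnu poissonN gaussian indep t0.
have [K HK] : exists K : nat, forall rho, (0 < rho)%R ->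
    mean_count P 1 N nu t (visiting rho) <= (K%:R * (1 + rho))%:E.
  exists (Num.truncn K0).+1 => rho rho0; apply: le_trans (HK0 _ rho0) _; rewrite lee_fin ler_wpM2r//.
    by rewrite addr_ge0// ltW.
  by rewrite ltW// truncnS_gt.
apply: negligible_small => e e0.
(* With [a] the inner area, the inner disc contributes fewer than [2 * a] particles, those entering
   fewer than [(2 * K + 1) * a], and the pool starts with area 1. Against the outer area
   [a + a ^ 2], a deficit of [(2 * K + 2) * a + 1] is needed in the annulus. *)
pose k := (2 * K + 3)%N.
pose c : R := (3 / 16 * expR (- (8 * k%:R ^+ 2)))%R.
have c01 : (0 < c <= 1)%R.
  rewrite mulr_gt0 ?expR_gt0//=.
  have : (expR (- (8 * k%:R ^+ 2)) <= 1 :> R)%R.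
    by rewrite -expR0 ler_expR oppr_le0 mulr_ge0// sqr_ge0.
  by rewrite /c; lra.
have /andP[c0 c1] := c01.
(* Among [m] independent annuli, all miss the deficit with probability at most [(1 - c) ^ m]. *)
have [m cm] : exists m, ((1 - c) ^+ m <= e / 2)%R.
  have e20 : (0 < e / 2)%R by rewrite divr_gt0.
  have : ((1 - c) ^+ n @[n --> \oo] --> (0 : R))%R by apply: cvg_expr; rewrite ger0_norm; lra.
  move/cvgr0_norm_le => /(_ _ e20)[n _ /(_ n (leqnn _))]; exists n.
  by rewrite -[leLHS]ger0_norm// exprn_ge0//; lra.
(* The first term gives the condition [4 * k <= s] of [low_count_prob] for all annuli, the second
   brings the total failure probability [(1 + 2 * K) * 2 / a0] below [e / 2]. *)
pose a0 := (4 * k + (Num.truncn ((4 * (1 + 2 * K%:R)) / e : R)%R).+1)%N.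
have a0_gt0 : (0 < a0)%N by rewrite /a0 addnS.
pose a := growing_area a0.
have a_gt0 n : (0 < a n)%N by exact: growing_area_gt0.
have aR n : (0 < (a n)%:R :> R)%R by rewrite ltr0n.
have ak n : (4 * k <= a n)%N by apply: leq_trans (growing_area_ge a0 n); exact: leq_addr.
pose rho n : R := growing_radius a0 n.
have rho0 n : (0 < rho n)%R by exact: growing_radius_gt0.
pose B n := [set w | C (annulus a0 n) w <= ((a n) ^ 2 - k * a n)%:R%:E].
have mB n : measurable (B n) by apply: measurable_le; apply: mC; exact: measurable_annulus.
have PB n : c%:E <= P (B n).
  by apply: low_count_prob; [exact: measurable_annulus|exact: area_annulus|rewrite /k addnS|].
pose bad1 n := [set w | (2 * (a n)%:R)%:E <= C (disc (rho n)%:E) w].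
have mb1 n : measurable (bad1 n) by apply: measurable_ge; apply: mC; exact: measurable_disc.
have Pb1 n : P (bad1 n) <= ((a n)%:R^-1)%:E.
  have := @point_count_chebyshev _ (a n)%:R (a n)%:R (bad1 n) (measurable_disc _) (area_growing_disc a0_gt0 n) (mb1 n).
  rewrite -(fineK (fin_num_measure P _ (mb1 n))) -EFinM !lee_fin => H.
  rewrite -(ler_pM2l (exprn_gt0 2 (aR n))) [leRHS](_ : _ = (a n)%:R)%R; last first.
    by move: ((a n)%:R : R) (aR n) => x x0; field; rewrite gt_eqF.
  apply: H => // w Hw; right; apply: le_trans Hw; rewrite lee_fin.
  by rewrite mulr2n mulrDl mul1r.
pose bad2 n := [set w | ((2 * K + 1)%:R * (a n)%:R)%:E <= particle_count X N nu t (visiting (rho n.+1)) w].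
have mb2 n : measurable (bad2 n).
  by apply: measurable_ge; apply: measurable_particle_count => //; exact: measurable_visiting.
have Pb2 n : P (bad2 n) <= (2 * K%:R / (a n)%:R)%:E.
  have := HK _ (rho0 n.+1).
  have mu0 : 0 <= mean_count P 1 N nu t (visiting (rho n.+1)).
    by rewrite /mean_count mule_ge0// integral_ge0.
  move muE : (mean_count _ _ _ _ _ _) mu0 => [mu| |]//; rewrite !lee_fin => mu0 muK.
  (* The mean is at most [K * (1 + rho (n + 1))], and both 1 and the outer radius are at most [a n];
     [bad2] leaves a margin of [a n] above it. *)
  have mua : (mu <= 2 * K%:R * (a n)%:R)%R.
    apply: le_trans muK _; rewrite -mulrA mulrCA ler_wpM2l//.
    have := growing_radiusS_le a0_gt0 n (R := R).
    have : (1 <= (a n)%:R :> R)%R by rewrite ler1n.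
    by rewrite /rho /a; lra.
  have := @particle_chebyshev _ T R P 1 X N nu ltr01 mX mN mnu ppp poissonN gaussian indep
    t (visiting (rho n.+1)) mu (a n)%:R (bad2 n) t0 (measurable_visiting _) muE (mb2 n).
  rewrite -(fineK (fin_num_measure P _ (mb2 n))) -EFinM !lee_fin => H.
  rewrite -(ler_pM2l (exprn_gt0 2 (aR n))) [leRHS](_ : _ = 2 * K%:R * (a n)%:R)%R; last first.
    by move: ((a n)%:R : R) (aR n) => x x0; field; rewrite gt_eqF.
  apply: (le_trans _ mua); apply: H => // w Hw; right; apply: le_trans Hw; rewrite lee_fin.
  rewrite (_ : (2 * K + 1)%:R = 2 * K%:R + 1 :> R)%R; last by rewrite natrD natrM.
  by rewrite mulrDl mul1r lerD2r.
have mBC : measurable (\bigcap_(n in [set: 'I_m]) (~` B n)).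
  by apply: fin_bigcap_measurable => [|n _]; [exact: finite_finset|exact: measurableC].
have mbad : measurable (\bigcup_n (bad1 n `|` bad2 n)).
  by apply: bigcupT_measurable => n; exact: measurableU.
exists (\bigcap_(n in [set: 'I_m]) (~` B n) `|` \bigcup_n (bad1 n `|` bad2 n)); split.
- exact: measurableU.
- move=> w H; apply: contrapT => /not_orP[/= nB nbad]; apply: H.
  have [n Bn] : exists n, B n w.
    by apply: contrapT => /forallNP H; apply: nB => n _; exact: H.
  have [nb1 nb2] : ~ bad1 n w /\ ~ bad2 n w.
    by split => H; apply: nbad; exists n => //; [left|right].
  exists (rho n.+1); first exact: ltW.
  rewrite darea_growing_radius.
  apply: (@le_trans _ _ (1 + (C (disc (rho n.+1)%:E) w + particle_count X N nu t (visiting (rho n.+1)) w))).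
    by rewrite leeD2l//; apply: visited_count_le => //; exact: ltW.
  have -> : C (disc (rho n.+1)%:E) w = C (disc (rho n)%:E) w + C (annulus a0 n) w.
    rewrite /point_count -countingU; last by apply/seteqP; split => // i [/= Xi [_ nXi]]; exact: nXi.
    congr counting; apply/seteqP; split => i /=.
      by move=> Xi; have [?|?] := pselect (disc (rho n)%:E (X i w)); [left|right].
    case=> [|[]//]; apply: disc_sub; rewrite lee_fin; exact: le_growing_radius.
  move/negP : nb1; move/negP : nb2; rewrite /bad1 /bad2 /= -!ltNge => v2 v1.
  apply: (@le_trans _ _ (1 + ((2 * (a n)%:R)%:E + ((a n) ^ 2 - k * a n)%:R%:E + ((2 * K + 1)%:R * (a n)%:R)%:E))).
    by rewrite leeD2l// leeD ?(ltW v2)// leeD// ltW.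
  have : (1 + (2 * a n + (a n ^ 2 - k * a n) + (2 * K + 1) * a n) <= a n + a n ^ 2)%N.
    have : (k * a n <= a n ^ 2)%N.
      by rewrite expnS expn1 leq_mul2r; apply/orP; right; have := ak n; lia.
    by have := a_gt0 n; move: (a n ^ 2)%N => q; rewrite /k; nia.
  rewrite -(ler_nat R) -!EFinD lee_fin -/a.
  by rewrite natrD (natrD _ _ ((2 * K + 1) * a n)) (natrD _ (2 * a n)) (natrM _ 2) (natrM _ (2 * K + 1)).
- apply: le_trans (measureU2 _ mBC mbad) _.
  rewrite [e]splitr EFinD leeD//.
    apply: (@le_trans _ _ ((1 - c) ^+ m)%:E); last by rewrite lee_fin.
    (* Only the starting points in disjoint annuli enter here, so the counts are independent; [bad1]
       and [bad2] are dependent and are left to the union bound. *)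
    pose E (n : 'I_m) : set (\bar R) := ~` [set x | x <= ((a n) ^ 2 - k * a n)%:R%:E].
    have := @point_count_indep _ T R P 1 X ppp m (fun n => annulus a0 n) E.
    rewrite (_ : \bigcap_k [set w | E k (C (annulus a0 k) w)] = \bigcap_(n in [set: 'I_m]) (~` B n))//.
    move=> PE; apply: (@le_trans _ _ (\prod_(n < m) P [set w | E n (C (annulus a0 n) w)])).
      rewrite le_eqVlt; apply/orP; left; apply/eqP; apply: PE.
      + by move=> n; exact: measurable_annulus.
      + by move=> n; rewrite [X in X < _]area_annulus// ltry.
      + have /trivIsetP tA := @trivIset_annulus a0 R.
        by apply/trivIsetP => i j _ _ ij; exact: tA.
      + move=> n; apply: measurableC; rewrite -set_itvNyc; exact: emeasurable_itv.
    apply: prod_le => n; rewrite measure_ge0/=.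
    rewrite (_ : [set w | _] = ~` B n)// probability_setC//.
    by rewrite EFinB leeB.
  apply: le_trans (@prob_bigcup_telescope _ _ _ P (fun n => bad1 n `|` bad2 n)
    (fun n => (1 + 2 * K%:R) * (2 / (a n)%:R))%R _ _ _) _.
  + by move=> n; exact: measurableU.
  + move=> n; apply: le_trans (measureU2 _ (mb1 n) (mb2 n)) _.
    apply: (@le_trans _ _ ((a n)%:R^-1 + 2 * K%:R / (a n)%:R)%:E); first by rewrite EFinD; exact: leeD (Pb1 n) (Pb2 n).
    rewrite lee_fin -mulrBr -{1}[((a n)%:R^-1)%R]mul1r -mulrDl.
    by apply: ler_wpM2l; [rewrite addr_ge0// mulr_ge0|exact: growing_area_telescope].
  + by move=> n; rewrite mulr_ge0// ?addr_ge0 ?mulr_ge0// divr_ge0.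
  rewrite lee_fin; change (a 0%N) with a0.
  have a0R : (0 < a0%:R :> R)%R by rewrite ltr0n.
  have : (4 * (1 + 2 * K%:R) / e <= a0%:R)%R.
    by rewrite natrD; apply: (le_trans (ltW (truncnS_gt _))); rewrite lerDr.
  rewrite ler_pdivrMr// mulrA ler_pdivrMr//; lra.
Qed.

Lemma walk_right_constant w i (t : R) : (0 <= t)%R ->
  exists2 e : R, (0 < e)%R & forall s, (t <= s < t + e)%R -> walk X N nu w i s = walk X N nu w i t.
Proof.
move=> t0; have [_ _ /(_ w t t0) rc _ _] := poissonN i.
(* For a clock with values in a discrete space, right continuity is local constancy. *)
have : \forall s \near t^'+, N i s w = N i t w.
  exact: (rc [set N i t w] (discrete_set1 _)).
move=> /nbhs_ballP[e /= e0 He]; exists e => // s /andP[ts se].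
rewrite /walk; suff -> : N i s w = N i t w by [].
move: ts; rewrite le_eqVlt => /predU1P[<-//|ts]; apply: He => //.
by rewrite /ball /= distrC ger0_norm ?subr_ge0 ?(ltW ts)// ltrBlDl.
Qed.

Lemma no_explosion_ae : P.-negligible [set w | ~ explosion_time (walk X N nu w) = +oo].
Proof.
apply: negligibleS (negligible_bigcup (fun n : nat => enclosing_disc_ae (ler0n R n))) => w /= H.
apply: contrapT => H'; apply: H; rewrite /explosion_time.
rewrite (_ : [set t%:E | t in _] = set0) ?ereal_inf0//.
apply/seteqP; split => // x [t [t0 rt] _].
pose n := (Num.truncn t).+1; have tn : (t < n%:R)%R by exact: truncnS_gt.
have [rho rho0 Hrho] : exists2 rho : R, (0 <= rho)%R &
    1 + counting [set i | exists2 s : R, (0 <= s <= n%:R)%R & disc rho%:E (walk X N nu w i s)] <=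
    darea rho%:E.
  by apply: contrapT => nH; apply: H'; exists n.
have := pool_bounded rho0 (walk_right_constant w) Hrho (t := t).
by rewrite t0 tn rt => /(_ isT); rewrite leye_eq.
Qed.

End no_explosion.

Theorem theorem1p2 (R : realType) (d : measure_display) (T : measurableType d)
    (P : probability T R) (lambda : R)
    (X : nat -> {RV P >-> plane R}) (N : nat -> R -> {RV P >-> nat})
    (nu : nat -> nat -> {RV P >-> plane R}) :
  0 < lambda -> random_walks_from_ppp lambda X N nu ->
  (1 < lambda ->
     {ae P, forall w, (explosion_time (walk X N nu w) < +oo)%E}) /\
  (lambda = 1 ->
     {ae P, forall w, explosion_time (walk X N nu w) = +oo%E}).
Proof.
move=> lambda0 [ppp poissonN gaussian indep].
have mX i : measurable_fun setT (X i) by [].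
have mN i t : measurable_fun setT (N i t) by [].
have mnu i m : measurable_fun setT (nu i m) by [].
split => [l1|l1].
  exact: (explosion_finite_ae lambda0 mX mN mnu ppp poissonN gaussian indep l1).
rewrite l1 in ppp.
exact: (no_explosion_ae mX mN mnu ppp poissonN gaussian indep).
Qed.
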